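(* Let $L\in\mathcal{L}$ be such that $L$ and $L^*$ have order continuous norms. Let $\alpha_1,\dots,\alpha_m$ be positive numbers with $\sum_{j=1}^m\alpha_j\ge1$, let $n\in\mathbb{N}$, let $r\in\{\rho_{ess},\hat\rho_{ess}\}$, and let $\{\Psi_{ij}\}_{i=1,\dots,k;\ j=1,\dots,m}$ be bounded sets of nonnegative matrices that define operators on $L$. Then $$r\left(\left(\Psi_{11}^{(\alpha_1)}\circ\cdots\circ\Psi_{1m}^{(\alpha_m)}\right)+\cdots+\left(\Psi_{k1}^{(\alpha_1)}\circ\cdots\circ\Psi_{km}^{(\alpha_m)}\right)\right)\le r\left((\Psi_{11}+\cdots+\Psi_{k1})^{(\alpha_1)}\circ\cdots\circ(\Psi_{1m}+\cdots+\Psi_{km})^{(\alpha_m)}\right)$$ $$\le r\left(((\Psi_{11}+\cdots+\Psi_{k1})^n)^{(\alpha_1)}\circ\cdots\circ((\Psi_{1m}+\cdots+\Psi_{km})^n)^{(\alpha_m)}\right)^{1/n}\le r(\Psi_{11}+\cdots+\Psi_{k1})^{\alpha_1}\cdots r(\Psi_{1m}+\cdots+\Psi_{km})^{\alpha_m}.$$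
   Context: Let $R=\mathbb{N}$ or $R=\{1,\dots,N\}$. A Banach sequence space is a Banach space $L$ of complex sequences indexed by $R$ such that if $x$ is a complex sequence, $y\in L$ and $|x|\le|y|$ entrywise, then $x\in L$ and $\|x\|_L\le\|y\|_L$. $\mathcal{L}$ is the class of Banach sequence spaces containing every standard unit vector $e_n$ with $\|e_n\|_L=1$. A Banach lattice has order continuous norm if every decreasing net $0\le f_\alpha\downarrow0$ satisfies $\|f_\alpha\|\to0$; $L^*$ is the Banach dual of $L$. A nonnegative matrix $A=[a_{ij}]$ defines an operator on $L$ if $(Ax)_i=\sum_j a_{ij}x_j$ converges absolutely and $Ax\in L$ for all $x\in L$. Hadamard power $A^{(t)}=[a_{ij}^t]$, Hadamard product $A\circ B=[a_{ij}b_{ij}]$. For sets: $\Psi+\Sigma=\{A+B:A\in\Psi,B\in\Sigma\}$, $\Psi^n=\{A_1\cdots A_n: A_i\in\Psi\}$, and $\Psi_1^{(\alpha_1)}\circ\cdots\circ\Psi_m^{(\alpha_m)}=\{A_1^{(\alpha_1)}\circ\cdots\circ A_m^{(\alpha_m)}: A_j\in\Psi_j\}$. $\gamma(T)$ is the Hausdorff measure of noncompactness, $\rho_{ess}(T)$ the essential spectral radius. For a bounded set $\Sigma$ of operators: $\rho_{ess}(\Sigma)=\sup_m[\sup_{A\in\Sigma^m}\rho_{ess}(A)]^{1/m}$ (generalized essential spectral radius) and $\hat\rho_{ess}(\Sigma)=\lim_{m\to\infty}[\sup_{A\in\Sigma^m}\gamma(A)]^{1/m}$ (joint essential spectral radius).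 *)

(* Defs.v *)
From Stdlib Require Import Reals.
From Coquelicot Require Import Coquelicot.
Open Scope R_scope.

(* Index set R of the paper: [None] = N (all of nat), [Some N] = {0,...,N-1}. *)
Definition inRb (Rs : option nat) (i : nat) : bool :=
  match Rs with None => true | Some N => Nat.ltb i N end.

Definition seqC := nat -> C.          (* complex sequences (supported on R) *)
Definition mat := nat -> nat -> R.    (* real matrices indexed by R x R *)
Definition mset := mat -> Prop.

Definition szero : seqC := fun _ => RtoC 0.
Definition sadd (x y : seqC) : seqC := fun i => Cplus (x i) (y i).
Definition sscal (c : C) (x : seqC) : seqC := fun i => Cmult c (x i).
Definition ssub (x y : seqC) : seqC := fun i => Cminus (x i) (y i).
Definition unitv (n : nat) : seqC := fun i => if Nat.eqb i n then RtoC 1 else RtoC 0.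

Fixpoint fsum (k : nat) (f : nat -> R) : R :=
  match k with O => 0 | S k' => fsum k' f + f k' end.
Fixpoint fprod (k : nat) (f : nat -> R) : R :=
  match k with O => 1 | S k' => fprod k' f * f k' end.
Fixpoint fsumC (k : nat) (f : nat -> C) : C :=
  match k with O => RtoC 0 | S k' => Cplus (fsumC k' f) (f k') end.

(* nonnegative real power, 0^a := 0 (used only with a > 0) *)
Definition pw (x a : R) : R := if Rlt_dec 0 x then Rpower x a else 0.

(* sup / inf of a set of reals (sup of the empty set := 0) *)
Definition supR (E : R -> Prop) : R := real (Lub_Rbar E).
Definition infR (E : R -> Prop) : R := real (Glb_Rbar E).

Definition sumR (Rs : option nat) (f : nat -> R) : R :=
  Series (fun j => if inRb Rs j then f j else 0).

Definition Cseries (f : nat -> C) : C :=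
  (Series (fun j => Re (f j)), Series (fun j => Im (f j))).

Definition supported (Rs : option nat) (x : seqC) : Prop :=
  forall i, inRb Rs i = false -> x i = RtoC 0.

Definition is_BSS (Rs : option nat) (Lm : seqC -> Prop) (nrm : seqC -> R) : Prop :=
  (forall x, Lm x -> supported Rs x) /\
  Lm szero /\
  (forall x y, Lm x -> Lm y -> Lm (sadd x y)) /\
  (forall c x, Lm x -> Lm (sscal c x)) /\
  (forall x, Lm x -> 0 <= nrm x) /\
  (forall x, Lm x -> nrm x = 0 -> x = szero) /\
  (forall c x, Lm x -> nrm (sscal c x) = Cmod c * nrm x) /\
  (forall x y, Lm x -> Lm y -> nrm (sadd x y) <= nrm x + nrm y) /\
  (forall u : nat -> seqC, (forall p, Lm (u p)) ->
     (forall eps, 0 < eps -> exists N, forall p q, (N <= p)%nat -> (N <= q)%nat ->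
          nrm (ssub (u p) (u q)) < eps) ->
     exists l, Lm l /\ forall eps, 0 < eps -> exists N, forall p, (N <= p)%nat ->
          nrm (ssub (u p) l) < eps) /\
  (forall x y, supported Rs x -> Lm y -> (forall i, Cmod (x i) <= Cmod (y i)) ->
     Lm x /\ nrm x <= nrm y).

Definition in_class_L (Rs : option nat) (Lm : seqC -> Prop) (nrm : seqC -> R) : Prop :=
  is_BSS Rs Lm nrm /\
  forall n, inRb Rs n = true -> Lm (unitv n) /\ nrm (unitv n) = 1.

Definition directed {D : Type} (le : D -> D -> Prop) : Prop :=
  inhabited D /\ (forall a, le a a) /\ (forall a b c, le a b -> le b c -> le a c) /\
  (forall a b, exists c, le a c /\ le b c).

Definition isreal (x : seqC) : Prop := forall i, Im (x i) = 0.
Definition nonneg (x : seqC) : Prop := forall i, Im (x i) = 0 /\ 0 <= Re (x i).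

Definition order_cont_L (Lm : seqC -> Prop) (nrm : seqC -> R) : Prop :=
  forall (D : Type) (le : D -> D -> Prop) (f : D -> seqC),
    directed le ->
    (forall a, Lm (f a) /\ nonneg (f a)) ->
    (forall a b, le a b -> forall i, Re (f b i) <= Re (f a i)) ->
    (forall h, Lm h -> isreal h -> (forall a i, Re (h i) <= Re (f a i)) ->
       forall i, Re (h i) <= 0) ->
    forall eps, 0 < eps -> exists a0, forall a, le a0 a -> nrm (f a) < eps.

Definition is_dual (Lm : seqC -> Prop) (nrm : seqC -> R) (phi : seqC -> C) : Prop :=
  (forall x y, Lm x -> Lm y -> phi (sadd x y) = Cplus (phi x) (phi y)) /\
  (forall c x, Lm x -> phi (sscal c x) = Cmult c (phi x)) /\
  (exists M, forall x, Lm x -> Cmod (phi x) <= M * nrm x).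
Definition dual_real (Lm : seqC -> Prop) (phi : seqC -> C) : Prop :=
  forall x, Lm x -> isreal x -> Im (phi x) = 0.
Definition dual_pos (Lm : seqC -> Prop) (phi : seqC -> C) : Prop :=
  forall x, Lm x -> nonneg x -> Im (phi x) = 0 /\ 0 <= Re (phi x).

Definition order_cont_dual (Lm : seqC -> Prop) (nrm : seqC -> R) : Prop :=
  forall (D : Type) (le : D -> D -> Prop) (f : D -> seqC -> C),
    directed le ->
    (forall a, is_dual Lm nrm (f a) /\ dual_pos Lm (f a)) ->
    (forall a b, le a b -> forall x, Lm x -> nonneg x -> Re (f b x) <= Re (f a x)) ->
    (forall h, is_dual Lm nrm h -> dual_real Lm h ->
       (forall a x, Lm x -> nonneg x -> Re (h x) <= Re (f a x)) ->
       forall x, Lm x -> nonneg x -> Re (h x) <= 0) ->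
    forall eps, 0 < eps -> exists a0, forall a, le a0 a ->
      forall x, Lm x -> nrm x <= 1 -> Cmod (f a x) <= eps.

Definition matapp (Rs : option nat) (A : mat) (x : seqC) : seqC :=
  fun i => if inRb Rs i then
    Cseries (fun j => if inRb Rs j then Cmult (RtoC (A i j)) (x j) else RtoC 0)
  else RtoC 0.

Definition nonneg_mat (Rs : option nat) (A : mat) : Prop :=
  forall i j, inRb Rs i = true -> inRb Rs j = true -> 0 <= A i j.

Definition defines_op (Rs : option nat) (Lm : seqC -> Prop) (A : mat) : Prop :=
  forall x, Lm x ->
    (forall i, inRb Rs i = true ->
       ex_series (fun j => if inRb Rs j then A i j * Cmod (x j) else 0)) /\
    Lm (matapp Rs A x).

Definition bounded_set (Rs : option nat) (Lm : seqC -> Prop) (nrm : seqC -> R)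
  (Psi : mset) : Prop :=
  exists M, forall A, Psi A -> forall x, Lm x -> nrm (matapp Rs A x) <= M * nrm x.

Definition mmul (Rs : option nat) (A B : mat) : mat :=
  fun i j => sumR Rs (fun l => A i l * B l j).

Fixpoint mprodn (Rs : option nat) (A : nat -> mat) (n : nat) : mat :=
  match n with O => A O | S n' => mmul Rs (mprodn Rs A n') (A n) end.

Definition setsum (k : nat) (F : nat -> mset) : mset :=
  fun M => exists A : nat -> mat, (forall i, (i < k)%nat -> F i (A i)) /\
    M = (fun r s => fsum k (fun i => A i r s)).

(* Psi^n = { A_1 ... A_n : A_l in Psi }, n >= 1 *)
Definition setpow (Rs : option nat) (Psi : mset) (n : nat) : mset :=
  fun M => exists A : nat -> mat, (forall l, (l < n)%nat -> Psi (A l)) /\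
    M = mprodn Rs A (n - 1).

Definition hgeo (m : nat) (Phi : nat -> mset) (alpha : nat -> R) : mset :=
  fun M => exists A : nat -> mat, (forall j, (j < m)%nat -> Phi j (A j)) /\
    M = (fun r s => fprod m (fun j => pw (A j r s) (alpha j))).

Definition lincomb (d : nat) (c : nat -> C) (v : nat -> seqC) : seqC :=
  fun i => fsumC d (fun t => Cmult (c t) (v t i)).

Definition fredholm (Lm : seqC -> Prop) (T : seqC -> seqC) : Prop :=
  (exists (d : nat) (v : nat -> seqC), (forall t, (t < d)%nat -> Lm (v t)) /\
     forall x, Lm x -> T x = szero -> exists c : nat -> C, x = lincomb d c v) /\
  (exists (d : nat) (w : nat -> seqC), (forall t, (t < d)%nat -> Lm (w t)) /\
     forall y, Lm y -> exists x (c : nat -> C), Lm x /\ y = sadd (T x) (lincomb d c w)).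

Definition rho_ess_op (Rs : option nat) (Lm : seqC -> Prop) (A : mat) : R :=
  supR (fun r => exists lam : C,
     ~ fredholm Lm (fun x => ssub (sscal lam x) (matapp Rs A x)) /\ r = Cmod lam).

Definition gamma_op (Rs : option nat) (Lm : seqC -> Prop) (nrm : seqC -> R) (A : mat) : R :=
  infR (fun e => 0 < e /\ exists (d : nat) (c : nat -> seqC),
     (forall t, (t < d)%nat -> Lm (c t)) /\
     forall x, Lm x -> nrm x <= 1 ->
       exists t, (t < d)%nat /\ nrm (ssub (matapp Rs A x) (c t)) <= e).

Definition rho_ess_set (Rs : option nat) (Lm : seqC -> Prop) (Sig : mset) : R :=
  supR (fun r => exists m : nat, (1 <= m)%nat /\
     r = pw (supR (fun s => exists A, setpow Rs Sig m A /\ s = rho_ess_op Rs Lm A))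
            (/ INR m)).

Definition hat_rho_ess (Rs : option nat) (Lm : seqC -> Prop) (nrm : seqC -> R)
  (Sig : mset) : R :=
  real (Lim_seq (fun m => pw (supR (fun s => exists A, setpow Rs Sig (S m) A /\
                                         s = gamma_op Rs Lm nrm A))
                             (/ INR (S m)))).

(* Main.v *)
Require Import Defs.
From Stdlib Require Import Reals.
From Coquelicot Require Import Coquelicot.
From Stdlib Require Import Lra Lia Arith FunctionalExtensionality Classical ClassicalEpsilon.
Open Scope R_scope.

(** Order continuity of the norm of [L] means that the tails [Q_n x] tend to 0, whence
    [gamma A = inf_n |Q_n A|] for a nonnegative matrix [A]. On the rows of [Q_n A_j] the entries are
    at most [|Q_n A_j|], so weighted AM-GM bounds a Hadamard product entrywise by a linear
    combination of its factors; this yields [gamma (A_1^(a_1) o ... o A_m^(a_m)) <=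
    prod_j (gamma A_j)^(a_j)]. With Hoelder's inequality for the entries of products, this proves
    everything for the joint radius, whose defining limit exists by Fekete's lemma.

    For the generalized radius one needs [rho_ess A = lim (gamma (A^k))^(1/k) =: s]. If
    [|lambda| > s], then some [lambda^k - A^k] is a finite-rank perturbation of an invertible
    operator. Conversely [s - A] is not Fredholm: otherwise, by Baire's theorem, [s - A] is
    approximately open modulo a finite-dimensional space, so that with [B = A / t] and [t] slightly
    larger than [s] the sums [S_k = B + ... + B^k] satisfy [gamma S_k <= M] uniformly in [k] and
    [t]. As [S_k^2 >= k B^(k+1)] by positivity, [k (s / t)^(k+1) <= M^2], and [t -> s] gives
    [k <= M^2] for all [k]. *)

(** Fredholmness does not see the entrywise order, so neither monotonicity of [rho_ess_op] nor its
    behaviour under Hadamard products can be read off its definition; the formula with powers and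
    [gamma_op] makes both accessible. Its lower half needs a non-Fredholm point of modulus [s], and
    positivity singles out [lambda = s]: in [S_k^2] all contributions add up and nothing cancels.
    The case [s = 0] is separate and trivial.

    The two radii treat powers differently. [gamma_op] is submultiplicative, so the joint radius is
    a Fekete limit. [rho_ess_op] is in general not submultiplicative; for the generalized radius
    this is replaced by [rho(A)^n <= rho(A^n)], which makes the normalised suprema grow along
    multiples. After that both radii obey one comparison principle: if every word of length [p l] in
    one set is controlled by words of length [n l] in other sets, the radii satisfy the
    corresponding inequality. The three inequalities of the theorem are then three entrywise
    dominations between matrix words. *)

Lemma choice_lt {T : Type} (x0 : T) (l : nat) (P : nat -> T -> Prop) :
  (forall i, (i < l)%nat -> exists x, P i x) -> exists f, forall i, (i < l)%nat -> P i (f i).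
Proof.
  intros H.
  assert (Hc : forall i, exists x, (i < l)%nat -> P i x).
  { intros i; destruct (classic (i < l)%nat) as [Hi|Hi]; [|exists x0; tauto].
    destruct (H i Hi) as [x Hx]; exists x; auto. }
  exists (fun i => proj1_sig (constructive_indefinite_description _ (Hc i))).
  intros i; apply (proj2_sig (constructive_indefinite_description _ (Hc i))).
Qed.

(** * Finite sums and products *)

Lemma fsum_le (m : nat) (f g : nat -> R) :
  (forall j, (j < m)%nat -> f j <= g j) -> fsum m f <= fsum m g.
Proof.
  induction m as [|m IH]; simpl; intros H; [lra|].
  assert (H1 := H m ltac:(lia)).
  assert (fsum m f <= fsum m g) by (apply IH; intros; apply H; lia). lra.
Qed.

Lemma fsum_ext (m : nat) (f g : nat -> R) :
  (forall j, (j < m)%nat -> f j = g j) -> fsum m f = fsum m g.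
Proof.
  intros H; apply Rle_antisym; apply fsum_le; intros j Hj; rewrite (H j Hj); lra.
Qed.

Lemma fsum_ge0 (m : nat) (f : nat -> R) :
  (forall j, (j < m)%nat -> 0 <= f j) -> 0 <= fsum m f.
Proof.
  intros H; induction m as [|m IH]; simpl; [lra|].
  assert (H1 := H m ltac:(lia)).
  assert (0 <= fsum m f) by (apply IH; intros; apply H; lia). lra.
Qed.

Lemma fsum_term_le (m j : nat) (f : nat -> R) :
  (forall i, (i < m)%nat -> 0 <= f i) -> (j < m)%nat -> f j <= fsum m f.
Proof.
  intros H Hj; induction m as [|m IH]; [lia|]; simpl.
  assert (0 <= fsum m f) by (apply fsum_ge0; intros; apply H; lia).
  assert (0 <= f m) by (apply H; lia).
  destruct (Nat.eq_dec j m) as [->|Hne]; [lra|].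
  assert (f j <= fsum m f) by (apply IH; [intros; apply H|]; lia). lra.
Qed.

Lemma fsum_plus (m : nat) (f g : nat -> R) :
  fsum m (fun j => f j + g j) = fsum m f + fsum m g.
Proof. induction m as [|m IH]; simpl; [|rewrite IH]; ring. Qed.

Lemma fsum_scal (m : nat) (c : R) (f : nat -> R) :
  fsum m (fun j => c * f j) = c * fsum m f.
Proof. induction m as [|m IH]; simpl; [|rewrite IH]; ring. Qed.

Lemma sum_n_fsum (f : nat -> R) (p : nat) : sum_n f p = fsum (S p) f.
Proof.
  induction p as [|p IH].
  - rewrite sum_O; simpl; ring.
  - rewrite sum_Sn, IH; reflexivity.
Qed.

Lemma fprod_ge0 (m : nat) (f : nat -> R) :
  (forall j, (j < m)%nat -> 0 <= f j) -> 0 <= fprod m f.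
Proof.
  intros H; induction m as [|m IH]; simpl; [lra|].
  apply Rmult_le_pos; [apply IH; intros; apply H | apply H]; lia.
Qed.

Lemma fprod_le (m : nat) (f g : nat -> R) :
  (forall j, (j < m)%nat -> 0 <= f j <= g j) -> fprod m f <= fprod m g.
Proof.
  induction m as [|m IH]; simpl; intros H; [lra|].
  apply Rmult_le_compat.
  - apply fprod_ge0; intros; apply H; lia.
  - apply H; lia.
  - apply IH; intros; apply H; lia.
  - apply H; lia.
Qed.

Lemma fprod_ext (m : nat) (f g : nat -> R) :
  (forall j, (j < m)%nat -> f j = g j) -> fprod m f = fprod m g.
Proof.
  induction m as [|m IH]; simpl; intros H; [reflexivity|].
  rewrite IH, H by (try lia; intros; apply H; lia); reflexivity.
Qed.

Lemma fprod_mult (m : nat) (f g : nat -> R) :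
  fprod m (fun j => f j * g j) = fprod m f * fprod m g.
Proof. induction m as [|m IH]; simpl; [|rewrite IH]; ring. Qed.

Lemma fprod_eq0 (m j : nat) (f : nat -> R) :
  (j < m)%nat -> f j = 0 -> fprod m f = 0.
Proof.
  intros Hj H0; induction m as [|m IH]; [lia|]; simpl.
  destruct (Nat.eq_dec j m) as [->|Hne]; [rewrite H0; ring|].
  rewrite IH by lia; ring.
Qed.

(** * Real powers with the convention [0^a = 0] *)

Lemma pw_ge0 (x a : R) : 0 <= pw x a.
Proof. unfold pw; destruct (Rlt_dec 0 x); [apply Rlt_le, exp_pos|lra]. Qed.

Lemma pw_nonpos (x a : R) : x <= 0 -> pw x a = 0.
Proof. intros; unfold pw; destruct (Rlt_dec 0 x); lra. Qed.

Lemma pw_Rpower (x a : R) : 0 < x -> pw x a = Rpower x a.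
Proof. intros; unfold pw; destruct (Rlt_dec 0 x); lra. Qed.

Lemma pw_gt0 (x a : R) : 0 < x -> 0 < pw x a.
Proof. intros; rewrite pw_Rpower by assumption; apply exp_pos. Qed.

Lemma pw_le (x y a : R) : 0 < a -> x <= y -> pw x a <= pw y a.
Proof.
  intros Ha Hxy; destruct (Rle_or_lt x 0) as [Hx|Hx].
  - rewrite pw_nonpos by assumption; apply pw_ge0.
  - rewrite !pw_Rpower by lra; apply Rle_Rpower_l; lra.
Qed.

Lemma pw_mult (x y a : R) : 0 <= x -> 0 <= y -> pw (x * y) a = pw x a * pw y a.
Proof.
  intros [Hx|<-] [Hy|<-]; rewrite ?Rmult_0_l, ?Rmult_0_r, ?(pw_nonpos 0), ?Rmult_0_l, ?Rmult_0_r
    by lra; try reflexivity.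
  rewrite !pw_Rpower by (try assumption; apply Rmult_lt_0_compat; assumption).
  symmetry; apply Rpower_mult_distr; assumption.
Qed.

Lemma pw_pw (x a c : R) : pw (pw x a) c = pw x (a * c).
Proof.
  destruct (Rle_or_lt x 0) as [Hx|Hx].
  - rewrite !(pw_nonpos x) by assumption; apply pw_nonpos; lra.
  - rewrite (pw_Rpower (pw x a)) by (apply pw_gt0; assumption).
    rewrite !pw_Rpower by assumption; apply Rpower_mult.
Qed.

Lemma pw_1 (x : R) : 0 <= x -> pw x 1 = x.
Proof.
  intros [H|<-]; [|apply pw_nonpos; lra].
  rewrite pw_Rpower by assumption; apply Rpower_1; assumption.
Qed.

Lemma pw_INR (x : R) (n : nat) : 0 <= x -> (1 <= n)%nat -> pw x (INR n) = x ^ n.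
Proof.
  intros [H|<-] Hn; [rewrite pw_Rpower by assumption; apply Rpower_pow; assumption|].
  rewrite pw_nonpos by lra; destruct n; [lia|simpl; ring].
Qed.

Lemma INR_gt0 (n : nat) : (1 <= n)%nat -> 0 < INR n.
Proof. intros; apply lt_0_INR; lia. Qed.

Lemma inv_INR_gt0 (n : nat) : (1 <= n)%nat -> 0 < / INR n.
Proof. intros; apply Rinv_0_lt_compat, INR_gt0; assumption. Qed.

Lemma pow_pw_inv (x : R) (n : nat) : 0 <= x -> (1 <= n)%nat -> (pw x (/ INR n)) ^ n = x.
Proof.
  intros Hx Hn; rewrite <- pw_INR, pw_pw by (try apply pw_ge0; assumption).
  rewrite Rinv_l by (apply Rgt_not_eq, INR_gt0; assumption); apply pw_1; assumption.
Qed.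

Lemma pw_inv_pow (x : R) (n : nat) : 0 <= x -> (1 <= n)%nat -> pw (x ^ n) (/ INR n) = x.
Proof.
  intros Hx Hn; rewrite <- pw_INR, pw_pw by assumption.
  rewrite Rinv_r by (apply Rgt_not_eq, INR_gt0; assumption); apply pw_1; assumption.
Qed.

Lemma pw_fprod (m : nat) (f : nat -> R) (a : R) :
  (forall j, (j < m)%nat -> 0 <= f j) -> pw (fprod m f) a = fprod m (fun j => pw (f j) a).
Proof.
  intros H; induction m as [|m IH]; simpl.
  - rewrite pw_Rpower by lra; unfold Rpower; rewrite ln_1, Rmult_0_r, exp_0; reflexivity.
  - rewrite pw_mult, IH; try reflexivity; try (intros; apply H; lia).
    apply fprod_ge0; intros; apply H; lia.
Qed.

Lemma continuous_pw (a l : R) : 0 < a -> continuous (fun x => pw x a) l.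
Proof.
  intros Ha; destruct (Rtotal_order l 0) as [Hl|[->|Hl]].
  - apply continuous_ext_loc with (g := fun _ => 0); [|apply continuous_const].
    assert (Hd : 0 < - l) by lra; exists (mkposreal _ Hd); intros y Hy.
    apply Rabs_lt_between' in Hy; simpl in Hy; symmetry; apply pw_nonpos; lra.
  - apply filterlim_locally; intros eps; simpl.
    (* At 0 the modulus of continuity is [eps^(1/a)], the solution of [y^a = eps]. *)
    assert (Hd : 0 < Rpower eps (/ a)) by apply exp_pos.
    exists (mkposreal _ Hd); intros y Hy.
    apply Rabs_lt_between' in Hy; simpl in Hy.
    apply Rabs_lt_between'; rewrite (pw_nonpos 0) by lra.
    assert (H0 := pw_ge0 y a).
    assert (Heps := cond_pos eps).
    destruct (Rle_or_lt y 0) as [Hy0|Hy0]; [rewrite pw_nonpos by assumption; lra|].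
    assert (pw y a < eps); [|lra].
    rewrite pw_Rpower by assumption.
    replace (pos eps) with (Rpower (Rpower eps (/ a)) a)
      by (rewrite Rpower_mult, Rinv_l by lra; apply Rpower_1; assumption).
    unfold Rpower at 1 2; apply exp_increasing, Rmult_lt_compat_l; [assumption|].
    apply ln_increasing; lra.
  - apply continuous_ext_loc with (g := fun x => exp (a * ln x)).
    + exists (mkposreal _ Hl); intros y Hy.
      apply Rabs_lt_between' in Hy; simpl in Hy; symmetry; apply pw_Rpower; lra.
    + apply (ex_derive_continuous (fun x => exp (a * ln x)) l); auto_derive; assumption.
Qed.

Lemma is_lim_seq_pw (u : nat -> R) (l a : R) :
  0 < a -> is_lim_seq u l -> is_lim_seq (fun p => pw (u p) a) (pw l a).
Proof.
  intros Ha Hu; apply (filterlim_comp _ _ _ u (fun x => pw x a) _ (locally l) _ Hu).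
  apply continuous_pw; assumption.
Qed.

Lemma is_lim_seq_fprod (m : nat) (u : nat -> nat -> R) (l : nat -> R) :
  (forall j, (j < m)%nat -> is_lim_seq (u j) (l j)) ->
  is_lim_seq (fun p => fprod m (fun j => u j p)) (fprod m l).
Proof.
  intros H; induction m as [|m IH]; simpl; [apply is_lim_seq_const|].
  apply is_lim_seq_mult'; [apply IH; intros|]; apply H; lia.
Qed.

Lemma is_lim_seq_eps : is_lim_seq (fun p => / INR (S p)) 0.
Proof.
  apply (is_lim_seq_incr_1 (fun p => / INR p)).
  replace (Finite 0) with (Rbar_inv p_infty) by reflexivity.
  apply is_lim_seq_inv; [apply is_lim_seq_INR|discriminate].
Qed.

(** Tail estimates only reach [gamma + eps]; continuity of [pw], also at 0, lets [eps = 1/(p+1)]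
    tend to 0 inside the product. *)
Lemma le_fprod_pw_lim (m : nat) (alpha g : nat -> R) (x : R) :
  (forall j, (j < m)%nat -> 0 < alpha j) ->
  (forall eps, 0 < eps -> x <= fprod m (fun j => pw (g j + eps) (alpha j))) ->
  x <= fprod m (fun j => pw (g j) (alpha j)).
Proof.
  intros Ha H.
  assert (Hl : is_lim_seq (fun p => fprod m (fun j => pw (g j + / INR (S p)) (alpha j)))
                 (fprod m (fun j => pw (g j) (alpha j)))).
  { apply (is_lim_seq_fprod m (fun j p => pw (g j + / INR (S p)) (alpha j))); intros j Hj.
    apply (is_lim_seq_pw (fun p => g j + / INR (S p))); [apply Ha; assumption|].
    replace (Finite (g j)) with (Finite (g j + 0)) by (f_equal; ring).
    apply is_lim_seq_plus'; [apply is_lim_seq_const|apply is_lim_seq_eps]. }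
  apply (is_lim_seq_le (fun _ => x) _ x _ (fun p => H _ (inv_INR_gt0 (S p) ltac:(lia)))
           (is_lim_seq_const x) Hl).
Qed.

(** * The weighted AM-GM inequality *)

Lemma ln_le_sub_1 (x : R) : 0 < x -> ln x <= x - 1.
Proof.
  intros Hx; assert (H := exp_ineq1_le (ln x)); rewrite exp_ln in H by assumption; lra.
Qed.

(* Weighted AM-GM; since [b j <= 1], lowering the exponents to total weight 1 only increases
   the left-hand side. *)
Lemma fprod_pw_le_mean (m : nat) (alpha b : nat -> R) :
  (forall j, (j < m)%nat -> 0 < alpha j) -> 1 <= fsum m alpha ->
  (forall j, (j < m)%nat -> 0 <= b j <= 1) ->
  fprod m (fun j => pw (b j) (alpha j)) <= fsum m (fun j => alpha j / fsum m alpha * b j).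
Proof.
  intros Ha Hs Hb; set (sg := fsum m alpha) in *.
  assert (Hw : forall j, (j < m)%nat -> 0 < alpha j / sg)
    by (intros; apply Rdiv_lt_0_compat; [apply Ha; assumption|lra]).
  assert (Ht : forall j, (j < m)%nat -> 0 <= alpha j / sg * b j)
    by (intros; apply Rmult_le_pos; [apply Rlt_le, Hw|apply Hb]; assumption).
  (* A vanishing factor makes the product 0; otherwise all [b j] are positive and logarithms are
     available. *)
  destruct (classic (exists j, (j < m)%nat /\ b j = 0)) as [[j [Hj H0]]|Hne].
  { rewrite (fprod_eq0 m j); [apply fsum_ge0; assumption|assumption|].
    apply pw_nonpos; lra. }
  assert (Hb' : forall j, (j < m)%nat -> 0 < b j <= 1).
  { intros j Hj; destruct (Hb j Hj) as [[H|H] H1]; [lra|].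
    exfalso; apply Hne; exists j; split; [assumption|lra]. }
  assert (Hm : (0 < m)%nat) by (destruct m; [simpl in sg; unfold sg in Hs; lra|lia]).
  set (mean := fsum m (fun j => alpha j / sg * b j)) in *.
  assert (Hmean : 0 < mean).
  { apply Rlt_le_trans with (alpha 0%nat / sg * b 0%nat).
    - apply Rmult_lt_0_compat; [apply Hw|apply Hb']; assumption.
    - apply (fsum_term_le m 0 (fun j => alpha j / sg * b j)); assumption. }
  assert (Hexp : forall p, (p <= m)%nat -> fprod p (fun j => pw (b j) (alpha j))
                 = exp (fsum p (fun j => alpha j * ln (b j)))).
  { induction p as [|p IH]; intros Hp; simpl; [symmetry; apply exp_0|].
    rewrite IH, exp_plus by lia; rewrite pw_Rpower by (apply Hb'; lia); reflexivity. }
  rewrite Hexp by lia; rewrite <- (exp_ln mean) by assumption.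
  assert (exp_le : forall x y, x <= y -> exp x <= exp y)
    by (intros x y [Hxy|<-]; [apply Rlt_le, exp_increasing; assumption|lra]).
  apply exp_le.
  (* The line [ln mean + b / mean - 1] is tangent to [ln] at [mean] and lies above it; summed
     against the weights, its two correction terms cancel. *)
  apply Rle_trans with (fsum m (fun j => ln mean * (alpha j / sg)
                               + (/ mean * (alpha j / sg * b j) + (-1) * (alpha j / sg)))).
  - apply fsum_le; intros j Hj; destruct (Hb' j Hj) as [B0 B1].
    apply Rle_trans with (alpha j / sg * ln (b j)).
    + assert (ln (b j) <= 0) by (rewrite <- ln_1; apply ln_le; assumption).
      (* Here [sg >= 1] enters: since [ln (b j) <= 0], the smaller coefficient gives the larger
         term. *)
      assert (alpha j / sg <= alpha j).
      { apply Rmult_le_reg_r with sg; [lra|]; unfold Rdiv; rewrite Rmult_assoc, Rinv_l by lra.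
        assert (Haj := Ha j Hj); nra. }
      nra.
    + assert (H := ln_le_sub_1 (b j / mean) (Rdiv_lt_0_compat _ _ B0 Hmean)).
      unfold Rdiv in H at 1; rewrite ln_mult, ln_Rinv in H
        by (try apply Rinv_0_lt_compat; assumption).
      assert (Hwj := Hw j Hj).
      apply Rmult_le_compat_l with (r := alpha j / sg) in H; [|lra].
      unfold Rdiv in *; nra.
  - rewrite !fsum_plus, !fsum_scal; fold mean.
    replace (fsum m (fun j => alpha j / sg)) with 1.
    + right; field; lra.
    + rewrite (fsum_ext m _ (fun j => / sg * alpha j)) by (intros; unfold Rdiv; ring).
      rewrite fsum_scal; fold sg; field; lra.
Qed.

(** * Suprema and infima of sets of reals *)

(** [supR] sends an infinite supremum to the default 0, so it is a true least upper bound only for a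
    nonempty set that is bounded above. *)
Lemma supR_is_lub (E : R -> Prop) (K x : R) :
  (forall y, E y -> y <= K) -> E x -> is_lub E (supR E).
Proof.
  intros HK Hx; unfold supR.
  destruct (Lub_Rbar_correct E) as [H1 H2]; destruct (Lub_Rbar E) as [l| |]; simpl.
  - split; [intros y Hy; apply (H1 y Hy)|].
    intros c Hc; apply (H2 (Finite c)); intros y Hy; apply Hc; assumption.
  - exfalso; apply (H2 (Finite K)); intros y Hy; apply HK; assumption.
  - exfalso; apply (H1 x Hx).
Qed.

Lemma supR_ub (E : R -> Prop) (K x : R) :
  (forall y, E y -> y <= K) -> E x -> x <= supR E.
Proof. intros HK Hx; apply (supR_is_lub E K x); assumption. Qed.

Lemma supR_empty (E : R -> Prop) : (forall x, ~ E x) -> supR E = 0.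
Proof.
  intros H; unfold supR; replace (Lub_Rbar E) with m_infty; [reflexivity|].
  symmetry; apply is_lub_Rbar_unique; split; [intros x Hx; elim (H x Hx)|].
  intros [y| |] _; exact I.
Qed.

Lemma supR_le (E : R -> Prop) (K : R) :
  0 <= K -> (forall y, E y -> y <= K) -> supR E <= K.
Proof.
  intros H0 HK; destruct (classic (exists x, E x)) as [[x Hx]|Hne].
  - apply (supR_is_lub E K x); assumption.
  - rewrite supR_empty; [assumption|intros x Hx; apply Hne; exists x; assumption].
Qed.

Lemma supR_ge0 (E : R -> Prop) (K : R) :
  (forall y, E y -> 0 <= y <= K) -> 0 <= supR E.
Proof.
  intros HK; destruct (classic (exists x, E x)) as [[x Hx]|Hne].
  - apply Rle_trans with x; [apply HK; assumption|].
    apply (supR_ub E K); [intros; apply HK|]; assumption.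
  - rewrite supR_empty; [lra|intros x Hx; apply Hne; exists x; assumption].
Qed.

Lemma infR_is_glb (E : R -> Prop) (x : R) :
  (forall y, E y -> 0 <= y) -> E x ->
  (forall y, E y -> infR E <= y) /\ (forall c, (forall y, E y -> c <= y) -> c <= infR E).
Proof.
  intros H0 Hx; unfold infR.
  destruct (Glb_Rbar_correct E) as [H1 H2]; destruct (Glb_Rbar E) as [l| |]; simpl.
  - split; [intros y Hy; apply (H1 y Hy)|].
    intros c Hc; apply (H2 (Finite c)); intros y Hy; apply Hc; assumption.
  - exfalso; apply (H1 x Hx).
  - exfalso; apply (H2 (Finite 0)); intros y Hy; apply H0; assumption.
Qed.

(** * Fekete's lemma and comparison of radii *)

Lemma is_lim_seq_Rpower_inv (T : R) :
  is_lim_seq (fun p => Rpower T (/ INR (S p))) 1.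
Proof.
  unfold Rpower; rewrite <- exp_0.
  apply (is_lim_seq_continuous exp (fun p => / INR (S p) * ln T) 0).
  - apply derivable_continuous_pt, derivable_pt_exp.
  - replace (Finite 0) with (Finite (0 * ln T)) by (f_equal; ring).
    apply is_lim_seq_mult'; [apply is_lim_seq_eps|apply is_lim_seq_const].
Qed.

(** The limit is the infimum of the normalised sequence. The argument is multiplicative, without
    logarithms, because [s] may vanish. A block of length [m] that is nearly optimal governs all
    long words, and the remainder only costs a constant factor, whose roots tend to 1. *)
Lemma fekete (s : nat -> R) :
  (forall m, (1 <= m)%nat -> 0 <= s m) ->
  (forall m l, (1 <= m)%nat -> (1 <= l)%nat -> s (m + l)%nat <= s m * s l) ->
  exists I : R, 0 <= I /\ is_lim_seq (fun p => pw (s (S p)) (/ INR (S p))) I /\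
    forall m, (1 <= m)%nat -> I ^ m <= s m.
Proof.
  intros H0 Hsub; set (v := fun p => pw (s (S p)) (/ INR (S p))).
  set (E := fun x => exists p, x = v p).
  destruct (infR_is_glb E (v O)) as [G1 G2];
    [intros y [p ->]; apply pw_ge0 | exists O; reflexivity |].
  set (I := infR E) in *.
  assert (I0 : 0 <= I) by (apply G2; intros y [p ->]; apply pw_ge0).
  exists I; split; [assumption|split].
  - apply is_lim_seq_spec; intros eps; simpl.
    assert (Heps := cond_pos eps).
    assert (Hex : exists p, v p < I + eps / 2).
    { apply NNPP; intros Hn; assert (I + eps / 2 <= I); [|lra].
      apply G2; intros y [p ->]; apply Rnot_lt_le; intros Hp; apply Hn; exists p; assumption. }
    destruct Hex as [p0 Hp0]; set (c := I + eps / 2) in *; set (m := S p0).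
    assert (Hc : 0 < c) by (unfold c; lra).
    assert (Hm : s m <= c ^ m).
    { rewrite <- (pow_pw_inv (s m) m) by (try apply H0; unfold m; lia).
      apply pow_incr; split; [apply pw_ge0|apply Rlt_le, Hp0]. }
    (* [T] absorbs the finitely many remainders of length at most [m]. *)
    assert (HT : forall q, exists T, 1 <= T /\
              forall r, (1 <= r)%nat -> (r <= q)%nat -> s r <= T * c ^ r).
    { induction q as [|q [T [T1 HT]]]; [exists 1; split; [lra|intros; lia]|].
      exists (T + s (S q) / c ^ S q).
      assert (Hcq := pow_lt c (S q) Hc).
      assert (HS := H0 (S q) ltac:(lia)).
      assert (0 <= s (S q) / c ^ S q) by (apply Rdiv_le_0_compat; assumption).
      split; [lra|]; intros r R1 R2.
      destruct (Nat.eq_dec r (S q)) as [->|Hne].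
      - rewrite Rmult_plus_distr_r; unfold Rdiv; rewrite Rmult_assoc, Rinv_l by lra; nra.
      - assert (Hr := HT r R1 ltac:(lia)); assert (Hcr := pow_lt c r Hc); nra. }
    destruct (HT m) as [T [T1 HTm]].
    (* Strong induction: splitting off [m] factors costs [c ^ m], until the remainder has length at
       most [m]. *)
    assert (Hall : forall N, (1 <= N)%nat -> s N <= T * c ^ N).
    { induction N as [N IH] using (well_founded_induction Nat.lt_wf_0); intros HN.
      destruct (Nat.le_gt_cases N m) as [Hle|Hgt]; [apply HTm; assumption|].
      replace N with (m + (N - m))%nat by lia.
      eapply Rle_trans; [apply Hsub; unfold m in *; lia|].
      rewrite pow_add.
      assert (A := IH (N - m)%nat ltac:(unfold m in *; lia) ltac:(unfold m in *; lia)).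
      assert (B := H0 (N - m)%nat ltac:(unfold m in *; lia)).
      assert (D := pow_lt c m Hc).
      apply Rle_trans with (c ^ m * s (N - m)%nat); [apply Rmult_le_compat_r; assumption|].
      nra. }
    assert (Hlim : is_lim_seq (fun p => c * Rpower T (/ INR (S p))) (c * 1))
      by (apply is_lim_seq_mult'; [apply is_lim_seq_const|apply is_lim_seq_Rpower_inv]).
    apply is_lim_seq_spec in Hlim.
    assert (He2 : 0 < eps / 2) by lra.
    destruct (Hlim (mkposreal _ He2)) as [N HN]; simpl pos in HN.
    exists N; intros p Hp; specialize (HN p Hp); apply Rabs_lt_between' in HN.
    apply Rabs_lt_between'; split.
    + assert (I <= v p) by (apply G1; exists p; reflexivity); lra.
    + assert (v p <= c * Rpower T (/ INR (S p))); [|replace (I + eps) with (c * 1 + eps / 2) by (unfold c; field); lra].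
      unfold v; apply Rle_trans with (pw (T * c ^ S p) (/ INR (S p))).
      * apply pw_le; [apply inv_INR_gt0; lia|apply Hall; lia].
      * rewrite pw_mult, pw_inv_pow, pw_Rpower by (try apply pow_le; lra || lia).
        right; ring.
  - intros m Hm; destruct m as [|p]; [lia|].
    rewrite <- (pow_pw_inv (s (S p)) (S p)) by (try apply H0; lia).
    apply pow_incr; split; [assumption|apply G1; exists p; reflexivity].
Qed.

(* How the radius [r] of a set is read off its normalised sequence [v] (indexed from 1):
   as a limit for the joint radius, as a supremum for the generalized one. The condition
   [v l <= v (n * l)] makes the supremum insensitive to passing to multiples, as the limit is. *)
Definition radius_of (b : bool) (v : nat -> R) (r : R) : Prop :=
  if b then (forall l, (1 <= l)%nat -> v l <= r) /\
            (forall c, (forall l, (1 <= l)%nat -> v l <= c) -> r <= c) /\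
            (forall n l, (1 <= n)%nat -> (1 <= l)%nat -> v l <= v (n * l)%nat)
  else is_lim_seq (fun p => v (S p)) r.

(** For suprema each [v j l] is replaced by its bound [r j]; for limits the inequality passes to the
    limit of the product. *)
Lemma radius_of_le_prod (b : bool) (J : nat) (alpha : nat -> R) (v : nat -> nat -> R)
  (r : nat -> R) (w : nat -> R) (q : R) :
  (forall j, (j < J)%nat -> 0 < alpha j) ->
  (forall j, (j < J)%nat -> radius_of b (v j) (r j)) -> radius_of b w q ->
  (forall l, (1 <= l)%nat -> w l <= fprod J (fun j => pw (v j l) (alpha j))) ->
  q <= fprod J (fun j => pw (r j) (alpha j)).
Proof.
  intros Ha Hv Hw H; destruct b; simpl in *.
  - apply (proj1 (proj2 Hw)); intros l Hl; eapply Rle_trans; [apply H; assumption|].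
    apply fprod_le; intros j Hj; split; [apply pw_ge0|].
    apply pw_le; [apply Ha; assumption|apply Hv; assumption].
  - apply (is_lim_seq_le (fun p => w (S p)) (fun p => fprod J (fun j => pw (v j (S p)) (alpha j)))
             q (fprod J (fun j => pw (r j) (alpha j)))); [intros; apply H; lia|assumption|].
    apply (is_lim_seq_fprod J (fun j p => pw (v j (S p)) (alpha j))); intros j Hj.
    apply is_lim_seq_pw; [apply Ha|apply Hv]; assumption.
Qed.

(** A subsequence keeps the limit. The supremum over multiples of [n] is no smaller because
    [v l <= v (n * l)]. *)
Lemma radius_of_multiples (b : bool) (v : nat -> R) (r : R) (n : nat) :
  (1 <= n)%nat -> radius_of b v r -> radius_of b (fun l => v (n * l)%nat) r.
Proof.
  intros Hn Hv; destruct b; simpl in *.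
  - destruct Hv as [H1 [H2 H3]]; repeat split.
    + intros l Hl; apply H1; nia.
    + intros c Hc; apply H2; intros l Hl.
      apply Rle_trans with (v (n * l)%nat); [apply H3; assumption|apply Hc; assumption].
    + intros n' l Hn' Hl; replace (n * (n' * l))%nat with (n' * (n * l))%nat by ring.
      apply H3; nia.
  - apply (is_lim_seq_ext (fun p => v (S (n * S p - 1)))); [intros; f_equal; nia|].
    apply (is_lim_seq_subseq (fun p => v (S p)) r (fun p => (n * S p - 1)%nat)); [|assumption].
    apply eventually_subseq; intros p; nia.
Qed.

(** * Hoelder's inequality for finite sums *)

Lemma fsum_swap (n m : nat) (f : nat -> nat -> R) :
  fsum n (fun l => fsum m (fun q => f q l)) = fsum m (fun q => fsum n (fun l => f q l)).
Proof.
  induction n as [|n IH]; simpl.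
  - symmetry; rewrite (fsum_ext m _ (fun _ => 0 * 0)) by (intros; ring).
    rewrite fsum_scal; ring.
  - rewrite IH, <- fsum_plus; reflexivity.
Qed.

Lemma fsum_weights (m : nat) (alpha : nat -> R) :
  1 <= fsum m alpha -> fsum m (fun j => alpha j / fsum m alpha) = 1.
Proof.
  intros H; rewrite (fsum_ext m _ (fun j => / fsum m alpha * alpha j))
    by (intros; unfold Rdiv; ring).
  rewrite fsum_scal; field; lra.
Qed.

(** AM-GM for the normalised entries [b j / e j]. The bound is linear in [b], so it turns into a
    linear combination of matrices, to which norm estimates apply. *)
Lemma fprod_pw_le_scaled_mean (m : nat) (alpha b e : nat -> R) :
  (forall j, (j < m)%nat -> 0 < alpha j) -> 1 <= fsum m alpha ->
  (forall j, (j < m)%nat -> 0 < e j /\ 0 <= b j <= e j) ->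
  fprod m (fun j => pw (b j) (alpha j)) <=
  fprod m (fun j => pw (e j) (alpha j)) * fsum m (fun j => alpha j / fsum m alpha / e j * b j).
Proof.
  intros Ha Hs Hb.
  assert (Hb' : forall j, (j < m)%nat -> 0 <= b j / e j <= 1).
  { intros j Hj; destruct (Hb j Hj) as [He [H0 H1]].
    split; [apply Rdiv_le_0_compat; assumption|].
    apply Rmult_le_reg_r with (e j); [assumption|]; field_simplify; lra. }
  assert (H := fprod_pw_le_mean m alpha (fun j => b j / e j) Ha Hs Hb').
  rewrite (fprod_ext m (fun j => pw (b j) (alpha j))
             (fun j => pw (e j) (alpha j) * pw (b j / e j) (alpha j))).
  - rewrite fprod_mult; apply Rmult_le_compat_l; [apply fprod_ge0; intros; apply pw_ge0|].
    eapply Rle_trans; [apply H|]; right; apply fsum_ext; intros j Hj.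
    destruct (Hb j Hj); field; lra.
  - intros j Hj; destruct (Hb j Hj) as [He _].
    rewrite <- pw_mult by (try apply Hb'; assumption || lra); f_equal; field; lra.
Qed.

(** Each [u q l] is at most the total [c q], so AM-GM applies after scaling by [c q]. Summing over
    [l] replaces every [u q l / c q] by at most 1, and the weights add up to 1. *)
Lemma hoelder_fsum (n m : nat) (alpha c : nat -> R) (u : nat -> nat -> R) :
  (forall q, (q < m)%nat -> 0 < alpha q) -> 1 <= fsum m alpha ->
  (forall q l, (q < m)%nat -> (l < n)%nat -> 0 <= u q l) ->
  (forall q, (q < m)%nat -> fsum n (u q) <= c q) ->
  fsum n (fun l => fprod m (fun q => pw (u q l) (alpha q))) <=
  fprod m (fun q => pw (c q) (alpha q)).
Proof.
  intros Ha Hs Hu Hc.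
  assert (Hul : forall q l, (q < m)%nat -> (l < n)%nat -> u q l <= c q).
  { intros q l Hq Hl; eapply Rle_trans; [|apply Hc; assumption].
    apply fsum_term_le; [intros; apply Hu|]; assumption. }
  assert (HP : 0 <= fprod m (fun q => pw (c q) (alpha q)))
    by (apply fprod_ge0; intros; apply pw_ge0).
  (* A nonpositive total forces [u q] to vanish, hence every product on the left; otherwise division
     by [c q] is legitimate. *)
  destruct (classic (exists q, (q < m)%nat /\ c q <= 0)) as [[q [Hq H0]]|Hne].
  - eapply Rle_trans; [|apply HP]; right.
    rewrite (fsum_ext n _ (fun _ => 0 * 0)); [rewrite fsum_scal; ring|].
    intros l Hl; rewrite (fprod_eq0 m q); [ring|assumption|].
    apply pw_nonpos; apply Rle_trans with (c q); [apply Hul|]; assumption.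
  - assert (Hcq : forall q, (q < m)%nat -> 0 < c q)
      by (intros q Hq; apply Rnot_le_lt; intros H; apply Hne; exists q; split; assumption).
    eapply Rle_trans.
    { apply fsum_le; intros l Hl.
      apply (fprod_pw_le_scaled_mean m alpha (fun q => u q l) c Ha Hs).
      intros q Hq; split; [apply Hcq|split; [apply Hu|apply Hul]]; assumption. }
    rewrite fsum_scal, fsum_swap.
    rewrite <- (Rmult_1_r (fprod m (fun q => pw (c q) (alpha q)))) at 2.
    apply Rmult_le_compat_l; [assumption|].
    rewrite <- (fsum_weights m alpha Hs); apply fsum_le; intros q Hq.
    rewrite fsum_scal; assert (C0 := Hcq q Hq); assert (A0 := Ha q Hq).
    apply Rle_trans with (alpha q / fsum m alpha / c q * c q); [|right; field; lra].
    apply Rmult_le_compat_l; [|apply Hc; assumption].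
    apply Rlt_le, Rdiv_lt_0_compat, C0; apply Rdiv_lt_0_compat; lra.
Qed.

(** * Positive operators on a Banach sequence space *)

(** Monotone convergence: a bound on the partial sums gives summability and the bound on the sum at
    once. *)
Lemma ex_series_bounded (a : nat -> R) (K : R) :
  (forall j, 0 <= a j) -> (forall n, fsum n a <= K) -> ex_series a /\ Series a <= K.
Proof.
  intros H0 HK.
  assert (Hex : ex_series a).
  { destruct (ex_finite_lim_seq_incr (sum_n a) K) as [l Hl].
    - intros n; rewrite sum_Sn; assert (H := H0 (S n)); unfold plus; simpl; lra.
    - intros n; rewrite sum_n_fsum; apply HK.
    - exists l; exact Hl. }
  split; [assumption|].
  apply (is_lim_seq_le (sum_n a) (fun _ => K) (Series a) K).
  - intros n; rewrite sum_n_fsum; apply HK.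
  - exact (Series_correct a Hex).
  - apply is_lim_seq_const.
Qed.

Lemma Series_le_ex (a b : nat -> R) :
  (forall n, 0 <= a n <= b n) -> ex_series b -> ex_series a.
Proof.
  intros H; apply (ex_series_le a b); intros n.
  unfold norm; simpl; unfold abs; simpl; rewrite Rabs_pos_eq; apply H.
Qed.

Lemma Series_ge0 (a : nat -> R) : (forall n, 0 <= a n) -> ex_series a -> 0 <= Series a.
Proof.
  intros H Ha; replace 0 with (Series (fun _ : nat => 0 * 0)).
  - apply Series_le; [intros n; split; [lra|rewrite Rmult_0_l; apply H]|assumption].
  - rewrite Series_scal_l; ring.
Qed.

Lemma Series_zero : Series (fun _ : nat => 0) = 0.
Proof.
  rewrite (Series_ext _ (fun _ => 0 * 0)) by (intros; ring); rewrite Series_scal_l; ring.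
Qed.

Lemma fsum_single (m k : nat) (f : nat -> R) :
  fsum m (fun j => if Nat.eqb j k then f j else 0) = if Nat.ltb k m then f k else 0.
Proof.
  induction m as [|m IH]; simpl; [destruct (Nat.ltb_spec k 0); [lia|reflexivity]|].
  rewrite IH; destruct (Nat.eqb_spec m k) as [->|Hne].
  - destruct (Nat.ltb_spec k k); [lia|]; destruct (Nat.ltb_spec k (S k)); [ring|lia].
  - destruct (Nat.ltb_spec k m), (Nat.ltb_spec k (S m)); try lia; ring.
Qed.

Lemma is_series_single (k : nat) (f : nat -> R) :
  is_series (fun j => if Nat.eqb j k then f j else 0) (f k).
Proof.
  apply (is_lim_seq_ext_loc (fun _ => f k) (sum_n (fun j => if Nat.eqb j k then f j else 0)) (f k));
    [|apply is_lim_seq_const].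
  exists k; intros n Hn; rewrite sum_n_fsum, fsum_single.
  destruct (Nat.ltb_spec k (S n)); [reflexivity|lia].
Qed.

Lemma ex_series_Re_Im (f : nat -> C) :
  ex_series (fun j => Cmod (f j)) ->
  ex_series (fun j => Re (f j)) /\ ex_series (fun j => Im (f j)).
Proof.
  intros H; split.
  - apply (ex_series_le (fun j => Re (f j)) (fun j => Cmod (f j))); [|assumption].
    intros j; apply (Rle_trans _ (Rmax (Rabs (fst (f j))) (Rabs (snd (f j)))));
      [apply Rmax_l|apply Rmax_Cmod].
  - apply (ex_series_le (fun j => Im (f j)) (fun j => Cmod (f j))); [|assumption].
    intros j; apply (Rle_trans _ (Rmax (Rabs (fst (f j))) (Rabs (snd (f j)))));
      [apply Rmax_r|apply Rmax_Cmod].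
Qed.

Lemma Cseries_ext (f g : nat -> C) : (forall j, f j = g j) -> Cseries f = Cseries g.
Proof. intros H; unfold Cseries; f_equal; apply Series_ext; intros j; rewrite H; reflexivity. Qed.

Lemma Cseries_plus (f g : nat -> C) :
  ex_series (fun j => Cmod (f j)) -> ex_series (fun j => Cmod (g j)) ->
  Cseries (fun j => Cplus (f j) (g j)) = Cplus (Cseries f) (Cseries g).
Proof.
  intros Hf Hg; apply ex_series_Re_Im in Hf; apply ex_series_Re_Im in Hg.
  unfold Cseries, Cplus; simpl; f_equal; rewrite <- Series_plus by tauto;
    apply Series_ext; intros; reflexivity.
Qed.

Lemma Cseries_scal (c : C) (f : nat -> C) :
  ex_series (fun j => Cmod (f j)) ->
  Cseries (fun j => Cmult c (f j)) = Cmult c (Cseries f).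
Proof.
  intros Hf; apply ex_series_Re_Im in Hf; destruct Hf as [H1 H2].
  assert (E1 := ex_series_scal_l (V := R_NormedModule) (fst c) _ H1).
  assert (E2 := ex_series_scal_l (V := R_NormedModule) (snd c) _ H2).
  assert (E3 := ex_series_scal_l (V := R_NormedModule) (fst c) _ H2).
  assert (E4 := ex_series_scal_l (V := R_NormedModule) (snd c) _ H1).
  unfold scal in E1, E2, E3, E4; simpl in E1, E2, E3, E4.
  unfold mult in E1, E2, E3, E4; simpl in E1, E2, E3, E4.
  unfold Cseries, Cmult; simpl; f_equal.
  - rewrite <- !Series_scal_l, <- Series_minus by assumption.
    apply Series_ext; intros; unfold Re, Im; simpl; reflexivity.
  - rewrite <- !Series_scal_l, <- Series_plus by assumption.
    apply Series_ext; intros; unfold Re, Im; simpl; reflexivity.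
Qed.

Lemma Cseries_RtoC (f : nat -> R) : Cseries (fun j => RtoC (f j)) = RtoC (Series f).
Proof. unfold Cseries, RtoC; f_equal; simpl; apply Series_zero. Qed.

Lemma Re_mul_add_Im_mul_le (z w : C) : fst z * fst w + snd z * snd w <= Cmod z * Cmod w.
Proof.
  rewrite <- (Cmod_conj z), <- Cmod_mult.
  eapply Rle_trans; [|apply re_le_Cmod].
  eapply Rle_trans; [|apply Rle_abs].
  unfold Re, Cconj, Cmult; simpl; lra.
Qed.

(** With [z] the sum, [|z|^2] is the sum of the real parts of [conj z * f j], each at most
    [|z| |f j|]; then [|z|] is cancelled. This reduces the triangle inequality to real series. *)
Lemma Cmod_Cseries_le (f : nat -> C) :
  ex_series (fun j => Cmod (f j)) -> Cmod (Cseries f) <= Series (fun j => Cmod (f j)).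
Proof.
  intros Hf; destruct (ex_series_Re_Im f Hf) as [H1 H2].
  set (z := Cseries f).
  destruct (Req_dec (Cmod z) 0) as [H0|H0].
  { rewrite H0; apply Series_ge0; [intros; apply Cmod_ge_0|assumption]. }
  assert (Hz := Cmod_ge_0 z).
  apply Rmult_le_reg_l with (Cmod z); [lra|].
  replace (Cmod z * Cmod z) with (fst z * fst z + snd z * snd z)
    by (assert (H := Cmod2_alt z); unfold Re, Im in H; lra).
  unfold z at 2 4; simpl; rewrite <- !Series_scal_l.
  rewrite <- Series_plus.
  - apply (is_lim_seq_le
      (sum_n (fun n => fst z * Re (f n) + snd z * Im (f n))) (sum_n (fun n => Cmod z * Cmod (f n)))
      (Series (fun n => fst z * Re (f n) + snd z * Im (f n)))
      (Series (fun n => Cmod z * Cmod (f n)))).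
    + intros n; rewrite !sum_n_fsum; apply fsum_le; intros; apply Re_mul_add_Im_mul_le.
    + apply Series_correct, (ex_series_plus (V := R_NormedModule));
        apply (ex_series_scal_l (V := R_NormedModule)); assumption.
    + apply Series_correct, (ex_series_scal_l (V := R_NormedModule)); assumption.
  - apply (ex_series_scal_l (V := R_NormedModule)); assumption.
  - apply (ex_series_scal_l (V := R_NormedModule)); assumption.
Qed.

(** * Truncations and the lattice structure of the space *)

(** [tail n] is the projection [Q_n], and [head n] the complementary projection of finite rank. *)
Definition tail (n : nat) (x : seqC) : seqC := fun i => if Nat.ltb i n then RtoC 0 else x i.
Definition head (n : nat) (x : seqC) : seqC := fun i => if Nat.ltb i n then x i else RtoC 0.
Definition absv (x : seqC) : seqC := fun i => RtoC (Cmod (x i)).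

Ltac seq_ext :=
  apply functional_extensionality; intros ?i;
  unfold sadd, sscal, ssub, szero, tail, head in *.

Lemma head_plus_tail (n : nat) (x : seqC) : x = sadd (head n x) (tail n x).
Proof. seq_ext; destruct (Nat.ltb i n); ring. Qed.

Lemma tail_add (n : nat) (x y : seqC) : tail n (sadd x y) = sadd (tail n x) (tail n y).
Proof. seq_ext; destruct (Nat.ltb i n); ring. Qed.

Lemma tail_scal (n : nat) (c : C) (x : seqC) : tail n (sscal c x) = sscal c (tail n x).
Proof. seq_ext; destruct (Nat.ltb i n); ring. Qed.

Lemma tail_0 (x : seqC) : tail 0 x = x.
Proof. seq_ext; reflexivity. Qed.

Lemma RtoC_m1 : RtoC (-1) = Copp (RtoC 1).
Proof. unfold RtoC, Copp; simpl; f_equal; ring. Qed.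

Lemma sub_eq_add (x y : seqC) : ssub x y = sadd x (sscal (RtoC (-1)) y).
Proof. seq_ext; rewrite RtoC_m1; ring. Qed.

Lemma Cmod_absv (x : seqC) (i : nat) : Cmod (absv x i) = Cmod (x i).
Proof. unfold absv; rewrite Cmod_R, Rabs_pos_eq; [reflexivity|apply Cmod_ge_0]. Qed.

Lemma absv_absv (x : seqC) : absv (absv x) = absv x.
Proof. apply functional_extensionality; intros i; unfold absv at 1; rewrite Cmod_absv; reflexivity. Qed.

Section Space.
Context (Rs : option nat) (Lm : seqC -> Prop) (nrm : seqC -> R).
Context (HL : in_class_L Rs Lm nrm).

Lemma Lm_supported x : Lm x -> supported Rs x.
Proof. apply HL. Qed.
Lemma Lm_zero : Lm szero.
Proof. apply HL. Qed.
Lemma Lm_add x y : Lm x -> Lm y -> Lm (sadd x y).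
Proof. apply HL. Qed.
Lemma Lm_scal c x : Lm x -> Lm (sscal c x).
Proof. apply HL. Qed.
Lemma nrm_ge0 x : Lm x -> 0 <= nrm x.
Proof. apply HL. Qed.
Lemma nrm_eq0 x : Lm x -> nrm x = 0 -> x = szero.
Proof. apply HL. Qed.
Lemma nrm_scal c x : Lm x -> nrm (sscal c x) = Cmod c * nrm x.
Proof. apply HL. Qed.
Lemma nrm_add x y : Lm x -> Lm y -> nrm (sadd x y) <= nrm x + nrm y.
Proof. apply HL. Qed.
Lemma Lm_solid x y : supported Rs x -> Lm y -> (forall i, Cmod (x i) <= Cmod (y i)) ->
  Lm x /\ nrm x <= nrm y.
Proof. apply HL. Qed.
Lemma Lm_complete (u : nat -> seqC) : (forall p, Lm (u p)) ->
  (forall eps, 0 < eps -> exists N, forall p q, (N <= p)%nat -> (N <= q)%nat ->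
     nrm (ssub (u p) (u q)) < eps) ->
  exists l, Lm l /\ forall eps, 0 < eps -> exists N, forall p, (N <= p)%nat ->
     nrm (ssub (u p) l) < eps.
Proof. apply HL. Qed.
Lemma Lm_unitv i : inRb Rs i = true -> Lm (unitv i).
Proof. apply HL. Qed.
Lemma nrm_unitv i : inRb Rs i = true -> nrm (unitv i) = 1.
Proof. apply HL. Qed.

Lemma Lm_sub x y : Lm x -> Lm y -> Lm (ssub x y).
Proof. intros; rewrite sub_eq_add; apply Lm_add; [|apply Lm_scal]; assumption. Qed.

Lemma nrm_zero : nrm szero = 0.
Proof.
  replace szero with (sscal (RtoC 0) szero) by (seq_ext; ring).
  rewrite nrm_scal, Cmod_0 by apply Lm_zero; ring.
Qed.

Lemma Cmod_RtoC_m1 : Cmod (RtoC (-1)) = 1.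
Proof. rewrite Cmod_R, Rabs_left; lra. Qed.

Lemma nrm_sub_sym x y : Lm x -> Lm y -> nrm (ssub x y) = nrm (ssub y x).
Proof.
  intros; replace (ssub x y) with (sscal (RtoC (-1)) (ssub y x))
    by (seq_ext; rewrite RtoC_m1; ring).
  rewrite nrm_scal, Cmod_RtoC_m1 by (apply Lm_sub; assumption); ring.
Qed.

Lemma nrm_sub_le x y : Lm x -> Lm y -> nrm (ssub x y) <= nrm x + nrm y.
Proof.
  intros; rewrite sub_eq_add.
  eapply Rle_trans; [apply nrm_add; [|apply Lm_scal]; assumption|].
  rewrite nrm_scal, Cmod_RtoC_m1 by assumption; lra.
Qed.

Lemma nrm_sub_triangle x y z : Lm x -> Lm y -> Lm z ->
  nrm (ssub x z) <= nrm (ssub x y) + nrm (ssub y z).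
Proof.
  intros; replace (ssub x z) with (sadd (ssub x y) (ssub y z)) by (seq_ext; ring).
  apply nrm_add; apply Lm_sub; assumption.
Qed.

Lemma tail_solid n x : Lm x -> Lm (tail n x) /\ nrm (tail n x) <= nrm x.
Proof.
  intros H; apply Lm_solid; [|assumption|].
  - intros i Hi; unfold tail; destruct (Nat.ltb i n); [reflexivity|].
    apply (Lm_supported x H i Hi).
  - intros i; unfold tail; destruct (Nat.ltb i n); [rewrite Cmod_0; apply Cmod_ge_0|lra].
Qed.
Lemma Lm_tail n x : Lm x -> Lm (tail n x).
Proof. intros; apply tail_solid; assumption. Qed.
Lemma nrm_tail_le n x : Lm x -> nrm (tail n x) <= nrm x.
Proof. intros; apply tail_solid; assumption. Qed.

Lemma head_solid n x : Lm x -> Lm (head n x) /\ nrm (head n x) <= nrm x.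
Proof.
  intros H; apply Lm_solid; [|assumption|].
  - intros i Hi; unfold head; destruct (Nat.ltb i n); [|reflexivity].
    apply (Lm_supported x H i Hi).
  - intros i; unfold head; destruct (Nat.ltb i n); [lra|rewrite Cmod_0; apply Cmod_ge_0].
Qed.
Lemma Lm_head n x : Lm x -> Lm (head n x).
Proof. intros; apply head_solid; assumption. Qed.

Lemma nrm_tail_anti n n' x : (n <= n')%nat -> Lm x -> nrm (tail n' x) <= nrm (tail n x).
Proof.
  intros Hn H; apply Lm_solid; [apply Lm_supported, Lm_tail; assumption|apply Lm_tail; assumption|].
  intros i; unfold tail; destruct (Nat.ltb_spec i n), (Nat.ltb_spec i n'); try lia;
    rewrite ?Cmod_0; try apply Cmod_ge_0; lra.
Qed.

Lemma absv_solid x : Lm x -> Lm (absv x) /\ nrm (absv x) = nrm x.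
Proof.
  intros H.
  assert (Hs : supported Rs (absv x))
    by (intros i Hi; unfold absv; rewrite (Lm_supported x H i Hi), Cmod_0; reflexivity).
  assert (H1 : Lm (absv x) /\ nrm (absv x) <= nrm x)
    by (apply Lm_solid; [assumption|assumption|intros i; rewrite Cmod_absv; lra]).
  split; [apply H1|apply Rle_antisym; [apply H1|]].
  apply Lm_solid; [apply Lm_supported; assumption|apply H1|intros i; rewrite Cmod_absv; lra].
Qed.
Lemma Lm_absv x : Lm x -> Lm (absv x).
Proof. intros; apply absv_solid; assumption. Qed.
Lemma nrm_absv x : Lm x -> nrm (absv x) = nrm x.
Proof. intros; apply absv_solid; assumption. Qed.

(** By solidity [x] dominates [x i] times the unit vector, which has norm 1. *)
Lemma coord_le_nrm x i : Lm x -> Cmod (x i) <= nrm x.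
Proof.
  intros H; destruct (inRb Rs i) eqn:Hi.
  - assert (H1 : nrm (sscal (x i) (unitv i)) <= nrm x).
    { apply Lm_solid; [apply Lm_supported, Lm_scal, Lm_unitv; assumption|assumption|].
      intros j; unfold sscal, unitv; destruct (Nat.eqb_spec j i) as [->|Hne].
      - rewrite Cmult_1_r; lra.
      - rewrite Cmult_0_r, Cmod_0; apply Cmod_ge_0. }
    rewrite nrm_scal, nrm_unitv in H1 by (try apply Lm_unitv; assumption); lra.
  - rewrite (Lm_supported x H i Hi), Cmod_0; apply nrm_ge0; assumption.
Qed.

(** * Linear maps and nonnegative matrices *)

Definition linear (T : seqC -> seqC) : Prop :=
  (forall x y, Lm x -> Lm y -> T (sadd x y) = sadd (T x) (T y)) /\
  (forall c x, Lm x -> T (sscal c x) = sscal c (T x)).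

Lemma linear_zero T : linear T -> T szero = szero.
Proof.
  intros [_ H]; replace szero with (sscal (RtoC 0) szero) at 1 by (seq_ext; ring).
  rewrite H by apply Lm_zero; seq_ext; ring.
Qed.

Lemma linear_sub T x y : linear T -> Lm x -> Lm y -> T (ssub x y) = ssub (T x) (T y).
Proof.
  intros [H1 H2] Hx Hy; rewrite !sub_eq_add, H1, H2 by (try apply Lm_scal; assumption); reflexivity.
Qed.

Lemma head_succ n x : inRb Rs n = true -> head (S n) x = sadd (head n x) (sscal (x n) (unitv n)).
Proof.
  intros Hn; seq_ext; unfold unitv; destruct (Nat.eqb_spec i n) as [->|Hne].
  - destruct (Nat.ltb_spec n n), (Nat.ltb_spec n (S n)); try lia; ring.
  - destruct (Nat.ltb_spec i n), (Nat.ltb_spec i (S n)); try lia; ring.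
Qed.

Lemma head_succ_out n x : inRb Rs n = false -> Lm x -> head (S n) x = head n x.
Proof.
  intros Hn H; seq_ext; destruct (Nat.ltb_spec i n), (Nat.ltb_spec i (S n)); try lia; try reflexivity.
  replace i with n by lia; apply (Lm_supported x H n Hn).
Qed.

(** Heads are finite combinations of unit vectors, so linearity alone determines the image;
    operators are compared this way before any continuity is invoked. *)
Lemma linear_head T n x i : linear T -> Lm x ->
  T (head n x) i = fsumC n (fun j => if inRb Rs j then Cmult (x j) (T (unitv j) i) else RtoC 0).
Proof.
  intros HT Hx; induction n as [|n IH]; simpl.
  - replace (head 0 x) with szero by (seq_ext; reflexivity).
    rewrite linear_zero by assumption; reflexivity.
  - destruct (inRb Rs n) eqn:Hn.
    + destruct HT as [H1 H2]; rewrite head_succ, H1, H2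
        by (try apply Lm_scal; try apply Lm_unitv; try apply Lm_head; assumption).
      unfold sadd at 1; rewrite IH; reflexivity.
    + rewrite head_succ_out, IH by assumption; ring.
Qed.

Definition posop (A : mat) : Prop := nonneg_mat Rs A /\ defines_op Rs Lm A.

(* Entries outside the index set are junk, hence comparisons are restricted to it. *)
Definition mle (A B : mat) : Prop :=
  forall i j, inRb Rs i = true -> inRb Rs j = true -> A i j <= B i j.

Definition mterm (A : mat) (x : seqC) (i j : nat) : C :=
  if inRb Rs j then Cmult (RtoC (A i j)) (x j) else RtoC 0.

Lemma Cmod_mterm A x i j : nonneg_mat Rs A -> inRb Rs i = true ->
  Cmod (mterm A x i j) = if inRb Rs j then A i j * Cmod (x j) else 0.
Proof.
  intros HA Hi; unfold mterm; destruct (inRb Rs j) eqn:Hj; [|apply Cmod_0].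
  rewrite Cmod_mult, Cmod_R, Rabs_pos_eq by (apply HA; assumption); reflexivity.
Qed.

Lemma matapp_in A x i : inRb Rs i = true -> matapp Rs A x i = Cseries (mterm A x i).
Proof. intros Hi; unfold matapp; rewrite Hi; reflexivity. Qed.

Lemma matapp_out A x i : inRb Rs i = false -> matapp Rs A x i = RtoC 0.
Proof. intros Hi; unfold matapp; rewrite Hi; reflexivity. Qed.

Lemma supported_matapp A x : supported Rs (matapp Rs A x).
Proof. intros i; apply matapp_out. Qed.

Lemma ex_series_mterm A x i : posop A -> Lm x -> inRb Rs i = true ->
  ex_series (fun j => Cmod (mterm A x i j)).
Proof.
  intros [H1 H2] Hx Hi.
  apply (ex_series_ext (fun j => if inRb Rs j then A i j * Cmod (x j) else 0));
    [intros; rewrite Cmod_mterm by assumption; reflexivity|].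
  apply H2; assumption.
Qed.

Lemma linear_matapp A : posop A -> linear (matapp Rs A).
Proof.
  intros HA; split.
  - intros x y Hx Hy; seq_ext; destruct (inRb Rs i) eqn:Hi; [|rewrite !matapp_out by assumption; ring].
    rewrite !matapp_in by assumption; rewrite <- Cseries_plus by (apply ex_series_mterm; assumption).
    apply Cseries_ext; intros j; unfold mterm; destruct (inRb Rs j); ring.
  - intros c x Hx; seq_ext; destruct (inRb Rs i) eqn:Hi; [|rewrite !matapp_out by assumption; ring].
    rewrite !matapp_in by assumption; rewrite <- Cseries_scal by (apply ex_series_mterm; assumption).
    apply Cseries_ext; intros j; unfold mterm; destruct (inRb Rs j); ring.
Qed.

Lemma Lm_matapp A x : posop A -> Lm x -> Lm (matapp Rs A x).
Proof. intros [_ H] Hx; apply (H x Hx). Qed.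

Lemma matapp_absv A x i : inRb Rs i = true ->
  matapp Rs A (absv x) i = RtoC (Series (fun j => if inRb Rs j then A i j * Cmod (x j) else 0)).
Proof.
  intros Hi; rewrite matapp_in, <- Cseries_RtoC by assumption; apply Cseries_ext; intros j.
  unfold mterm, absv; destruct (inRb Rs j); [rewrite RtoC_mult|]; reflexivity.
Qed.

(** The comparison concerns the single row [i], because the Hadamard estimate holds only on rows
    from some [n] on. *)
Lemma matapp_dom A B x y i : nonneg_mat Rs A -> posop B -> Lm y ->
  (forall j, inRb Rs i = true -> inRb Rs j = true -> A i j <= B i j) ->
  (forall j, Cmod (x j) <= Cmod (y j)) ->
  (inRb Rs i = true -> ex_series (fun j => if inRb Rs j then A i j * Cmod (x j) else 0)) /\
  Cmod (matapp Rs A x i) <= Cmod (matapp Rs B (absv y) i).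
Proof.
  intros HA HB Hy HAB Hxy; destruct (inRb Rs i) eqn:Hi.
  - assert (Hle : forall j, 0 <= (if inRb Rs j then A i j * Cmod (x j) else 0)
                    <= (if inRb Rs j then B i j * Cmod (y j) else 0)).
    { intros j; destruct (inRb Rs j) eqn:Hj; [|lra].
      assert (0 <= A i j) by (apply HA; assumption).
      assert (A i j <= B i j) by (apply HAB; auto).
      assert (Hj1 := Hxy j); assert (Hj2 := Cmod_ge_0 (x j)); split; [|apply Rmult_le_compat]; nra. }
    assert (HBs := proj1 (proj2 HB y Hy) i Hi).
    assert (HAs := Series_le_ex _ _ Hle HBs).
    split; [intros _; assumption|].
    assert (HAt : ex_series (fun j => Cmod (mterm A x i j))).
    { apply (ex_series_ext (fun j => if inRb Rs j then A i j * Cmod (x j) else 0)); [|assumption].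
      intros; rewrite Cmod_mterm by assumption; reflexivity. }
    rewrite matapp_in, matapp_absv, Cmod_R by assumption.
    eapply Rle_trans; [apply Cmod_Cseries_le; assumption|].
    eapply Rle_trans; [|apply Rle_abs].
    rewrite (Series_ext _ (fun j => if inRb Rs j then A i j * Cmod (x j) else 0))
      by (intros; apply Cmod_mterm; assumption).
    apply Series_le; assumption.
  - split; [discriminate|]; rewrite !matapp_out by assumption; lra.
Qed.

(** * Norm bounds on tails of positive operators *)

Definition tail_bound (n : nat) (A : mat) (e : R) : Prop :=
  forall x, Lm x -> nrm (tail n (matapp Rs A x)) <= e * nrm x.

Definition op_bound (A : mat) (K : R) : Prop := 0 <= K /\ posop A /\ tail_bound 0 A K.

Lemma op_bound_nrm A K x : op_bound A K -> Lm x -> nrm (matapp Rs A x) <= K * nrm x.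
Proof.
  intros H Hx; destruct H as [_ [_ H]]; specialize (H x Hx); rewrite tail_0 in H; assumption.
Qed.

Lemma tail_bound_anti n n' A e : posop A -> (n <= n')%nat -> tail_bound n A e -> tail_bound n' A e.
Proof.
  intros HA Hn H x Hx; eapply Rle_trans; [|apply (H x Hx)].
  apply nrm_tail_anti; [assumption|apply Lm_matapp; assumption].
Qed.

Lemma tail_bound_le n A e e' : e <= e' -> tail_bound n A e -> tail_bound n A e'.
Proof.
  intros He H x Hx; eapply Rle_trans; [apply (H x Hx)|].
  apply Rmult_le_compat_r; [apply nrm_ge0|]; assumption.
Qed.

Lemma posop_dom A B : nonneg_mat Rs A -> posop B -> mle A B -> posop A.
Proof.
  intros HA HB HAB; split; [assumption|]; intros x Hx; split.
  - intros i Hi; apply (matapp_dom A B x x i); try assumption; intros; [apply HAB|apply Rle_refl]; assumption.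
  - apply (Lm_solid _ (matapp Rs B (absv x))).
    + apply supported_matapp.
    + apply Lm_matapp; [|apply Lm_absv]; assumption.
    + intros i; apply matapp_dom; try assumption; intros; [apply HAB|apply Rle_refl]; assumption.
Qed.

Lemma tail_bound_dom n A B e : posop A -> posop B ->
  (forall i j, (n <= i)%nat -> inRb Rs i = true -> inRb Rs j = true -> A i j <= B i j) ->
  tail_bound n B e -> tail_bound n A e.
Proof.
  intros HA HB HAB H x Hx; rewrite <- (nrm_absv x Hx).
  eapply Rle_trans; [|apply H, Lm_absv; assumption].
  apply Lm_solid.
  - apply Lm_supported, Lm_tail, Lm_matapp; assumption.
  - apply Lm_tail, Lm_matapp; [|apply Lm_absv]; assumption.
  - intros i; unfold tail; destruct (Nat.ltb_spec i n); [lra|].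
    apply matapp_dom; [apply HA|assumption|assumption| |intros; lra].
    intros; apply HAB; assumption.
Qed.

Lemma op_bound_dom A B K : nonneg_mat Rs A -> op_bound B K -> mle A B -> op_bound A K.
Proof.
  intros HA [H0 [H1 H2]] HAB; assert (Hp := posop_dom A B HA H1 HAB).
  split; [assumption|split; [assumption|]].
  apply (tail_bound_dom 0 A B K); try assumption; intros; apply HAB; assumption.
Qed.

Lemma matapp_unitv A j i : inRb Rs i = true -> inRb Rs j = true ->
  matapp Rs A (unitv j) i = RtoC (A i j).
Proof.
  intros Hi Hj; rewrite matapp_in by assumption.
  rewrite (Cseries_ext _ (fun l => RtoC (if Nat.eqb l j then A i l else 0))).
  - rewrite Cseries_RtoC; f_equal; apply is_series_unique, (is_series_single j (fun l => A i l)).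
  - intros l; unfold mterm, unitv; destruct (Nat.eqb_spec l j) as [->|Hne].
    + rewrite Hj; ring.
    + destruct (inRb Rs l); [ring|reflexivity].
Qed.

(** The entry is coordinate [i] of the image of the unit vector at [j], which has norm 1. *)
Lemma entry_le_tail_bound n A e i j : posop A -> tail_bound n A e -> (n <= i)%nat ->
  inRb Rs i = true -> inRb Rs j = true -> A i j <= e.
Proof.
  intros HA H Hn Hi Hj.
  assert (Hu := H (unitv j) (Lm_unitv j Hj)); rewrite nrm_unitv in Hu by assumption.
  assert (Hc := coord_le_nrm (tail n (matapp Rs A (unitv j))) i
                  (Lm_tail _ _ (Lm_matapp _ _ HA (Lm_unitv j Hj)))).
  unfold tail at 1 in Hc; destruct (Nat.ltb_spec i n); [lia|].
  rewrite matapp_unitv, Cmod_R in Hc by assumption.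
  assert (Hr := Rle_abs (A i j)); lra.
Qed.

Lemma posop_add A B : posop A -> posop B ->
  posop (fun i j => A i j + B i j) /\
  forall x, Lm x -> matapp Rs (fun i j => A i j + B i j) x = sadd (matapp Rs A x) (matapp Rs B x).
Proof.
  intros HA HB.
  assert (Heq : forall x, Lm x ->
    matapp Rs (fun i j => A i j + B i j) x = sadd (matapp Rs A x) (matapp Rs B x)).
  { intros x Hx; seq_ext; destruct (inRb Rs i) eqn:Hi; [|rewrite !matapp_out by assumption; ring].
    rewrite !matapp_in by assumption; rewrite <- Cseries_plus by (apply ex_series_mterm; assumption).
    apply Cseries_ext; intros j; unfold mterm; destruct (inRb Rs j); [rewrite RtoC_plus|]; ring. }
  split; [split|assumption].
  - intros i j Hi Hj; apply Rplus_le_le_0_compat; [apply HA|apply HB]; assumption.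
  - intros x Hx; split.
    + intros i Hi.
      apply (ex_series_ext (fun j => plus (if inRb Rs j then A i j * Cmod (x j) else 0)
                                          (if inRb Rs j then B i j * Cmod (x j) else 0))).
      * intros j; unfold plus; simpl; destruct (inRb Rs j); ring.
      * apply (ex_series_plus (V := R_NormedModule)); [apply HA|apply HB]; assumption.
    + rewrite Heq by assumption; apply Lm_add; apply Lm_matapp; assumption.
Qed.

Lemma posop_scal c A : 0 <= c -> posop A ->
  posop (fun i j => c * A i j) /\
  forall x, Lm x -> matapp Rs (fun i j => c * A i j) x = sscal (RtoC c) (matapp Rs A x).
Proof.
  intros Hc HA.
  assert (Heq : forall x, Lm x ->
    matapp Rs (fun i j => c * A i j) x = sscal (RtoC c) (matapp Rs A x)).
  { intros x Hx; seq_ext; destruct (inRb Rs i) eqn:Hi; [|rewrite !matapp_out by assumption; ring].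
    rewrite !matapp_in by assumption; rewrite <- Cseries_scal by (apply ex_series_mterm; assumption).
    apply Cseries_ext; intros j; unfold mterm; destruct (inRb Rs j); [rewrite RtoC_mult|]; ring. }
  split; [split|assumption].
  - intros i j Hi Hj; apply Rmult_le_pos; [|apply HA]; assumption.
  - intros x Hx; split.
    + intros i Hi.
      apply (ex_series_ext (fun j => scal c (if inRb Rs j then A i j * Cmod (x j) else 0))).
      * intros j; unfold scal; simpl; unfold mult; simpl; destruct (inRb Rs j); ring.
      * apply (ex_series_scal_l (V := R_NormedModule)); apply HA; assumption.
    + rewrite Heq by assumption; apply Lm_scal, Lm_matapp; assumption.
Qed.

Lemma posop_zero : posop (fun _ _ => 0) /\ forall x, matapp Rs (fun _ _ => 0) x = szero.
Proof.
  assert (Heq : forall x, matapp Rs (fun _ _ => 0) x = szero).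
  { intros x; seq_ext; destruct (inRb Rs i) eqn:Hi; [|rewrite !matapp_out by assumption; ring].
    rewrite matapp_in by assumption; rewrite (Cseries_ext _ (fun _ => RtoC 0)).
    - rewrite (Cseries_RtoC (fun _ => 0)), Series_zero; reflexivity.
    - intros j; unfold mterm; destruct (inRb Rs j); ring. }
  split; [split|assumption].
  - intros i j _ _; lra.
  - intros x Hx; split; [|rewrite Heq; apply Lm_zero].
    intros i Hi; exists 0; apply (is_series_ext (fun j => if Nat.eqb j 0 then 0 else 0)).
    + intros j; rewrite Rmult_0_l; destruct (Nat.eqb j 0), (inRb Rs j); reflexivity.
    + apply (is_series_single 0 (fun _ => 0)).
Qed.

Lemma tail_bound_add n A B e f : posop A -> posop B -> tail_bound n A e -> tail_bound n B f ->
  tail_bound n (fun i j => A i j + B i j) (e + f).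
Proof.
  intros HA HB He Hf x Hx; rewrite (proj2 (posop_add A B HA HB)), tail_add by assumption.
  eapply Rle_trans; [apply nrm_add; apply Lm_tail, Lm_matapp; assumption|].
  assert (H1 := He x Hx); assert (H2 := Hf x Hx); lra.
Qed.

Lemma tail_bound_scal n c A e : 0 <= c -> posop A -> tail_bound n A e -> tail_bound n (fun i j => c * A i j) (c * e).
Proof.
  intros Hc HA He x Hx; rewrite (proj2 (posop_scal c A Hc HA)), tail_scal by assumption.
  rewrite nrm_scal, Cmod_R, Rabs_pos_eq by (try apply Lm_tail, Lm_matapp; assumption).
  rewrite Rmult_assoc; apply Rmult_le_compat_l; [assumption|apply He; assumption].
Qed.

Lemma tail_bound_zero n : tail_bound n (fun _ _ => 0) 0.
Proof.
  intros x Hx; rewrite (proj2 posop_zero); replace (tail n szero) with szero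
    by (seq_ext; destruct (Nat.ltb i n); reflexivity).
  rewrite nrm_zero; lra.
Qed.

Lemma posop_fsum m (A : nat -> mat) : (forall j, (j < m)%nat -> posop (A j)) ->
  posop (fun r s => fsum m (fun j => A j r s)).
Proof.
  induction m as [|m IH]; intros H; simpl; [apply posop_zero|].
  apply (posop_add (fun r s => fsum m (fun j => A j r s)) (A m)); [apply IH; intros|]; apply H; lia.
Qed.

Lemma tail_bound_fsum n m (A : nat -> mat) (e : nat -> R) :
  (forall j, (j < m)%nat -> posop (A j) /\ tail_bound n (A j) (e j)) ->
  tail_bound n (fun r s => fsum m (fun j => A j r s)) (fsum m e).
Proof.
  induction m as [|m IH]; intros H; simpl; [apply tail_bound_zero|].
  apply (tail_bound_add n (fun r s => fsum m (fun j => A j r s)) (A m)).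
  - apply posop_fsum; intros; apply H; lia.
  - apply H; lia.
  - apply IH; intros; apply H; lia.
  - apply H; lia.
Qed.

Lemma op_bound_fsum m (A : nat -> mat) (e : nat -> R) :
  (forall j, (j < m)%nat -> op_bound (A j) (e j)) ->
  op_bound (fun r s => fsum m (fun j => A j r s)) (fsum m e).
Proof.
  intros H; split; [apply fsum_ge0; intros; apply H; assumption|split].
  - apply posop_fsum; intros; apply H; assumption.
  - apply tail_bound_fsum; intros; split; apply H; assumption.
Qed.

(** * Products of matrices and composition of operators *)

Lemma matapp_matapp_unitv A B i j : inRb Rs i = true -> inRb Rs j = true ->
  matapp Rs A (matapp Rs B (unitv j)) i = RtoC (mmul Rs A B i j).
Proof.
  intros Hi Hj; rewrite matapp_in by assumption; unfold mmul, sumR; rewrite <- Cseries_RtoC.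
  apply Cseries_ext; intros l; unfold mterm; destruct (inRb Rs l) eqn:Hl; [|reflexivity].
  rewrite matapp_unitv, RtoC_mult by assumption; reflexivity.
Qed.

Lemma linear_comp T U : (forall x, Lm x -> Lm (U x)) -> linear T -> linear U ->
  linear (fun x => T (U x)).
Proof.
  intros HU [T1 T2] [U1 U2]; split; intros.
  - rewrite U1, T1 by (try apply HU; assumption); reflexivity.
  - rewrite U2, T2 by (try apply HU; assumption); reflexivity.
Qed.

Lemma ex_series_mul A B i j : posop A -> posop B -> inRb Rs i = true -> inRb Rs j = true ->
  ex_series (fun l => if inRb Rs l then A i l * B l j else 0).
Proof.
  intros HA HB Hi Hj.
  apply (ex_series_ext (fun l => if inRb Rs l then A i l * Cmod (matapp Rs B (unitv j) l) else 0)).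
  - intros l; destruct (inRb Rs l) eqn:Hl; [|reflexivity].
    rewrite matapp_unitv, Cmod_R, Rabs_pos_eq by (try apply HB; assumption); reflexivity.
  - apply HA; [apply Lm_matapp; [|apply Lm_unitv]|]; assumption.
Qed.

Lemma nonneg_mul A B : posop A -> posop B -> nonneg_mat Rs (mmul Rs A B).
Proof.
  intros HA HB i j Hi Hj; apply Series_ge0; [|apply ex_series_mul; assumption].
  intros l; destruct (inRb Rs l) eqn:Hl; [|lra].
  apply Rmult_le_pos; [apply HA|apply HB]; assumption.
Qed.

Lemma fsumC_RtoC n (f : nat -> R) : fsumC n (fun j => RtoC (f j)) = RtoC (fsum n f).
Proof. induction n as [|n IH]; simpl; [|rewrite IH, RtoC_plus]; reflexivity. Qed.

Lemma fsumC_ext n (f g : nat -> C) : (forall j, (j < n)%nat -> f j = g j) -> fsumC n f = fsumC n g.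
Proof.
  intros H; induction n as [|n IH]; simpl; [reflexivity|].
  rewrite IH, H by (try lia; intros; apply H; lia); reflexivity.
Qed.

(** Shows that the series of the product matrix converge, before it is known to represent the
    composition. Its finite partial sums come from composing [A] and [B] on a head of [|x|], and
    positivity bounds them by the full composition. *)
Lemma mul_dom A B x i : posop A -> posop B -> Lm x ->
  (inRb Rs i = true -> ex_series (fun j => if inRb Rs j then mmul Rs A B i j * Cmod (x j) else 0)) /\
  Cmod (matapp Rs (mmul Rs A B) x i) <= Cmod (matapp Rs A (absv (matapp Rs B (absv x))) i).
Proof.
  intros HA HB Hx; destruct (inRb Rs i) eqn:Hi;
    [|split; [discriminate|rewrite !matapp_out by assumption; lra]].
  assert (Hn := nonneg_mul A B HA HB).
  set (a := fun j => if inRb Rs j then mmul Rs A B i j * Cmod (x j) else 0).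
  set (K := Cmod (matapp Rs A (absv (matapp Rs B (absv x))) i)).
  assert (Ha : forall j, 0 <= a j).
  { intros j; unfold a; destruct (inRb Rs j) eqn:Hj; [|lra].
    apply Rmult_le_pos; [apply Hn; assumption|apply Cmod_ge_0]. }
  assert (HLx := Lm_absv x Hx).
  destruct (ex_series_bounded a K Ha) as [Hex Hle].
  { intros n.
    (* This identity for finite heads takes the place of an exchange of two infinite sums. *)
    assert (Heq : RtoC (fsum n a) = matapp Rs A (matapp Rs B (head n (absv x))) i).
    { rewrite (linear_head (fun z => matapp Rs A (matapp Rs B z))); [|apply linear_comp|assumption].
      - rewrite <- fsumC_RtoC; apply fsumC_ext; intros j _; unfold a.
        destruct (inRb Rs j) eqn:Hj; [|reflexivity].
        rewrite matapp_matapp_unitv, RtoC_mult by assumption; unfold absv; ring.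
      - intros; apply Lm_matapp; assumption.
      - apply linear_matapp; assumption.
      - apply linear_matapp; assumption. }
    rewrite <- (Rabs_pos_eq (fsum n a)), <- Cmod_R, Heq by (apply fsum_ge0; intros; apply Ha).
    apply matapp_dom; [apply HA|assumption|apply Lm_matapp; assumption|intros; lra|].
    intros j; rewrite <- (absv_absv x) at 2.
    apply matapp_dom; [apply HB|assumption|assumption|intros; lra|].
    intros l; unfold head; destruct (Nat.ltb l n); [lra|rewrite Cmod_0; apply Cmod_ge_0]. }
  split; [intros _; assumption|].
  eapply Rle_trans; [|apply Hle].
  rewrite matapp_in by assumption.
  assert (Ht : ex_series (fun j => Cmod (mterm (mmul Rs A B) x i j))).
  { apply (ex_series_ext a); [|assumption]; intros; rewrite Cmod_mterm by assumption; reflexivity. }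
  eapply Rle_trans; [apply Cmod_Cseries_le; assumption|].
  right; apply Series_ext; intros; apply Cmod_mterm; assumption.
Qed.

Lemma posop_mul A B : posop A -> posop B -> posop (mmul Rs A B).
Proof.
  intros HA HB; split; [apply nonneg_mul; assumption|].
  intros x Hx; split; [intros i; apply mul_dom; assumption|].
  apply (Lm_solid _ (matapp Rs A (absv (matapp Rs B (absv x))))).
  - apply supported_matapp.
  - apply Lm_matapp, Lm_absv, Lm_matapp, Lm_absv; assumption.
  - intros i; apply mul_dom; assumption.
Qed.

(** The form in which order continuity of the norm enters; [tail_vanishes] supplies it. *)
Context (Htail : forall x, Lm x -> forall eps, 0 < eps ->
  exists N, forall n, (N <= n)%nat -> nrm (tail n x) < eps).

(** Both sides agree on heads by linearity. On the tail of [x] each is at most [KA * KB] times its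
    norm, which tends to 0. *)
Lemma matapp_mul A B KA KB x : op_bound A KA -> op_bound B KB -> Lm x ->
  matapp Rs (mmul Rs A B) x = matapp Rs A (matapp Rs B x).
Proof.
  intros HA HB Hx.
  assert (PA : posop A) by apply HA. assert (PB : posop B) by apply HB.
  assert (A0 : 0 <= KA) by apply HA. assert (B0 : 0 <= KB) by apply HB.
  assert (PAB := posop_mul A B PA PB).
  assert (LAB := linear_matapp _ PAB).
  assert (LC : linear (fun z => matapp Rs A (matapp Rs B z)))
    by (apply linear_comp; [intros; apply Lm_matapp| |]; try apply linear_matapp; assumption).
  assert (Hb : forall t, Lm t -> nrm (matapp Rs A (absv (matapp Rs B (absv t)))) <= KA * KB * nrm t).
  { intros t Ht; assert (Ht' := Lm_absv t Ht).
    eapply Rle_trans; [apply (op_bound_nrm A KA); [|apply Lm_absv, Lm_matapp]; assumption|].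
    rewrite nrm_absv, Rmult_assoc by (apply Lm_matapp; assumption).
    apply Rmult_le_compat_l; [assumption|]; rewrite <- (nrm_absv t) by assumption.
    apply op_bound_nrm; assumption. }
  seq_ext; destruct (inRb Rs i) eqn:Hi; [|rewrite !matapp_out by assumption; reflexivity].
  set (z := Cminus (matapp Rs (mmul Rs A B) x i) (matapp Rs A (matapp Rs B x) i)).
  assert (Hz : Cmod z <= 0).
  { apply le_epsilon; intros eps Heps.
    (* Two terms of size [KA * KB * d] must stay below [eps]; the added 1 keeps the denominator
       positive. *)
    assert (Hd : 0 < eps / (2 * (KA * KB) + 1)) by (apply Rdiv_lt_0_compat; nra).
    assert (Hk1 : eps = eps / (2 * (KA * KB) + 1) * (2 * (KA * KB) + 1)) by (field; nra).
    set (d := eps / (2 * (KA * KB) + 1)) in *.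
    destruct (Htail x Hx _ Hd) as [n Hn]; specialize (Hn n (le_n n)).
    set (t := tail n x) in *; assert (Ht : Lm t) by (apply Lm_tail; assumption).
    assert (Hh : matapp Rs (mmul Rs A B) (head n x) i = matapp Rs A (matapp Rs B (head n x)) i).
    { rewrite (linear_head _ n x i LAB Hx), (linear_head _ n x i LC Hx).
      apply fsumC_ext; intros j _; destruct (inRb Rs j) eqn:Hj; [|reflexivity].
      rewrite matapp_matapp_unitv, matapp_unitv by assumption; reflexivity. }
    assert (Hz : z = Cminus (matapp Rs (mmul Rs A B) t i) (matapp Rs A (matapp Rs B t) i)).
    { unfold z; rewrite (head_plus_tail n x); fold t.
      rewrite (proj1 LAB), (proj1 LC) by (try apply Lm_head; assumption).
      unfold sadd; rewrite Hh; ring. }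
    rewrite Hz; unfold Cminus; eapply Rle_trans; [apply Cmod_triangle|]; rewrite Cmod_opp.
    assert (H1 : Cmod (matapp Rs (mmul Rs A B) t i) <= KA * KB * nrm t).
    { eapply Rle_trans; [apply mul_dom; assumption|].
      eapply Rle_trans; [apply coord_le_nrm, Lm_matapp, Lm_absv, Lm_matapp, Lm_absv; assumption|].
      apply Hb; assumption. }
    assert (H2 : Cmod (matapp Rs A (matapp Rs B t) i) <= KA * KB * nrm t).
    { eapply Rle_trans; [apply coord_le_nrm, Lm_matapp, Lm_matapp; assumption|].
      eapply Rle_trans; [apply (op_bound_nrm A KA); [|apply Lm_matapp]; assumption|].
      rewrite Rmult_assoc; apply Rmult_le_compat_l; [assumption|apply op_bound_nrm; assumption]. }
    assert (Hk : 0 <= KA * KB) by nra.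
    assert (Hk2 : KA * KB * nrm t <= KA * KB * d)
      by (apply Rmult_le_compat_l; [assumption|apply Rlt_le; assumption]).
    lra. }
  assert (Hz0 : z = RtoC 0) by (apply Cmod_eq_0; assert (H := Cmod_ge_0 z); lra).
  replace (matapp Rs (mmul Rs A B) x i) with (Cplus z (matapp Rs A (matapp Rs B x) i))
    by (unfold z; ring).
  rewrite Hz0; ring.
Qed.

Lemma op_bound_mul A B KA KB : op_bound A KA -> op_bound B KB -> op_bound (mmul Rs A B) (KA * KB).
Proof.
  intros HA HB; split; [apply Rmult_le_pos; [apply HA|apply HB]|split].
  - apply posop_mul; [apply HA|apply HB].
  - intros x Hx; rewrite tail_0, (matapp_mul A B KA KB) by assumption.
    assert (Hy : Lm (matapp Rs B x)) by (apply Lm_matapp; [apply HB|assumption]).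
    eapply Rle_trans; [apply (op_bound_nrm A KA); assumption|].
    rewrite Rmult_assoc; apply Rmult_le_compat_l; [apply HA|apply op_bound_nrm; assumption].
Qed.

Lemma op_bound_add A B KA KB : op_bound A KA -> op_bound B KB -> op_bound (fun i j => A i j + B i j) (KA + KB).
Proof.
  intros HA HB; split; [apply Rplus_le_le_0_compat; [apply HA|apply HB]|split].
  - apply posop_add; [apply HA|apply HB].
  - apply tail_bound_add; [apply HA|apply HB|apply HA|apply HB].
Qed.

Lemma op_bound_scal c A K : 0 <= c -> op_bound A K -> op_bound (fun i j => c * A i j) (c * K).
Proof.
  intros Hc HA; split; [apply Rmult_le_pos; [|apply HA]; assumption|split].
  - apply posop_scal; [assumption|apply HA].
  - apply tail_bound_scal; [assumption|apply HA|apply HA].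
Qed.

Lemma mul_mono A A' B B' : posop A -> posop B -> posop A' -> posop B' -> mle A A' -> mle B B' ->
  mle (mmul Rs A B) (mmul Rs A' B').
Proof.
  intros HA HB HA' HB' H1 H2 i j Hi Hj; unfold mmul, sumR; apply Series_le.
  - intros l; destruct (inRb Rs l) eqn:Hl; [|lra].
    assert (0 <= A i l) by (apply HA; assumption).
    assert (0 <= B l j) by (apply HB; assumption).
    assert (A i l <= A' i l) by (apply H1; assumption).
    assert (B l j <= B' l j) by (apply H2; assumption).
    split; [apply Rmult_le_pos|apply Rmult_le_compat]; assumption.
  - apply ex_series_mul; assumption.
Qed.

(** [A] restricted to heads has finite rank: only finitely many columns occur, each with vanishing
    tails, and their coefficients are bounded by the norm of [z]. *)
Lemma tail_head_small A m delta : posop A -> 0 < delta ->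
  exists N, forall n, (N <= n)%nat -> forall z, Lm z ->
    nrm (tail n (matapp Rs A (head m z))) <= delta * nrm z.
Proof.
  intros HA; revert delta; induction m as [|m IH]; intros delta Hd.
  - exists O; intros n _ z Hz; replace (head 0 z) with szero by (seq_ext; reflexivity).
    rewrite linear_zero by (apply linear_matapp; assumption).
    replace (tail n szero) with szero by (seq_ext; destruct (Nat.ltb i n); reflexivity).
    rewrite nrm_zero; apply Rmult_le_pos; [lra|apply nrm_ge0; assumption].
  - destruct (inRb Rs m) eqn:Hm.
    + destruct (IH (delta / 2) ltac:(lra)) as [N1 H1].
      assert (Hu : Lm (matapp Rs A (unitv m))) by (apply Lm_matapp; [|apply Lm_unitv]; assumption).
      destruct (Htail _ Hu (delta / 2) ltac:(lra)) as [N2 H2].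
      exists (N1 + N2)%nat; intros n Hn z Hz.
      assert (HLA := linear_matapp A HA).
      rewrite head_succ, (proj1 HLA), (proj2 HLA), tail_add, tail_scal
        by (try apply Lm_scal; try apply Lm_unitv; try apply Lm_head; assumption).
      eapply Rle_trans; [apply nrm_add|].
      * apply Lm_tail, Lm_matapp, Lm_head; assumption.
      * apply Lm_scal, Lm_tail; assumption.
      * rewrite nrm_scal by (apply Lm_tail; assumption).
        assert (X1 := H1 n ltac:(lia) z Hz); assert (X2 := H2 n ltac:(lia)).
        assert (X3 := coord_le_nrm z m Hz); assert (X4 := Cmod_ge_0 (z m)).
        assert (X5 := nrm_ge0 _ (Lm_tail n _ Hu)).
        assert (Cmod (z m) * nrm (tail n (matapp Rs A (unitv m))) <= nrm z * (delta / 2))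
          by (apply Rmult_le_compat; lra).
        lra.
    + destruct (IH delta Hd) as [N HN]; exists N; intros n Hn z Hz.
      rewrite head_succ_out by assumption; apply HN; assumption.
Qed.

(** Split [B x] at [m]: the tail contributes [a * b], and the head passes through finitely many
    columns of [A], whose tails cost [delta]. This is what makes [gamma_op] submultiplicative. *)
Lemma tail_bound_mul n m A B KA KB a b delta : op_bound A KA -> op_bound B KB -> 0 <= a -> 0 < delta ->
  tail_bound n A a -> tail_bound m B b -> exists N, tail_bound N (mmul Rs A B) (a * b + delta).
Proof.
  intros HA HB Ha Hd HnA HmB.
  assert (PA : posop A) by apply HA. assert (PB : posop B) by apply HB.
  assert (B0 : 0 <= KB) by apply HB.
  assert (Hd' : 0 < delta / (KB + 1)) by (apply Rdiv_lt_0_compat; lra).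
  destruct (tail_head_small A m _ PA Hd') as [N1 H1].
  exists (N1 + n)%nat; intros x Hx; rewrite (matapp_mul A B KA KB) by assumption.
  set (y := matapp Rs B x); assert (Hy : Lm y) by (apply Lm_matapp; assumption).
  rewrite (head_plus_tail m y), (proj1 (linear_matapp A PA)), tail_add
    by (try apply Lm_head; try apply Lm_tail; assumption).
  eapply Rle_trans; [apply nrm_add|].
  - apply Lm_tail, Lm_matapp, Lm_head; assumption.
  - apply Lm_tail, Lm_matapp, Lm_tail; assumption.
  - assert (X1 := H1 (N1 + n)%nat ltac:(lia) y Hy).
    assert (X2 := tail_bound_anti n (N1 + n) A a PA ltac:(lia) HnA (tail m y) (Lm_tail m y Hy)).
    assert (X3 : nrm (tail m y) <= b * nrm x) by (apply HmB; assumption).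
    assert (X4 : nrm y <= KB * nrm x) by (apply op_bound_nrm; assumption).
    assert (X5 := nrm_ge0 x Hx).
    assert (X6 : a * nrm (tail m y) <= a * (b * nrm x)) by (apply Rmult_le_compat_l; assumption).
    assert (X7 : delta / (KB + 1) * nrm y <= delta / (KB + 1) * ((KB + 1) * nrm x))
      by (apply Rmult_le_compat_l; lra).
    replace (delta / (KB + 1) * ((KB + 1) * nrm x)) with (delta * nrm x) in X7 by (field; lra).
    lra.
Qed.

Lemma tail_bound_of_unit_ball n A e : posop A ->
  (forall x, Lm x -> nrm x <= 1 -> nrm (tail n (matapp Rs A x)) <= e) -> tail_bound n A e.
Proof.
  intros HA H x Hx; destruct (Req_dec (nrm x) 0) as [H0|H0].
  - rewrite H0, (nrm_eq0 x Hx H0), linear_zero by (apply linear_matapp; assumption).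
    replace (tail n szero) with szero by (seq_ext; destruct (Nat.ltb i n); reflexivity).
    rewrite nrm_zero; lra.
  - assert (Hp := nrm_ge0 x Hx).
    assert (Hi : 0 < / nrm x) by (apply Rinv_0_lt_compat; lra).
    assert (Hc : Cmod (RtoC (/ nrm x)) = / nrm x) by (rewrite Cmod_R, Rabs_pos_eq; lra).
    assert (H1 : nrm (tail n (matapp Rs A (sscal (RtoC (/ nrm x)) x))) <= e).
    { apply H; [apply Lm_scal; assumption|].
      rewrite nrm_scal, Hc by assumption; right; field; assumption. }
    rewrite (proj2 (linear_matapp A HA)), tail_scal, nrm_scal, Hc in H1
      by (try apply Lm_tail, Lm_matapp; assumption).
    apply Rmult_le_reg_l with (/ nrm x); [assumption|].
    eapply Rle_trans; [apply H1|]; right; field; assumption.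
Qed.

(** * Finite nets and the measure of noncompactness *)

Lemma finite_net_R (K eta : R) : 0 < eta -> 0 <= K ->
  exists (d : nat) (f : nat -> R), forall w, Rabs w <= K ->
    exists u, (u < d)%nat /\ Rabs (w - f u) <= eta.
Proof.
  intros He HK.
  destruct (nfloor_ex (2 * K / eta)) as [D HD]; [apply Rdiv_le_0_compat; lra|].
  exists (S (S D)), (fun u => - K + INR u * eta); intros w Hw; apply Rabs_le_between in Hw.
  destruct (nfloor_ex ((w + K) / eta)) as [u Hu]; [apply Rdiv_le_0_compat; lra|].
  assert (Hw1 : (w + K) / eta <= 2 * K / eta)
    by (apply Rmult_le_compat_r; [apply Rlt_le, Rinv_0_lt_compat; assumption|lra]).
  assert (Hw2 : w + K = (w + K) / eta * eta) by (field; lra).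
  exists u; split.
  - apply INR_lt; rewrite !S_INR; lra.
  - apply Rabs_le_between; split; nra.
Qed.

Lemma finite_net_C (K eta : R) : 0 < eta -> 0 <= K ->
  exists (d : nat) (z : nat -> C), (0 < d)%nat /\ forall w, Cmod w <= K ->
    exists u, (u < d)%nat /\ Cmod (Cminus w (z u)) <= eta.
Proof.
  intros He HK; destruct (finite_net_R K (eta / 2) ltac:(lra) HK) as [d [f Hf]].
  assert (Hd : (0 < d)%nat) by (destruct (Hf 0 ltac:(rewrite Rabs_R0; assumption)); lia).
  (* A pair of grid indices is coded by quotient and remainder modulo [d]. *)
  exists (d * d)%nat, (fun q => (f (q / d)%nat, f (q mod d)%nat)); split; [nia|].
  intros w Hw; assert (Hm := Rmax_Cmod w).
  destruct (Hf (fst w)) as [u1 [U1 V1]]; 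
    [eapply Rle_trans; [apply Rmax_l|eapply Rle_trans; [exact Hm|exact Hw]]|].
  destruct (Hf (snd w)) as [u2 [U2 V2]]; 
    [eapply Rle_trans; [apply Rmax_r|eapply Rle_trans; [exact Hm|exact Hw]]|].
  exists (u1 * d + u2)%nat; split; [nia|].
  rewrite Nat.div_add_l, Nat.div_small, Nat.add_0_r by lia.
  rewrite Nat.add_comm, Nat.Div0.mod_add, Nat.mod_small by lia.
  replace (Cminus w (f u1, f u2))
    with (Cplus (RtoC (fst w - f u1)) (Cmult Ci (RtoC (snd w - f u2)))).
  - eapply Rle_trans; [apply Cmod_triangle|]; rewrite Cmod_mult, !Cmod_R, Cmod_Ci; lra.
  - destruct w as [p q]; unfold Cminus, Cplus, Copp, Cmult, Ci, RtoC; simpl; f_equal; ring.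
Qed.

(** Total boundedness of a bounded set in finite dimension, one coordinate at a time: half of [eta]
    is spent on the earlier coordinates and half on the new one, whose unit vector has norm 1. *)
Lemma finite_net_head n K eta : 0 < eta -> 0 <= K ->
  exists (d : nat) (c : nat -> seqC), (forall t, (t < d)%nat -> Lm (c t)) /\
    forall y, Lm y -> nrm y <= K -> exists t, (t < d)%nat /\ nrm (ssub (head n y) (c t)) <= eta.
Proof.
  intros He HK; revert eta He; induction n as [|n IH]; intros eta He.
  - exists 1%nat, (fun _ => szero); split; [intros; apply Lm_zero|].
    intros y Hy HyK; exists O; split; [lia|].
    replace (ssub (head 0 y) szero) with szero by (seq_ext; simpl; ring).
    rewrite nrm_zero; lra.
  - destruct (inRb Rs n) eqn:Hn.
    + destruct (IH (eta / 2) ltac:(lra)) as [d [c [Hc Hnet]]].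
      destruct (finite_net_C K (eta / 2) ltac:(lra) HK) as [d' [z [Hd' Hz]]].
      assert (Hu := Lm_unitv n Hn).
      exists (d * d')%nat, (fun q => sadd (c (q / d')%nat) (sscal (z (q mod d')%nat) (unitv n))).
      split.
      * intros t Ht; apply Lm_add; [apply Hc, Nat.Div0.div_lt_upper_bound; nia|apply Lm_scal; assumption].
      * intros y Hy HyK; destruct (Hnet y Hy HyK) as [t1 [T1 V1]].
        destruct (Hz (y n)) as [t2 [T2 V2]];
          [eapply Rle_trans; [apply coord_le_nrm|]; assumption|].
        exists (t1 * d' + t2)%nat; split; [nia|].
        rewrite Nat.div_add_l, Nat.div_small, Nat.add_0_r by lia.
        rewrite (Nat.add_comm (t1 * d')), Nat.Div0.mod_add, Nat.mod_small by lia.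
        rewrite head_succ by assumption.
        replace (ssub (sadd (head n y) (sscal (y n) (unitv n))) (sadd (c t1) (sscal (z t2) (unitv n))))
          with (sadd (ssub (head n y) (c t1)) (sscal (Cminus (y n) (z t2)) (unitv n)))
          by (seq_ext; destruct (Nat.ltb i n); ring).
        eapply Rle_trans; [apply nrm_add|].
        -- apply Lm_sub; [apply Lm_head|apply Hc]; assumption.
        -- apply Lm_scal; assumption.
        -- rewrite nrm_scal, nrm_unitv by assumption; lra.
    + destruct (IH eta He) as [d [c [Hc Hnet]]]; exists d, c; split; [assumption|].
      intros y Hy HyK; rewrite head_succ_out by assumption; apply Hnet; assumption.
Qed.

(** The predicate whose infimum is [gamma_op]. *)
Definition ball_net (A : mat) (e : R) : Prop :=
  0 < e /\ exists (d : nat) (c : nat -> seqC),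
     (forall t, (t < d)%nat -> Lm (c t)) /\
     forall x, Lm x -> nrm x <= 1 ->
       exists t, (t < d)%nat /\ nrm (ssub (matapp Rs A x) (c t)) <= e.

Lemma ball_net_of_tail_bound n A K e eta : op_bound A K -> 0 <= e -> 0 < eta -> tail_bound n A e ->
  ball_net A (e + eta).
Proof.
  intros HA He Heta Hb; assert (K0 : 0 <= K) by apply HA.
  assert (PA : posop A) by apply HA.
  split; [lra|]; destruct (finite_net_head n K eta Heta K0) as [d [c [Hc Hnet]]].
  exists d, c; split; [assumption|]; intros x Hx Hx1.
  set (y := matapp Rs A x); assert (Hy : Lm y) by (apply Lm_matapp; assumption).
  destruct (Hnet y Hy) as [t [Ht Hty]].
  { eapply Rle_trans; [apply (op_bound_nrm A K); assumption|].
    rewrite <- (Rmult_1_r K) at 2; apply Rmult_le_compat_l; assumption. }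
  exists t; split; [assumption|].
  replace (ssub y (c t)) with (sadd (tail n y) (ssub (head n y) (c t)))
    by (seq_ext; destruct (Nat.ltb i n); ring).
  eapply Rle_trans; [apply nrm_add; [apply Lm_tail|apply Lm_sub; [apply Lm_head|apply Hc]]; assumption|].
  assert (X := Hb x Hx); fold y in X; nra.
Qed.

Lemma gamma_glb A K : op_bound A K ->
  (forall e, ball_net A e -> gamma_op Rs Lm nrm A <= e) /\
  (forall c, (forall e, ball_net A e -> c <= e) -> c <= gamma_op Rs Lm nrm A).
Proof.
  intros HA; apply (infR_is_glb (ball_net A) (K + 1)).
  - intros y [Hy _]; lra.
  - apply (ball_net_of_tail_bound 0 A K K 1); try apply HA; lra.
Qed.

Lemma gamma_ge0 A K : op_bound A K -> 0 <= gamma_op Rs Lm nrm A.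
Proof. intros HA; apply (gamma_glb A K HA); intros e [He _]; lra. Qed.

(** First half of [gamma = inf_n |Q_n A|]: a net for the heads of the image is a net for the image,
    with the tail as additional error. *)
Lemma gamma_le_tail_bound n A K e : op_bound A K -> 0 <= e -> tail_bound n A e -> gamma_op Rs Lm nrm A <= e.
Proof.
  intros HA He Hb; apply le_epsilon; intros eta Heta.
  apply (gamma_glb A K HA), (ball_net_of_tail_bound n A K); assumption.
Qed.

Lemma tails_finite_small d (c : nat -> seqC) eps : 0 < eps -> (forall t, (t < d)%nat -> Lm (c t)) ->
  exists N, forall t, (t < d)%nat -> nrm (tail N (c t)) < eps.
Proof.
  intros He; induction d as [|d IH]; intros Hc; [exists O; intros; lia|].
  destruct IH as [N1 H1]; [intros; apply Hc; lia|].
  destruct (Htail (c d) (Hc d ltac:(lia)) eps He) as [N2 H2].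
  exists (N1 + N2)%nat; intros t Ht; destruct (Nat.eq_dec t d) as [->|Hne]; [apply H2; lia|].
  eapply Rle_lt_trans; [|apply (H1 t); lia].
  apply nrm_tail_anti; [lia|apply Hc; assumption].
Qed.

(** Second half of [gamma = inf_n |Q_n A|]: beyond some [N] all of the finitely many centres have
    small tails, so every image of the unit ball has a tail little larger than its distance to a
    centre. *)
Lemma tail_bound_of_gamma_lt A K e : op_bound A K -> gamma_op Rs Lm nrm A < e -> exists n, tail_bound n A e.
Proof.
  intros HA He.
  assert (Hex : exists e', ball_net A e' /\ e' < e).
  { apply NNPP; intros Hn; assert (e <= gamma_op Rs Lm nrm A); [|lra].
    apply (gamma_glb A K HA); intros e' He'; apply Rnot_lt_le; intros H; apply Hn.
    exists e'; split; assumption. }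
  destruct Hex as [e' [[He0 [d [c [Hc Hnet]]]] He']].
  destruct (tails_finite_small d c (e - e') ltac:(lra) Hc) as [N HN].
  assert (PA : posop A) by apply HA.
  exists N; apply tail_bound_of_unit_ball; [assumption|]; intros x Hx Hx1.
  destruct (Hnet x Hx Hx1) as [t [Ht Hxt]].
  set (y := matapp Rs A x) in *; assert (Hy : Lm y) by (apply Lm_matapp; assumption).
  assert (Hyc : Lm (ssub y (c t))) by (apply Lm_sub; [|apply Hc]; assumption).
  replace (tail N y) with (sadd (tail N (ssub y (c t))) (tail N (c t)))
    by (seq_ext; destruct (Nat.ltb i N); ring).
  eapply Rle_trans; [apply nrm_add; apply Lm_tail; [|apply Hc]; assumption|].
  assert (X1 := nrm_tail_le N _ Hyc); assert (X2 := HN t Ht); lra.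
Qed.

Lemma gamma_mono A B KB : nonneg_mat Rs A -> op_bound B KB -> mle A B ->
  gamma_op Rs Lm nrm A <= gamma_op Rs Lm nrm B.
Proof.
  intros HA HB HAB; assert (HA' := op_bound_dom A B KB HA HB HAB).
  apply le_epsilon; intros eta Heta.
  destruct (tail_bound_of_gamma_lt B KB (gamma_op Rs Lm nrm B + eta) HB ltac:(lra)) as [n Hn].
  apply (gamma_le_tail_bound n A KB); [assumption|assert (H := gamma_ge0 B KB HB); lra|].
  apply (tail_bound_dom n A B); try assumption; [apply HA'|apply HB|intros; apply HAB; assumption].
Qed.

Lemma gamma_le_K A K : op_bound A K -> gamma_op Rs Lm nrm A <= K.
Proof. intros HA; apply (gamma_le_tail_bound 0 A K); try apply HA; assumption. Qed.

Lemma gamma_scal_le c A K : 0 <= c -> op_bound A K ->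
  gamma_op Rs Lm nrm (fun i j => c * A i j) <= c * gamma_op Rs Lm nrm A.
Proof.
  intros Hc HA; assert (H0 := gamma_ge0 A K HA).
  apply le_epsilon; intros eta Heta.
  set (d := eta / (c + 1)); assert (Hd : 0 < d) by (apply Rdiv_lt_0_compat; lra).
  destruct (tail_bound_of_gamma_lt A K (gamma_op Rs Lm nrm A + d) HA ltac:(lra)) as [n Hn].
  apply Rle_trans with (c * (gamma_op Rs Lm nrm A + d)).
  - apply (gamma_le_tail_bound n _ (c * K)); [apply op_bound_scal; assumption|apply Rmult_le_pos; lra|].
    apply tail_bound_scal; [assumption|apply HA|assumption].
  - assert (E : eta = d * (c + 1)) by (unfold d; field; lra); nra.
Qed.

Lemma gamma_mul_le A B KA KB : op_bound A KA -> op_bound B KB ->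
  gamma_op Rs Lm nrm (mmul Rs A B) <= gamma_op Rs Lm nrm A * gamma_op Rs Lm nrm B.
Proof.
  intros HA HB; assert (A0 := gamma_ge0 A KA HA); assert (B0 := gamma_ge0 B KB HB).
  set (a := gamma_op Rs Lm nrm A) in *; set (b := gamma_op Rs Lm nrm B) in *.
  assert (H : forall d, 0 < d -> gamma_op Rs Lm nrm (mmul Rs A B) <= (a + d) * (b + d) + d).
  { intros d Hd.
    destruct (tail_bound_of_gamma_lt A KA (a + d) HA ltac:(unfold a; lra)) as [n Hn].
    destruct (tail_bound_of_gamma_lt B KB (b + d) HB ltac:(unfold b; lra)) as [m Hm].
    destruct (tail_bound_mul n m A B KA KB (a + d) (b + d) d HA HB ltac:(lra) Hd Hn Hm) as [N HN].
    apply (gamma_le_tail_bound N _ (KA * KB)); [apply op_bound_mul; assumption|nra|assumption]. }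
  apply le_epsilon; intros eta Heta.
  (* For [d <= 1] the bound [(a + d) * (b + d) + d] exceeds [a * b] by at most [d * (a + b + 2)]. *)
  set (d := Rmin 1 (eta / (a + b + 2))).
  assert (Hq : 0 < eta / (a + b + 2)) by (apply Rdiv_lt_0_compat; lra).
  assert (Hd : 0 < d) by (apply Rmin_glb_lt; lra).
  assert (Hd1 : d <= 1) by apply Rmin_l.
  assert (Hd2 : d <= eta / (a + b + 2)) by apply Rmin_r.
  assert (Hd3 : d * (a + b + 2) <= eta).
  { apply Rle_trans with (eta / (a + b + 2) * (a + b + 2)); [|right; field; lra].
    apply Rmult_le_compat_r; lra. }
  specialize (H d Hd); nra.
Qed.

(** * Hadamard products of positive operators *)

Definition had (m : nat) (alpha : nat -> R) (F : nat -> mat) : mat :=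
  fun r s => fprod m (fun j => pw (F j r s) (alpha j)).

Lemma had_nonneg m alpha F : nonneg_mat Rs (had m alpha F).
Proof. intros i j _ _; apply fprod_ge0; intros; apply pw_ge0. Qed.

Section Hadamard.
Context (m : nat) (alpha : nat -> R).
Context (Ha : forall j, (j < m)%nat -> 0 < alpha j) (Hs : 1 <= fsum m alpha).

Lemma had_mono F G : (forall j, (j < m)%nat -> nonneg_mat Rs (F j) /\ mle (F j) (G j)) ->
  mle (had m alpha F) (had m alpha G).
Proof.
  intros H r s Hr Hs'; apply fprod_le; intros j Hj; split; [apply pw_ge0|].
  apply pw_le; [apply Ha; assumption|apply H; assumption].
Qed.

(* On rows [>= n] the entries of [F j] are at most [e j], so there the Hadamard product is
   dominated by a combination of the [F j] of tail norm [prod_j (e j)^(alpha j)]. *)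
Lemma had_dom n F e : (forall j, (j < m)%nat -> posop (F j) /\ 0 < e j /\ tail_bound n (F j) (e j)) ->
  let B := fun r s => fprod m (fun j => pw (e j) (alpha j)) *
                      fsum m (fun j => alpha j / fsum m alpha / e j * F j r s) in
  posop B /\ tail_bound n B (fprod m (fun j => pw (e j) (alpha j))) /\
  forall r s, (n <= r)%nat -> inRb Rs r = true -> inRb Rs s = true -> had m alpha F r s <= B r s.
Proof.
  intros H B.
  assert (HP : 0 <= fprod m (fun j => pw (e j) (alpha j)))
    by (apply fprod_ge0; intros; apply pw_ge0).
  assert (Hw : forall j, (j < m)%nat -> 0 <= alpha j / fsum m alpha / e j).
  { intros j Hj; assert (A0 := Ha j Hj); apply Rlt_le, Rdiv_lt_0_compat;
      [apply Rdiv_lt_0_compat; lra|apply H; assumption]. }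
  assert (HpF : forall j, (j < m)%nat -> posop (fun r s => alpha j / fsum m alpha / e j * F j r s))
    by (intros; apply posop_scal; [apply Hw|apply H]; assumption).
  assert (HpS := posop_fsum m (fun j r s => alpha j / fsum m alpha / e j * F j r s) HpF).
  split; [apply (posop_scal _ _ HP HpS)|split].
  - rewrite <- (Rmult_1_r (fprod m (fun j => pw (e j) (alpha j)))).
    apply (tail_bound_scal n _ _ _ HP HpS).
    rewrite <- (fsum_weights m alpha Hs).
    apply (tail_bound_fsum n m (fun j r s => alpha j / fsum m alpha / e j * F j r s)).
    intros j Hj; split; [apply HpF; assumption|].
    destruct (H j Hj) as [H1 [H2 H3]].
    assert (Hb := tail_bound_scal n _ (F j) (e j) (Hw j Hj) H1 H3).
    replace (alpha j / fsum m alpha / e j * e j) with (alpha j / fsum m alpha) in Hb by (field; lra).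
    exact Hb.
  - intros r s Hn Hr Hs'; apply fprod_pw_le_scaled_mean; try assumption.
    intros j Hj; destruct (H j Hj) as [H1 [H2 H3]]; split; [assumption|split].
    + apply H1; assumption.
    + apply (entry_le_tail_bound n); assumption.
Qed.

(** The case [n = 0] of [had_dom]; the bounds must be strictly positive because [had_dom] divides by
    them. *)
Lemma op_bound_had F K : (forall j, (j < m)%nat -> 0 < K j /\ op_bound (F j) (K j)) ->
  op_bound (had m alpha F) (fprod m (fun j => pw (K j) (alpha j))).
Proof.
  intros H; destruct (had_dom 0 F K) as [H1 [H2 H3]].
  { intros j Hj; destruct (H j Hj) as [H0 [_ [H1 H2]]]; split; [|split]; assumption. }
  eapply (op_bound_dom (had m alpha F)); [apply had_nonneg| |intros r s; apply H3; lia].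
  split; [apply fprod_ge0; intros; apply pw_ge0|split; eassumption].
Qed.

Lemma ex_op_bound_had F : (forall j, (j < m)%nat -> exists K, op_bound (F j) K) ->
  exists K, op_bound (had m alpha F) K.
Proof.
  intros H.
  destruct (choice_lt 0 m (fun j K => 0 < K /\ op_bound (F j) K)) as [K HK].
  { intros j Hj; destruct (H j Hj) as [K [K0 [HK1 HK2]]]; exists (K + 1); split; [lra|].
    split; [lra|split; [assumption|apply (tail_bound_le 0 _ K); [lra|assumption]]]. }
  exists (fprod m (fun j => pw (K j) (alpha j))); apply op_bound_had; assumption.
Qed.

(** [had_dom] with [e j = gamma (F j) + eps], at an [n] common to all factors; the [eps] also keeps
    the divisors positive, and is removed by [le_fprod_pw_lim]. *)
Lemma gamma_had_le F : (forall j, (j < m)%nat -> exists K, op_bound (F j) K) ->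
  gamma_op Rs Lm nrm (had m alpha F) <= fprod m (fun j => pw (gamma_op Rs Lm nrm (F j)) (alpha j)).
Proof.
  intros H; destruct (ex_op_bound_had F H) as [KH HKH].
  apply le_fprod_pw_lim; [assumption|]; intros eps Heps.
  assert (Hn : forall p, (p <= m)%nat -> exists n, forall j, (j < p)%nat ->
             tail_bound n (F j) (gamma_op Rs Lm nrm (F j) + eps)).
  { induction p as [|p IH]; intros Hp; [exists O; intros; lia|].
    destruct (IH ltac:(lia)) as [n1 H1]; destruct (H p ltac:(lia)) as [K HK].
    destruct (tail_bound_of_gamma_lt (F p) K (gamma_op Rs Lm nrm (F p) + eps) HK ltac:(lra)) as [n2 H2].
    exists (n1 + n2)%nat; intros j Hj.
    destruct (H j ltac:(lia)) as [Kj HKj].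
    destruct (Nat.eq_dec j p) as [->|Hne].
    - apply (tail_bound_anti n2); [apply HK|lia|assumption].
    - apply (tail_bound_anti n1); [apply HKj|lia|apply H1; lia]. }
  destruct (Hn m (le_n m)) as [n Hn'].
  destruct (had_dom n F (fun j => gamma_op Rs Lm nrm (F j) + eps)) as [H1 [H2 H3]].
  { intros j Hj; destruct (H j Hj) as [K HK]; assert (G0 := gamma_ge0 _ _ HK).
    split; [apply HK|split; [lra|apply Hn'; assumption]]. }
  apply (gamma_le_tail_bound n _ KH); [assumption|apply fprod_ge0; intros; apply pw_ge0|].
  eapply tail_bound_dom; [apply HKH|apply H1|apply H3|apply H2].
Qed.

(** Hoelder's inequality for the sum that defines an entry of the product: partial sums are
    estimated by [hoelder_fsum], with the entries of the products [F q G q] as totals. *)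
Lemma had_mul_le F G :
  (forall j, (j < m)%nat -> posop (F j)) -> (forall j, (j < m)%nat -> posop (G j)) ->
  mle (mmul Rs (had m alpha F) (had m alpha G)) (had m alpha (fun j => mmul Rs (F j) (G j))).
Proof.
  intros HF HG r s Hr Hs'.
  set (u := fun q l => if inRb Rs l then F q r l * G q l s else 0).
  assert (Hu : forall q l, (q < m)%nat -> 0 <= u q l).
  { intros q l Hq; unfold u; destruct (inRb Rs l) eqn:Hl; [|lra].
    apply Rmult_le_pos; [apply HF|apply HG]; assumption. }
  assert (Hm : (0 < m)%nat) by (destruct m; [simpl in Hs; lra|lia]).
  apply (ex_series_bounded
           (fun l => if inRb Rs l then had m alpha F r l * had m alpha G l s else 0)).
  - intros l; destruct (inRb Rs l); [|lra].
    apply Rmult_le_pos; apply fprod_ge0; intros; apply pw_ge0.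
  - intros n; eapply Rle_trans; [|apply (hoelder_fsum n m alpha _ u)]; try assumption.
    + apply fsum_le; intros l _; unfold u; destruct (inRb Rs l) eqn:Hl.
      * unfold had; rewrite <- fprod_mult; right; apply fprod_ext; intros q Hq.
        symmetry; apply pw_mult; [apply HF|apply HG]; assumption.
      * apply fprod_ge0; intros; apply pw_ge0.
    + intros; apply Hu; assumption.
    + intros q Hq; assert (Hex : ex_series (u q)) by (apply ex_series_mul; auto).
      apply (is_lim_seq_incr_compare (fun n => fsum n (u q)) (Series (u q))).
      * apply is_lim_seq_incr_1, (is_lim_seq_ext (sum_n (u q)));
          [intros; apply sum_n_fsum|apply Series_correct; assumption].
      * intros p; simpl; assert (X := Hu q p Hq); lra.
Qed.

End Hadamard.

(** * Long products and powers of sets *)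

Definition bounded_op (A : mat) : Prop := exists K, op_bound A K.
(** Operators determine only the entries on the index set, so identities between products are proved
    in this sense rather than as equalities of functions. *)
Definition meq (A B : mat) : Prop := mle A B /\ mle B A.

Lemma bounded_op_posop A : bounded_op A -> posop A.
Proof. intros [K H]; apply H. Qed.

Lemma bounded_op_nonneg A : bounded_op A -> nonneg_mat Rs A.
Proof. intros [K H]; apply H. Qed.

Lemma meq_refl A : meq A A.
Proof. split; intros i j _ _; apply Rle_refl. Qed.

Lemma meq_sym A B : meq A B -> meq B A.
Proof. intros [H1 H2]; split; assumption. Qed.

Lemma mle_trans A B D : mle A B -> mle B D -> mle A D.
Proof. intros H1 H2 i j Hi Hj; eapply Rle_trans; [apply H1|apply H2]; assumption. Qed.

Lemma meq_trans A B D : meq A B -> meq B D -> meq A D.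
Proof. intros [H1 H2] [H3 H4]; split; eapply mle_trans; eassumption. Qed.

Lemma nonneg_mle A B : nonneg_mat Rs A -> mle A B -> nonneg_mat Rs B.
Proof. intros H1 H2 i j Hi Hj; eapply Rle_trans; [apply H1|apply H2]; assumption. Qed.

Lemma bounded_op_mul A B : bounded_op A -> bounded_op B -> bounded_op (mmul Rs A B).
Proof. intros [K HK] [K' HK']; exists (K * K'); apply op_bound_mul; assumption. Qed.

Lemma mul_meq A A' B B' : bounded_op A -> bounded_op B -> bounded_op A' -> bounded_op B' -> meq A A' -> meq B B' ->
  meq (mmul Rs A B) (mmul Rs A' B').
Proof.
  intros HA HB HA' HB' [H1 H2] [H3 H4]; split; apply mul_mono; try apply bounded_op_posop; assumption.
Qed.

(** Entries are read off on unit vectors, where both sides are the same composition of operators. *)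
Lemma mul_assoc A B D : bounded_op A -> bounded_op B -> bounded_op D ->
  meq (mmul Rs (mmul Rs A B) D) (mmul Rs A (mmul Rs B D)).
Proof.
  intros HA HB HD.
  assert (H : forall i j, inRb Rs i = true -> inRb Rs j = true ->
    mmul Rs (mmul Rs A B) D i j = mmul Rs A (mmul Rs B D) i j).
  { intros i j Hi Hj; apply RtoC_inj; rewrite <- !matapp_matapp_unitv by assumption.
    assert (Hu := Lm_unitv j Hj); assert (Hv := Lm_matapp D _ (bounded_op_posop D HD) Hu).
    destruct HA as [KA HA], HB as [KB HB], HD as [KD HD].
    rewrite (matapp_mul A B KA KB), (matapp_mul B D KB KD) by assumption; reflexivity. }
  split; intros i j Hi Hj; rewrite H by assumption; lra.
Qed.

Lemma op_bound_mprodn (A : nat -> mat) K n : (forall l, (l <= n)%nat -> op_bound (A l) K) ->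
  op_bound (mprodn Rs A n) (K ^ S n).
Proof.
  induction n as [|n IH]; intros H.
  - simpl; rewrite Rmult_1_r; apply H; lia.
  - replace (K ^ S (S n)) with (K ^ S n * K) by (simpl; ring).
    apply op_bound_mul; [apply IH; intros|]; apply H; lia.
Qed.

Lemma bounded_op_mprodn (A : nat -> mat) n : (forall l, (l <= n)%nat -> bounded_op (A l)) -> bounded_op (mprodn Rs A n).
Proof.
  induction n as [|n IH]; intros H; [apply H; lia|].
  apply bounded_op_mul; [apply IH; intros|]; apply H; lia.
Qed.

Lemma mprodn_ext (A B : nat -> mat) n : (forall l, (l <= n)%nat -> A l = B l) ->
  mprodn Rs A n = mprodn Rs B n.
Proof.
  induction n as [|n IH]; intros H; simpl; [apply H; lia|].
  rewrite IH, H by (try lia; intros; apply H; lia); reflexivity.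
Qed.

Lemma mprodn_mono (A B : nat -> mat) n :
  (forall l, (l <= n)%nat -> bounded_op (A l) /\ bounded_op (B l) /\ mle (A l) (B l)) ->
  mle (mprodn Rs A n) (mprodn Rs B n).
Proof.
  induction n as [|n IH]; intros H; simpl; [apply H; lia|].
  apply mul_mono.
  - apply bounded_op_posop, bounded_op_mprodn; intros; apply H; lia.
  - apply bounded_op_posop, H; lia.
  - apply bounded_op_posop, bounded_op_mprodn; intros; apply H; lia.
  - apply bounded_op_posop, H; lia.
  - apply IH; intros; apply H; lia.
  - apply H; lia.
Qed.

(** [mprodn] with index [n] has [n + 1] factors: here the first [p + 1] are separated from the last
    [l + 1]. *)
Lemma mprodn_split (A : nat -> mat) p l : (forall i, (i <= p + S l)%nat -> bounded_op (A i)) ->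
  meq (mprodn Rs A (p + S l)) (mmul Rs (mprodn Rs A p) (mprodn Rs (fun i => A (S p + i)%nat) l)).
Proof.
  induction l as [|l IH]; intros H.
  - replace (p + 1)%nat with (S p) by lia; simpl; rewrite Nat.add_0_r; apply meq_refl.
  - replace (p + S (S l))%nat with (S (p + S l)) by lia; simpl.
    assert (H1 : bounded_op (mprodn Rs A (p + S l))) by (apply bounded_op_mprodn; intros; apply H; lia).
    assert (H2 : bounded_op (mprodn Rs A p)) by (apply bounded_op_mprodn; intros; apply H; lia).
    assert (H3 : bounded_op (mprodn Rs (fun i => A (S (p + i))) l))
      by (apply bounded_op_mprodn; intros; apply H; lia).
    assert (H4 : bounded_op (A (S (p + S l)))) by (apply H; lia).
    eapply meq_trans; [|apply mul_assoc; assumption].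
    apply mul_meq; try assumption; [apply bounded_op_mul; assumption| |apply meq_refl].
    apply IH; intros; apply H; lia.
Qed.

(** Regroups [n * (L + 1)] factors into [L + 1] consecutive blocks of length [n]. *)
Lemma mprodn_blocks (A : nat -> mat) n L : (1 <= n)%nat ->
  (forall i, (i < n * S L)%nat -> bounded_op (A i)) ->
  meq (mprodn Rs A (n * S L - 1))
      (mprodn Rs (fun l => mprodn Rs (fun q => A (l * n + q)%nat) (n - 1)) L).
Proof.
  intros Hn; induction L as [|L IH]; intros H.
  - simpl; replace (n * 1 - 1)%nat with (n - 1)%nat by lia; apply meq_refl.
  - cbn [mprodn].
    replace (n * S (S L) - 1)%nat with ((n * S L - 1) + S (n - 1))%nat by nia.
    eapply meq_trans; [apply mprodn_split; intros; apply H; nia|].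
    rewrite (mprodn_ext (fun i => A (S (n * S L - 1) + i)%nat) (fun q => A (S L * n + q)%nat) (n - 1))
      by (intros; f_equal; nia).
    apply mul_meq.
    + apply bounded_op_mprodn; intros; apply H; nia.
    + apply bounded_op_mprodn; intros; apply H; nia.
    + apply bounded_op_mprodn; intros; apply bounded_op_mprodn; intros; apply H; nia.
    + apply bounded_op_mprodn; intros; apply H; nia.
    + apply IH; intros; apply H; nia.
    + apply meq_refl.
Qed.

Lemma setpow_op_bound Sig K p M : (forall A, Sig A -> op_bound A K) -> (1 <= p)%nat ->
  setpow Rs Sig p M -> op_bound M (K ^ p).
Proof.
  intros HS Hp [A [HA ->]]; replace p with (S (p - 1)) at 2 by lia.
  apply op_bound_mprodn; intros; apply HS, HA; lia.
Qed.

Lemma setpow_split Sig p q M : (forall A, Sig A -> bounded_op A) -> (1 <= p)%nat -> (1 <= q)%nat ->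
  setpow Rs Sig (p + q) M ->
  exists P Q, setpow Rs Sig p P /\ setpow Rs Sig q Q /\ meq M (mmul Rs P Q).
Proof.
  intros HS Hp Hq [A [HA ->]].
  exists (mprodn Rs A (p - 1)), (mprodn Rs (fun i => A (S (p - 1) + i)%nat) (q - 1)).
  split; [|split].
  - exists A; split; [intros; apply HA; lia|reflexivity].
  - eexists; split; [|reflexivity]; intros; apply HA; lia.
  - replace (p + q - 1)%nat with ((p - 1) + S (q - 1))%nat by lia.
    apply mprodn_split; intros; apply HS, HA; lia.
Qed.

Lemma setpow_blocks Sig n l M : (forall A, Sig A -> bounded_op A) -> (1 <= n)%nat -> (1 <= l)%nat ->
  setpow Rs Sig (n * l) M ->
  exists B, (forall i, (i < l)%nat -> setpow Rs Sig n (B i)) /\ meq M (mprodn Rs B (l - 1)).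
Proof.
  intros HS Hn Hl [A [HA ->]].
  exists (fun i => mprodn Rs (fun q => A (i * n + q)%nat) (n - 1)); split.
  - intros i Hi; eexists; split; [|reflexivity]; intros q Hq; apply HA; nia.
  - replace (n * l - 1)%nat with (n * S (l - 1) - 1)%nat by (f_equal; f_equal; lia).
    apply mprodn_blocks; [assumption|]; intros; apply HS, HA; nia.
Qed.

Lemma setpow_unblocks Sig n l (B : nat -> mat) : (forall A, Sig A -> bounded_op A) ->
  (1 <= n)%nat -> (1 <= l)%nat -> (forall i, (i < l)%nat -> setpow Rs Sig n (B i)) ->
  exists M, setpow Rs Sig (n * l) M /\ meq (mprodn Rs B (l - 1)) M.
Proof.
  intros HS Hn Hl HB.
  destruct (choice_lt (fun _ _ _ => 0) l (fun i D =>
    (forall q, (q < n)%nat -> Sig (D q)) /\ B i = mprodn Rs D (n - 1)) HB) as [D HD].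
  (* Concatenation of the words: position [p] lies in block [p / n] at place [p mod n]. *)
  set (A := fun p => D (p / n)%nat (p mod n)%nat).
  assert (HA : forall p, (p < n * l)%nat -> Sig (A p)).
  { intros p Hp; apply HD; [apply Nat.Div0.div_lt_upper_bound; lia|apply Nat.mod_upper_bound; lia]. }
  exists (mprodn Rs A (n * l - 1)); split; [exists A; split; [assumption|reflexivity]|].
  rewrite (mprodn_ext B (fun i => mprodn Rs (fun q => A (i * n + q)%nat) (n - 1)) (l - 1)).
  - apply meq_sym; replace (n * l - 1)%nat with (n * S (l - 1) - 1)%nat by (f_equal; f_equal; lia).
    apply mprodn_blocks; [assumption|]; intros; apply HS, HA; nia.
  - intros i Hi; rewrite (proj2 (HD i ltac:(lia))); apply mprodn_ext; intros q Hq; unfold A.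
    rewrite Nat.div_add_l, Nat.div_small, Nat.add_0_r by lia.
    rewrite Nat.add_comm, Nat.Div0.mod_add, Nat.mod_small by lia; reflexivity.
Qed.

Lemma mprodn_had_le m alpha (F : nat -> nat -> mat) L :
  (forall j, (j < m)%nat -> 0 < alpha j) -> 1 <= fsum m alpha ->
  (forall l j, (l <= L)%nat -> (j < m)%nat -> bounded_op (F l j)) ->
  mle (mprodn Rs (fun l => had m alpha (F l)) L)
      (had m alpha (fun j => mprodn Rs (fun l => F l j) L)).
Proof.
  intros Ha Hs; induction L as [|L IH]; intros H; simpl.
  - intros i j _ _; apply Rle_refl.
  - assert (H1 : forall j, (j < m)%nat -> bounded_op (mprodn Rs (fun l => F l j) L))
      by (intros; apply bounded_op_mprodn; intros; apply H; lia).
    assert (H2 : forall j, (j < m)%nat -> bounded_op (F (S L) j)) by (intros; apply H; lia).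
    eapply mle_trans; [|apply had_mul_le; try assumption; intros; apply bounded_op_posop; auto].
    apply mul_mono.
    + apply bounded_op_posop, bounded_op_mprodn; intros; apply ex_op_bound_had; try assumption.
      intros; apply H; lia.
    + apply bounded_op_posop, ex_op_bound_had; assumption.
    + apply bounded_op_posop, ex_op_bound_had; assumption.
    + apply bounded_op_posop, ex_op_bound_had; assumption.
    + apply IH; intros; apply H; lia.
    + intros i j _ _; apply Rle_refl.
Qed.

(** The power [A^(p+1)], with the same index shift as in [mprodn]. *)
Definition mpow (A : mat) (p : nat) : mat := mprodn Rs (fun _ => A) p.

Lemma bounded_op_mpow A p : bounded_op A -> bounded_op (mpow A p).
Proof. intros; apply bounded_op_mprodn; intros; assumption. Qed.

Notation gamma := (gamma_op Rs Lm nrm).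

Lemma gamma_meq A B : bounded_op A -> meq A B -> gamma A = gamma B.
Proof.
  intros [K HA] [H1 H2].
  assert (HB : op_bound B K) by (apply (op_bound_dom B A); [apply (nonneg_mle A)|assumption|assumption];
    try assumption; apply HA).
  apply Rle_antisym; eapply gamma_mono; try eassumption; [apply HA|apply HB].
Qed.

Lemma gamma_mpow_fekete A : bounded_op A -> exists I : R, 0 <= I /\
  is_lim_seq (fun p => pw (gamma (mpow A p)) (/ INR (S p))) I /\
  forall p, I ^ S p <= gamma (mpow A p).
Proof.
  intros HA.
  destruct (fekete (fun k => gamma (mpow A (k - 1)))) as [I [I0 [I1 I2]]].
  - intros k _; destruct (bounded_op_mpow A (k - 1) HA) as [K HK]; apply (gamma_ge0 _ K HK).
  - intros k l Hk Hl.
    replace (k + l - 1)%nat with ((k - 1) + S (l - 1))%nat by lia.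
    rewrite (gamma_meq _ (mmul Rs (mpow A (k - 1)) (mpow A (l - 1)))).
    + destruct (bounded_op_mpow A (k - 1) HA) as [K HK], (bounded_op_mpow A (l - 1) HA) as [K' HK'].
      apply (gamma_mul_le _ _ K K'); assumption.
    + apply bounded_op_mpow; assumption.
    + apply (mprodn_split (fun _ => A)); intros; assumption.
  - exists I; split; [assumption|split].
    + apply (is_lim_seq_ext (fun p => pw (gamma (mpow A (S p - 1))) (/ INR (S p)))); [|exact I1].
      intros p; replace (S p - 1)%nat with p by lia; reflexivity.
    + intros p; specialize (I2 (S p) ltac:(lia)).
      replace (S p - 1)%nat with p in I2 by lia; exact I2.
Qed.

(** * The essential spectral radius *)

(** Banach's fixed point theorem: the iterates of [szero] form a Cauchy sequence by geometric
    decay. *)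
Lemma contraction_fixpoint (F : seqC -> seqC) q : 0 <= q < 1 ->
  (forall x, Lm x -> Lm (F x)) ->
  (forall x y, Lm x -> Lm y -> nrm (ssub (F x) (F y)) <= q * nrm (ssub x y)) ->
  exists x, Lm x /\ F x = x.
Proof.
  intros [Q0 Q1] HF Hq; set (u := fun p => Nat.iter p F szero).
  assert (Hu : forall p, Lm (u p)) by (induction p; [apply Lm_zero|apply HF; assumption]).
  set (a := nrm (ssub (u 1%nat) (u O))).
  assert (A0 : 0 <= a) by (apply nrm_ge0, Lm_sub; apply Hu).
  assert (Hstep : forall p, nrm (ssub (u (S p)) (u p)) <= q ^ p * a).
  { induction p as [|p IH]; [simpl; unfold a; simpl; lra|].
    eapply Rle_trans; [apply (Hq (u (S p)) (u p)); apply Hu|].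
    simpl; rewrite Rmult_assoc; apply Rmult_le_compat_l; assumption. }
  assert (Hk : forall p k, nrm (ssub (u (p + k)%nat) (u p)) <= q ^ p * (a / (1 - q))).
  (* The induction on [k] needs the exact partial geometric sum; the term [q ^ (p + k)] is dropped
     afterwards. *)
  { intros p k; apply Rle_trans with ((q ^ p - q ^ (p + k)) * (a / (1 - q))).
    - induction k as [|k IH].
      + rewrite Nat.add_0_r; replace (ssub (u p) (u p)) with szero by (seq_ext; ring).
        rewrite nrm_zero; lra.
      + replace (p + S k)%nat with (S (p + k)) by lia.
        eapply Rle_trans; [apply (nrm_sub_triangle _ (u (p + k)%nat)); apply Hu|].
        assert (X := Hstep (p + k)%nat).
        replace ((q ^ p - q ^ S (p + k)) * (a / (1 - q)))
          with ((q ^ p - q ^ (p + k)) * (a / (1 - q)) + q ^ (p + k) * a) by (simpl; field; lra).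
        lra.
    - assert (X := pow_le q (p + k) Q0).
      apply Rmult_le_compat_r; [apply Rdiv_le_0_compat|]; lra. }
  destruct (Lm_complete u Hu) as [l [Hl Hlim]].
  { intros eps Heps; set (c := a / (1 - q)).
    assert (C0 : 0 <= c) by (apply Rdiv_le_0_compat; lra).
    destruct (pow_lt_1_zero q) with (y := eps / (2 * (c + 1))) as [N HN];
      [rewrite Rabs_pos_eq; assumption|apply Rdiv_lt_0_compat; lra|].
    specialize (HN N (le_n N)); rewrite Rabs_pos_eq in HN by (apply pow_le; assumption).
    exists N; intros p r Hp Hr.
    eapply Rle_lt_trans; [apply (nrm_sub_triangle _ (u N)); apply Hu|].
    rewrite (nrm_sub_sym (u N)) by apply Hu.
    assert (X1 := Hk N (p - N)%nat); assert (X2 := Hk N (r - N)%nat); fold c in X1, X2.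
    replace (N + (p - N))%nat with p in X1 by lia; replace (N + (r - N))%nat with r in X2 by lia.
    assert (X3 : q ^ N * c <= eps / (2 * (c + 1)) * c) by (apply Rmult_le_compat_r; lra).
    assert (X4 : eps = eps / (2 * (c + 1)) * c * 2 + eps / (2 * (c + 1)) * 2) by (field; lra).
    assert (X5 : 0 < eps / (2 * (c + 1))) by (apply Rdiv_lt_0_compat; lra).
    lra. }
  exists l; split; [assumption|].
  assert (Hz : nrm (ssub (F l) l) = 0).
  { apply Rle_antisym; [|apply nrm_ge0, Lm_sub; [apply HF|]; assumption].
    apply le_epsilon; intros eps Heps.
    destruct (Hlim (eps / 2) ltac:(lra)) as [N HN].
    assert (X1 := HN N (le_n N)); assert (X2 := HN (S N) ltac:(lia)).
    assert (X3 := Hq l (u N) Hl (Hu N)); rewrite (nrm_sub_sym l) in X3 by (assumption || apply Hu).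
    assert (X4 := nrm_sub_triangle (F l) (u (S N)) l (HF l Hl) (Hu (S N)) Hl).
    assert (X5 := nrm_ge0 _ (Lm_sub _ _ (Hu N) Hl)).
    change (u (S N)) with (F (u N)) in *.
    assert (X6 : q * nrm (ssub (u N) l) <= 1 * nrm (ssub (u N) l)) by (apply Rmult_le_compat_r; lra).
    lra. }
  apply nrm_eq0 in Hz; [|apply Lm_sub; [apply HF|]; assumption].
  apply functional_extensionality; intros i.
  assert (Hi := f_equal (fun g => g i) Hz); unfold ssub, szero in Hi; simpl in Hi.
  replace (F l i) with (Cplus (Cminus (F l i) (l i)) (l i)) by ring; rewrite Hi; ring.
Qed.

Lemma Cmod_gt0_neq c : 0 < Cmod c -> c <> RtoC 0.
Proof. intros H ->; rewrite Cmod_0 in H; lra. Qed.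

(** [mu - Q_n B] is surjective: the solution is a fixed point of [x -> (y + Q_n B x) / mu], a
    contraction with constant [e / |mu|]. *)
Lemma tail_resolvent n B e mu y : bounded_op B -> tail_bound n B e -> 0 <= e < Cmod mu -> Lm y ->
  exists x, Lm x /\ sscal mu x = sadd y (tail n (matapp Rs B x)).
Proof.
  intros HB He [E0 E1] Hy; assert (PB := bounded_op_posop B HB).
  assert (Hmu : mu <> RtoC 0) by (apply Cmod_gt0_neq; lra).
  destruct (contraction_fixpoint (fun x => sscal (Cinv mu) (sadd y (tail n (matapp Rs B x))))
              (e / Cmod mu)) as [x [Hx Hfix]].
  - split; [apply Rdiv_le_0_compat; lra|].
    apply Rmult_lt_reg_r with (Cmod mu); [lra|]; field_simplify; lra.
  - intros x Hx; apply Lm_scal, Lm_add; [|apply Lm_tail, Lm_matapp]; assumption.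
  - intros x z Hx Hz.
    replace (ssub (sscal (Cinv mu) (sadd y (tail n (matapp Rs B x))))
                  (sscal (Cinv mu) (sadd y (tail n (matapp Rs B z)))))
      with (sscal (Cinv mu) (tail n (matapp Rs B (ssub x z)))).
    + assert (Hxz := Lm_sub x z Hx Hz).
      rewrite nrm_scal by (apply Lm_tail, Lm_matapp; assumption).
      rewrite Cmod_inv by assumption.
      replace (e / Cmod mu * nrm (ssub x z)) with (/ Cmod mu * (e * nrm (ssub x z))) by (field; lra).
      apply Rmult_le_compat_l; [apply Rlt_le, Rinv_0_lt_compat; lra|apply He; assumption].
    + rewrite linear_sub by (try apply linear_matapp; assumption).
      seq_ext; destruct (Nat.ltb i n); ring.
  - exists x; split; [assumption|]; rewrite <- Hfix at 1.
    seq_ext; field; assumption.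
Qed.

Lemma tail_resolvent_unique n B e mu x : tail_bound n B e -> e < Cmod mu -> Lm x ->
  sscal mu x = tail n (matapp Rs B x) -> x = szero.
Proof.
  intros He E1 Hx Heq; apply nrm_eq0; [assumption|].
  assert (H := He x Hx); rewrite <- Heq, nrm_scal in H by assumption.
  assert (H0 := nrm_ge0 x Hx); destruct H0 as [H0|H0]; [nra|lra].
Qed.

(** Padding by zero lets linear combinations run over all [t < n] even when the index set has fewer
    than [n] elements. *)
Definition unit0 (t : nat) : seqC := if inRb Rs t then unitv t else szero.

Lemma Lm_unit0 t : Lm (unit0 t).
Proof. unfold unit0; destruct (inRb Rs t) eqn:Ht; [apply Lm_unitv; assumption|apply Lm_zero]. Qed.

Lemma lincomb_succ d c v : lincomb (S d) c v = sadd (lincomb d c v) (sscal (c d) (v d)).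
Proof. reflexivity. Qed.

Lemma Lm_lincomb d c v : (forall t, (t < d)%nat -> Lm (v t)) -> Lm (lincomb d c v).
Proof.
  induction d as [|d IH]; intros H; [apply Lm_zero|].
  rewrite lincomb_succ; apply Lm_add; [apply IH; intros|apply Lm_scal]; apply H; lia.
Qed.

Lemma lincomb_unit0 n y : Lm y -> lincomb n y unit0 = head n y.
Proof.
  intros Hy; induction n as [|n IH]; [seq_ext; reflexivity|].
  rewrite lincomb_succ, IH; unfold unit0; destruct (inRb Rs n) eqn:Hn.
  - symmetry; apply head_succ; assumption.
  - rewrite head_succ_out by assumption; seq_ext; ring.
Qed.

(* [mu - B] is a finite-rank perturbation of the invertible operator [mu - tail n B]. *)
Lemma fredholm_of_gamma_lt B mu : bounded_op B -> gamma B < Cmod mu ->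
  fredholm Lm (fun x => ssub (sscal mu x) (matapp Rs B x)).
Proof.
  intros HB Hg; assert (PB := bounded_op_posop B HB); destruct HB as [K HK].
  assert (HB : bounded_op B) by (exists K; assumption).
  assert (G0 := gamma_ge0 B K HK); set (e := (gamma B + Cmod mu) / 2).
  destruct (tail_bound_of_gamma_lt B K e HK ltac:(unfold e; lra)) as [n He].
  assert (E : 0 <= e < Cmod mu) by (unfold e; lra).
  split.
  (* Kernel: if [mu x = B x], then [(mu - Q_n B) x = head n (B x)], so [x] is the combination of the
     solutions [z t] for the unit vectors, with the coordinates of [B x] as coefficients. *)
  - assert (Hz : forall t, exists z, Lm z /\ sscal mu z = sadd (unit0 t) (tail n (matapp Rs B z)))
      by (intros t; apply (tail_resolvent n B e); try assumption; apply Lm_unit0).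
    set (z := fun t => proj1_sig (constructive_indefinite_description _ (Hz t))).
    assert (Hz' : forall t, Lm (z t) /\ sscal mu (z t) = sadd (unit0 t) (tail n (matapp Rs B (z t))))
      by (intros t; unfold z; destruct (constructive_indefinite_description _ (Hz t)); assumption).
    exists n, z; split; [intros; apply Hz'|].
    intros x Hx Hker; exists (matapp Rs B x).
    set (c := matapp Rs B x) in *; assert (Hc : Lm c) by (apply Lm_matapp; assumption).
    assert (Hlc : forall d, sscal mu (lincomb d c z) =
              sadd (lincomb d c unit0) (tail n (matapp Rs B (lincomb d c z)))).
    { induction d as [|d IH].
      - change (lincomb 0 c z) with szero; change (lincomb 0 c unit0) with szero.
        rewrite (linear_zero (matapp Rs B)) by (apply linear_matapp; assumption).
        seq_ext; destruct (Nat.ltb i n); ring.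
      - rewrite !lincomb_succ.
        destruct (linear_matapp B PB) as [L1 L2].
        rewrite L1, L2, tail_add, tail_scal
          by (try apply Lm_scal; try apply Hz'; apply Lm_lincomb; intros; apply Hz').
        apply functional_extensionality; intros i.
        assert (X1 := f_equal (fun g => g i) IH).
        assert (X2 := f_equal (fun g => g i) (proj2 (Hz' d))); simpl in X1, X2.
        unfold sadd, sscal in *.
        transitivity (Cplus (Cmult mu (lincomb d c z i)) (Cmult (c d) (Cmult mu (z d i)))); [ring|].
        rewrite X1, X2; ring. }
    assert (Hlz : Lm (lincomb n c z)) by (apply Lm_lincomb; intros; apply Hz').
    assert (H0 : ssub x (lincomb n c z) = szero).
    { apply (tail_resolvent_unique n B e mu); [assumption|lra|apply Lm_sub; assumption|].
      rewrite (linear_sub (matapp Rs B)) by (try apply linear_matapp; assumption).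
      specialize (Hlc n); rewrite lincomb_unit0 in Hlc by assumption.
      fold c; apply functional_extensionality; intros i.
      assert (X1 := f_equal (fun g => g i) Hlc).
      assert (X2 := f_equal (fun g => g i) Hker); simpl in X1, X2.
      unfold sadd, sscal, ssub, szero, tail, head in *.
      transitivity (Cminus (Cplus (Cminus (Cmult mu (x i)) (c i)) (c i)) (Cmult mu (lincomb n c z i)));
        [ring|].
      rewrite X1, X2; destruct (Nat.ltb i n); ring. }
    apply functional_extensionality; intros i.
    assert (X := f_equal (fun g => g i) H0); unfold ssub, szero in X; simpl in X.
    replace (x i) with (Cplus (Cminus (x i) (lincomb n c z i)) (lincomb n c z i)) by ring.
    rewrite X; ring.
  (* Range: the solution of [(mu - Q_n B) x = y] satisfies [y = (mu - B) x + head n (B x)]. *)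
  - exists n, unit0; split; [intros; apply Lm_unit0|].
    intros y Hy; destruct (tail_resolvent n B e mu y HB He E Hy) as [x [Hx Heq]].
    exists x, (matapp Rs B x); split; [assumption|].
    rewrite lincomb_unit0 by (apply Lm_matapp; assumption).
    apply functional_extensionality; intros i; assert (X := f_equal (fun g => g i) Heq); simpl in X.
    unfold sadd, sscal, ssub, tail, head in *; rewrite X; destruct (Nat.ltb i n); ring.
Qed.

Lemma matapp_mmul A B x : bounded_op A -> bounded_op B -> Lm x ->
  matapp Rs (mmul Rs A B) x = matapp Rs A (matapp Rs B x).
Proof. intros [K HK] [K' HK'] Hx; apply (matapp_mul A B K K'); assumption. Qed.

Lemma mpow_eigen A lam x p : bounded_op A -> Lm x -> matapp Rs A x = sscal lam x ->
  matapp Rs (mpow A p) x = sscal (Cpow lam (S p)) x.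
Proof.
  intros HA Hx H; induction p as [|p IH].
  - unfold mpow; simpl; rewrite H; seq_ext; ring.
  - change (mpow A (S p)) with (mmul Rs (mpow A p) A).
    rewrite matapp_mmul, H by (try apply bounded_op_mpow; assumption).
    rewrite (proj2 (linear_matapp _ (bounded_op_posop _ (bounded_op_mpow A p HA)))), IH by assumption.
    seq_ext; simpl; ring.
Qed.

(** The factor [lam - A] divides [lam^(p+1) - A^(p+1)]. The induction uses [lam^(p+2) - A^(p+2) =
    (lam - A) lam^(p+1) + (lam^(p+1) - A^(p+1)) A]. *)
Lemma mpow_factor A lam x p : bounded_op A -> Lm x ->
  exists z, Lm z /\ ssub (sscal (Cpow lam (S p)) x) (matapp Rs (mpow A p) x) =
                    ssub (sscal lam z) (matapp Rs A z).
Proof.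
  intros HA; revert x; induction p as [|p IH]; intros x Hx.
  - exists x; split; [assumption|]; unfold mpow; simpl; seq_ext; ring.
  - change (mpow A (S p)) with (mmul Rs (mpow A p) A).
    rewrite matapp_mmul by (try apply bounded_op_mpow; assumption).
    assert (HAx : Lm (matapp Rs A x)) by (apply Lm_matapp; [apply bounded_op_posop|]; assumption).
    destruct (IH (matapp Rs A x) HAx) as [z [Hz Heq]].
    exists (sadd (sscal (Cpow lam (S p)) x) z); split; [apply Lm_add; [apply Lm_scal|]; assumption|].
    destruct (linear_matapp A (bounded_op_posop A HA)) as [L1 L2].
    rewrite L1, L2 by (try apply Lm_scal; assumption).
    apply functional_extensionality; intros i; assert (X := f_equal (fun g => g i) Heq); simpl in X.
    unfold sadd, sscal, ssub in *; simpl.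
    set (u := matapp Rs (mpow A p) (matapp Rs A x) i) in *.
    replace u with (Cminus (Cmult (Cmult lam (Cpow lam p)) (matapp Rs A x i))
      (Cminus (Cmult (Cmult lam (Cpow lam p)) (matapp Rs A x i)) u)) by ring.
    rewrite X; ring.
Qed.

(** The kernel of [lam - A] lies in that of [lam^(p+1) - A^(p+1)], and its range contains the range
    of the latter. *)
Lemma fredholm_of_mpow A lam p : bounded_op A ->
  fredholm Lm (fun x => ssub (sscal (Cpow lam (S p)) x) (matapp Rs (mpow A p) x)) ->
  fredholm Lm (fun x => ssub (sscal lam x) (matapp Rs A x)).
Proof.
  intros HA [[d [v [Hv H1]]] [d' [w [Hw H2]]]]; split.
  - exists d, v; split; [assumption|]; intros x Hx Hker; apply H1; [assumption|].
    rewrite (mpow_eigen A lam); try assumption; [seq_ext; ring|].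
    apply functional_extensionality; intros i; assert (X := f_equal (fun g => g i) Hker); simpl in X.
    unfold sscal, ssub, szero in *.
    replace (matapp Rs A x i) with (Cminus (Cmult lam (x i)) (Cminus (Cmult lam (x i)) (matapp Rs A x i)))
      by ring.
    rewrite X; ring.
  - exists d', w; split; [assumption|]; intros y Hy.
    destruct (H2 y Hy) as [x [c [Hx ->]]].
    destruct (mpow_factor A lam x p HA Hx) as [z [Hz Heq]].
    exists z, c; split; [assumption|rewrite Heq; reflexivity].
Qed.

Lemma not_fredholm_le A lam (I : R) : bounded_op A ->
  is_lim_seq (fun p => pw (gamma (mpow A p)) (/ INR (S p))) I ->
  ~ fredholm Lm (fun x => ssub (sscal lam x) (matapp Rs A x)) -> Cmod lam <= I.
Proof.
  intros HA HI Hnf; apply Rnot_lt_le; intros Hlt; apply Hnf.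
  apply is_lim_seq_spec in HI; assert (He : 0 < Cmod lam - I) by lra.
  destruct (HI (mkposreal _ He)) as [p Hp]; specialize (Hp p (le_n p)).
  apply Rabs_lt_between' in Hp; simpl pos in Hp.
  apply (fredholm_of_mpow A lam p HA), fredholm_of_gamma_lt; [apply bounded_op_mpow; assumption|].
  rewrite Cmod_pow; apply Rnot_le_lt; intros Hle.
  assert (X := pw_le _ _ (/ INR (S p)) (inv_INR_gt0 (S p) ltac:(lia)) Hle).
  rewrite pw_inv_pow in X by (try apply Cmod_ge_0; lia); lra.
Qed.

(** * Baire's theorem and approximate openness *)

(** If no [E k] were dense in a ball, shrinking balls could be chosen, the one at stage [k + 1]
    staying away from [E k]; the limit of their centres would then lie in no [E k]. *)
Lemma baire (E : nat -> seqC -> Prop) :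
  (forall y, Lm y -> exists k, E k y) ->
  exists k y0 eps, Lm y0 /\ 0 < eps /\ forall y, Lm y -> nrm (ssub y y0) < eps ->
    forall delta, 0 < delta -> exists z, Lm z /\ E k z /\ nrm (ssub y z) < delta.
Proof.
  intros Hcov; apply NNPP; intros Hn.
  (* A state is a centre with a radius. The new centre moves by less than half the radius, and the
     open ball of twice the new radius misses [E k]. The premises on [s] make the choice total. *)
  assert (Hstep : forall (k : nat) (s : seqC * R), exists s' : seqC * R,
    Lm (fst s) -> 0 < snd s ->
    Lm (fst s') /\ 0 < snd s' /\ snd s' <= snd s / 2 /\
    nrm (ssub (fst s') (fst s)) < snd s / 2 /\
    forall z, Lm z -> E k z -> 2 * snd s' <= nrm (ssub (fst s') z)).
  { intros k [y0 eps]; simpl.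
    destruct (classic (Lm y0 /\ 0 < eps)) as [[Hy0 Heps]|Hc]; [|exists (y0, eps); tauto].
    apply NNPP; intros Hn'; apply Hn; exists k, y0, (eps / 2).
    split; [assumption|split; [lra|]]; intros y Hy Hyy delta Hd.
    apply NNPP; intros Hz; apply Hn'; exists (y, Rmin (eps / 2) (delta / 2)); simpl.
    assert (M1 := Rmin_l (eps / 2) (delta / 2)); assert (M2 := Rmin_r (eps / 2) (delta / 2)).
    assert (M3 : 0 < Rmin (eps / 2) (delta / 2)) by (apply Rmin_glb_lt; lra).
    intros _ _; split; [assumption|split; [assumption|split; [assumption|split; [assumption|]]]].
    intros z Lz Ez; apply Rle_trans with delta; [lra|].
    apply Rnot_lt_le; intros H; apply Hz; exists z; split; [|split]; assumption. }
  set (next := fun k s => proj1_sig (constructive_indefinite_description _ (Hstep k s))).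
  set (s := fix s k := match k with O => (szero, 1) | S k' => next k' (s k') end).
  assert (Hs : forall k, Lm (fst (s k)) /\ 0 < snd (s k) <= (1 / 2) ^ k).
  { induction k as [|k [H1 [H2 H3]]]; simpl; [split; [apply Lm_zero|lra]|].
    unfold next; destruct (constructive_indefinite_description _ (Hstep k (s k))) as [s' Hs']; simpl.
    destruct (Hs' H1 H2) as [H4 [H5 [H6 _]]]; split; [assumption|lra]. }
  assert (Hs2 : forall k, snd (s (S k)) <= snd (s k) / 2 /\
    nrm (ssub (fst (s (S k))) (fst (s k))) < snd (s k) / 2 /\
    forall z, Lm z -> E k z -> 2 * snd (s (S k)) <= nrm (ssub (fst (s (S k))) z)).
  { intros k; destruct (Hs k) as [H1 [H2 _]]; simpl.
    unfold next; destruct (constructive_indefinite_description _ (Hstep k (s k))) as [s' Hs']; simpl.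
    apply Hs'; assumption. }
  (* Radii at least halve, so each move is shorter than the drop of the radius and the moves
     telescope. *)
  assert (Hd : forall k j, nrm (ssub (fst (s (k + j)%nat)) (fst (s k))) <= snd (s k)).
  { intros k j; apply Rle_trans with (snd (s k) - snd (s (k + j)%nat));
      [|destruct (Hs (k + j)%nat); lra].
    induction j as [|j IH].
    - rewrite Nat.add_0_r; replace (ssub (fst (s k)) (fst (s k))) with szero by (seq_ext; ring).
      rewrite nrm_zero; lra.
    - replace (k + S j)%nat with (S (k + j)) by lia.
      eapply Rle_trans; [apply (nrm_sub_triangle _ (fst (s (k + j)%nat))); apply Hs|].
      destruct (Hs2 (k + j)%nat) as [X1 [X2 _]]; lra. }
  destruct (Lm_complete (fun k => fst (s k))) as [l [Hl Hlim]].
  - intros k; apply Hs.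
  - intros eps Heps.
    destruct (pow_lt_1_zero (1 / 2)) with (y := eps / 2) as [N HN];
      [rewrite Rabs_pos_eq; lra|lra|].
    specialize (HN N (le_n N)); rewrite Rabs_pos_eq in HN by (apply pow_le; lra).
    exists N; intros p q Hp Hq.
    eapply Rle_lt_trans; [apply (nrm_sub_triangle _ (fst (s N))); apply Hs|].
    rewrite (nrm_sub_sym (fst (s N))) by apply Hs.
    assert (X1 := Hd N (p - N)%nat); assert (X2 := Hd N (q - N)%nat).
    replace (N + (p - N))%nat with p in X1 by lia; replace (N + (q - N))%nat with q in X2 by lia.
    destruct (Hs N); lra.
  - assert (Hl' : forall k, nrm (ssub (fst (s k)) l) <= snd (s k)).
    { intros k; apply le_epsilon; intros eta Heta; destruct (Hlim eta Heta) as [N HN].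
      specialize (HN (k + N)%nat ltac:(lia)).
      eapply Rle_trans; [apply (nrm_sub_triangle _ (fst (s (k + N)%nat))); try apply Hs; assumption|].
      rewrite nrm_sub_sym by apply Hs; assert (X := Hd k N); lra. }
    (* The limit is within one radius of centre [k + 1], but membership in [E k] would put it at
       least two radii away. *)
    destruct (Hcov l Hl) as [k Hk].
    assert (X := proj2 (proj2 (Hs2 k)) l Hl Hk).
    assert (X2 := Hl' (S k)); destruct (Hs (S k)); lra.
Qed.

Lemma lincomb_scal_sub d a c1 c0 w :
  lincomb d (fun t => Cmult a (Cminus (c1 t) (c0 t))) w =
  sscal a (ssub (lincomb d c1 w) (lincomb d c0 w)).
Proof.
  induction d as [|d IH]; [unfold lincomb; simpl; seq_ext; ring|].
  rewrite !lincomb_succ, IH; seq_ext; ring.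
Qed.

(** The first half of the open mapping theorem, modulo the span of [w]: by Baire, the vectors with a
    preimage and coefficients of size at most some [k] are dense in a ball, and differences of such
    vectors carry this to the unit ball. *)
Lemma approx_open T d w : linear T -> (forall x, Lm x -> Lm (T x)) ->
  (forall t, (t < d)%nat -> Lm (w t)) ->
  (forall y, Lm y -> exists x c, Lm x /\ y = sadd (T x) (lincomb d c w)) ->
  exists K, 0 <= K /\ forall y, Lm y -> nrm y <= 1 -> exists x c, Lm x /\ nrm x <= K /\
    (forall t, (t < d)%nat -> Cmod (c t) <= K) /\
    nrm (ssub y (sadd (T x) (lincomb d c w))) <= 1 / 2.
Proof.
  intros HT LT Hw Hsurj.
  destruct (baire (fun k y => exists x c, Lm x /\ nrm x <= INR k /\
              (forall t, (t < d)%nat -> Cmod (c t) <= INR k) /\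
              y = sadd (T x) (lincomb d c w))) as [k [y0 [eps [Hy0 [Heps H]]]]].
  { intros y Hy; destruct (Hsurj y Hy) as [x [c [Hx Heq]]].
    assert (X0 := nrm_ge0 x Hx).
    assert (X1 : 0 <= fsum d (fun t => Cmod (c t))) by (apply fsum_ge0; intros; apply Cmod_ge_0).
    destruct (nfloor_ex (nrm x + fsum d (fun t => Cmod (c t)))) as [k Hk]; [lra|].
    exists (S k), x, c; rewrite S_INR; split; [assumption|split; [lra|split; [|assumption]]].
    intros t Ht.
    assert (X2 := fsum_term_le d t (fun t => Cmod (c t)) (fun t _ => Cmod_ge_0 (c t)) Ht).
    simpl in X2; lra. }
  assert (Hk := pos_INR k).
  (* [y] is scaled by [eps / 2] into the ball around [y0]; the difference of two preimages of size
     [k] is scaled back by [2 / eps]. The two errors [eps / 8] together become [1 / 2]. *)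
  exists (2 / eps * (2 * INR k)); split; [apply Rmult_le_pos; [apply Rdiv_le_0_compat|]; lra|].
  intros y Hy Hy1; set (a := RtoC (eps / 2)); set (b := RtoC (2 / eps)).
  assert (Hab : Cmult b a = RtoC 1)
    by (unfold a, b; rewrite <- RtoC_mult; f_equal; field; lra).
  assert (Hb : Cmod b = 2 / eps)
    by (unfold b; rewrite Cmod_R, Rabs_pos_eq; [reflexivity|apply Rdiv_le_0_compat; lra]).
  set (y1 := sadd y0 (sscal a y)).
  assert (Ly1 : Lm y1) by (apply Lm_add; [|apply Lm_scal]; assumption).
  destruct (H y1 Ly1) with (delta := eps / 8) as [z1 [Lz1 [[x1 [c1 [X1 [N1 [C1 E1]]]]] D1]]];
    [|lra|].
  { replace (ssub y1 y0) with (sscal a y) by (unfold y1; seq_ext; ring).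
    rewrite nrm_scal by assumption; unfold a; rewrite Cmod_R, Rabs_pos_eq by lra.
    assert (Z := nrm_ge0 y Hy); nra. }
  destruct (H y0 Hy0) with (delta := eps / 8) as [z0 [Lz0 [[x0 [c0 [X0 [N0 [C0 E0]]]]] D0]]];
    [|lra|].
  { replace (ssub y0 y0) with szero by (seq_ext; ring); rewrite nrm_zero; assumption. }
  exists (sscal b (ssub x1 x0)), (fun t => Cmult b (Cminus (c1 t) (c0 t))).
  split; [apply Lm_scal, Lm_sub; assumption|split; [|split]].
  - rewrite nrm_scal, Hb by (apply Lm_sub; assumption).
    apply Rmult_le_compat_l; [apply Rdiv_le_0_compat; lra|].
    eapply Rle_trans; [apply nrm_sub_le; assumption|lra].
  - intros t Ht; rewrite Cmod_mult, Hb; apply Rmult_le_compat_l; [apply Rdiv_le_0_compat; lra|].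
    unfold Cminus; eapply Rle_trans; [apply Cmod_triangle|]; rewrite Cmod_opp.
    assert (Y1 := C1 t Ht); assert (Y0 := C0 t Ht); lra.
  - rewrite lincomb_scal_sub, (proj2 HT), (linear_sub T) by (try apply Lm_sub; assumption).
    replace (ssub y _) with (sscal b (ssub (ssub y1 z1) (ssub y0 z0))).
    + rewrite nrm_scal, Hb by (apply Lm_sub; apply Lm_sub; assumption).
      assert (Y := nrm_sub_le (ssub y1 z1) (ssub y0 z0) (Lm_sub _ _ Ly1 Lz1) (Lm_sub _ _ Hy0 Lz0)).
      apply Rle_trans with (2 / eps * (eps / 4)); [|right; field; lra].
      apply Rmult_le_compat_l; [apply Rdiv_le_0_compat|]; lra.
    + rewrite E1, E0; unfold y1; apply functional_extensionality; intros i.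
      unfold sadd, sscal, ssub.
      transitivity (Cplus (Cmult (Cmult b a) (y i)) (Cmult b (Cminus
        (Cplus (T x0 i) (lincomb d c0 w i)) (Cplus (T x1 i) (lincomb d c1 w i))))); [ring|].
      rewrite Hab; ring.
Qed.

(** * Sums of powers *)

(** As [mpow B i] is [B^(i+1)], this is [S_K = B + ... + B^K]. *)
Definition power_sum (B : mat) (K : nat) : mat := fun r s => fsum K (fun i => mpow B i r s).

Lemma bounded_op_power_sum B K : bounded_op B -> bounded_op (power_sum B K).
Proof.
  intros HB; unfold power_sum; induction K as [|K [e IH]]; simpl.
  - exists 0; split; [lra|split; [apply posop_zero|apply tail_bound_zero]].
  - destruct (bounded_op_mpow B K HB) as [e' He']; exists (e + e').
    apply (op_bound_add (fun r s => fsum K (fun i => mpow B i r s))); assumption.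
Qed.

Lemma matapp_power_sum_succ B K x : bounded_op B -> Lm x ->
  matapp Rs (power_sum B (S K)) x = sadd (matapp Rs (power_sum B K) x) (matapp Rs (mpow B K) x).
Proof.
  intros HB Hx.
  apply (posop_add (power_sum B K) (mpow B K)); [| |assumption]; apply bounded_op_posop;
    [apply bounded_op_power_sum|apply bounded_op_mpow]; assumption.
Qed.

(** The identity [S_K B = S_K - B + B^(K+1)]. *)
Lemma power_sum_telescope B K x : bounded_op B -> Lm x ->
  matapp Rs (power_sum B K) (matapp Rs B x) =
  sadd (ssub (matapp Rs (power_sum B K) x) (matapp Rs B x)) (matapp Rs (mpow B K) x).
Proof.
  intros HB Hx; assert (HBx : Lm (matapp Rs B x)) by (apply Lm_matapp; [apply bounded_op_posop|]; assumption).
  induction K as [|K IH].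
  - change (power_sum B 0) with (fun _ _ : nat => 0); rewrite !(proj2 posop_zero).
    change (mpow B 0) with B; seq_ext; ring.
  - rewrite !matapp_power_sum_succ, IH by assumption.
    change (mpow B (S K)) with (mmul Rs (mpow B K) B).
    rewrite (matapp_mmul (mpow B K)) by (try apply bounded_op_mpow; assumption); seq_ext; ring.
Qed.

Lemma mmul_add_l A B D : bounded_op A -> bounded_op B -> bounded_op D ->
  forall i j, inRb Rs i = true -> inRb Rs j = true ->
  mmul Rs (fun r s => A r s + B r s) D i j = mmul Rs A D i j + mmul Rs B D i j.
Proof.
  intros HA HB HD i j Hi Hj; apply RtoC_inj.
  rewrite RtoC_plus, <- !matapp_matapp_unitv by assumption.
  rewrite (proj2 (posop_add A B (bounded_op_posop A HA) (bounded_op_posop B HB)))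
    by (apply Lm_matapp; [apply bounded_op_posop|apply Lm_unitv]; assumption).
  reflexivity.
Qed.

Lemma mpow_le_power_sum B i K : bounded_op B -> (i < K)%nat -> mle (mpow B i) (power_sum B K).
Proof.
  intros HB Hi r s Hr Hs; apply (fsum_term_le K i (fun i => mpow B i r s)); [|assumption].
  intros; apply bounded_op_nonneg; try apply bounded_op_mpow; assumption.
Qed.

Lemma power_sum_mono B k p : bounded_op B -> (k <= p)%nat -> mle (power_sum B k) (power_sum B p).
Proof.
  intros HB Hkp r s Hr Hs; induction Hkp as [|p Hkp IH]; [apply Rle_refl|].
  assert (H := bounded_op_nonneg _ (bounded_op_mpow B p HB) r s Hr Hs).
  change (power_sum B (S p) r s) with (power_sum B p r s + mpow B p r s); lra.
Qed.

(* The product contains [mpow B i * mpow B (k - 1 - i) = B^(k+1)] for every [i < j]. *)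
Lemma power_sum_sqr_ge B k j : bounded_op B -> (j <= k)%nat ->
  mle (fun r s => INR j * mpow B k r s) (mmul Rs (power_sum B j) (power_sum B k)).
Proof.
  intros HB; induction j as [|j IH]; intros Hj.
  - intros r s Hr Hs; simpl; rewrite Rmult_0_l.
    apply nonneg_mul; try apply bounded_op_posop, bounded_op_power_sum; assumption.
  - intros r s Hr Hs; rewrite S_INR, Rmult_plus_distr_r, Rmult_1_l.
    change (power_sum B (S j)) with (fun r s => power_sum B j r s + mpow B j r s).
    rewrite mmul_add_l by (try apply bounded_op_power_sum; try apply bounded_op_mpow; assumption).
    apply Rplus_le_compat; [apply IH; [lia|assumption|assumption]|].
    eapply Rle_trans.
    + replace k with (j + S (k - j - 1))%nat at 1 by lia.
      apply (mprodn_split (fun _ => B)); try assumption; intros; assumption.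
    + apply mul_mono; try assumption; try apply bounded_op_posop, bounded_op_mpow; try apply bounded_op_posop, bounded_op_power_sum;
        try assumption.
      * intros ? ? _ _; apply Rle_refl.
      * apply mpow_le_power_sum; [assumption|lia].
Qed.

Lemma mmul_scal c d A B r s :
  mmul Rs (fun i j => c * A i j) (fun i j => d * B i j) r s = c * d * mmul Rs A B r s.
Proof.
  unfold mmul, sumR; rewrite <- Series_scal_l; apply Series_ext; intros l.
  destruct (inRb Rs l); ring.
Qed.

Lemma mpow_scal c A p : mpow (fun i j => c * A i j) p = (fun i j => c ^ S p * mpow A p i j).
Proof.
  induction p as [|p IH].
  - apply functional_extensionality; intros i; apply functional_extensionality; intros j.
    unfold mpow; simpl; ring.
  - change (mpow (fun i j => c * A i j) (S p))
      with (mmul Rs (mpow (fun i j => c * A i j) p) (fun i j => c * A i j)).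
    rewrite IH; apply functional_extensionality; intros i; apply functional_extensionality; intros j.
    rewrite mmul_scal; change (mpow A (S p)) with (mmul Rs (mpow A p) A); simpl; ring.
Qed.

(** One truncation index serves all coefficients bounded by [K], because only the [d] vectors
    [A (w t)] are involved. *)
Lemma tail_matapp_lincomb_small A d w K eta : bounded_op A -> 0 <= K -> 0 < eta ->
  (forall t, (t < d)%nat -> Lm (w t)) ->
  exists N, forall n, (N <= n)%nat -> forall c, (forall t, (t < d)%nat -> Cmod (c t) <= K) ->
    nrm (tail n (matapp Rs A (lincomb d c w))) <= eta.
Proof.
  intros HA HK; revert eta; induction d as [|d IH]; intros eta Heta Hw.
  - exists O; intros n _ c _; change (lincomb 0 c w) with szero.
    rewrite (linear_zero (matapp Rs A)) by (apply linear_matapp, bounded_op_posop; assumption).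
    replace (tail n szero) with szero by (seq_ext; destruct (Nat.ltb i n); reflexivity).
    rewrite nrm_zero; lra.
  - destruct (IH (eta / 2) ltac:(lra)) as [N1 H1]; [intros; apply Hw; lia|].
    assert (Hd : Lm (w d)) by (apply Hw; lia).
    assert (HAd : Lm (matapp Rs A (w d))) by (apply Lm_matapp; [apply bounded_op_posop|]; assumption).
    destruct (Htail _ HAd (eta / (2 * (K + 1)))) as [N2 H2]; [apply Rdiv_lt_0_compat; lra|].
    exists (N1 + N2)%nat; intros n Hn c Hc; rewrite lincomb_succ.
    assert (Hl : Lm (lincomb d c w)) by (apply Lm_lincomb; intros; apply Hw; lia).
    destruct (linear_matapp A (bounded_op_posop A HA)) as [L1 L2].
    rewrite L1, L2, tail_add, tail_scal by (try apply Lm_scal; assumption).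
    eapply Rle_trans; [apply nrm_add|].
    + apply Lm_tail, Lm_matapp; [apply bounded_op_posop|]; assumption.
    + apply Lm_scal, Lm_tail; assumption.
    + rewrite nrm_scal by (apply Lm_tail; assumption).
      assert (X1 := H1 n ltac:(lia) c (fun t Ht => Hc t (Nat.lt_lt_succ_r _ _ Ht))).
      assert (X2 := H2 n ltac:(lia)); assert (X3 := Hc d ltac:(lia)).
      assert (X4 : Cmod (c d) * nrm (tail n (matapp Rs A (w d))) <= K * (eta / (2 * (K + 1)))).
      { apply Rmult_le_compat; [apply Cmod_ge_0|apply nrm_ge0, Lm_tail; assumption|assumption|lra]. }
      assert (X5 : eta / 2 = K * (eta / (2 * (K + 1))) + eta / (2 * (K + 1))) by (field; lra).
      assert (X6 : 0 < eta / (2 * (K + 1))) by (apply Rdiv_lt_0_compat; lra).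
      lra.
Qed.

(** * Approximate openness of [s - A] leads to a contradiction *)

Section LowerBound.
Context (A : mat) (KA s : R) (HA : op_bound A KA) (Hs0 : 0 < s).
Context (Hlim : is_lim_seq (fun p => pw (gamma (mpow A p)) (/ INR (S p))) s).
Context (Hlow : forall p, s ^ S p <= gamma (mpow A p)).
Context (K : R) (HK0 : 0 <= K) (d : nat) (w : nat -> seqC).
Context (Hw : forall t, (t < d)%nat -> Lm (w t)).
Context (Hopen : forall y, Lm y -> nrm y <= 1 -> exists x c, Lm x /\ nrm x <= K /\
  (forall t, (t < d)%nat -> Cmod (c t) <= K) /\
  nrm (ssub y (sadd (ssub (sscal (RtoC s) x) (matapp Rs A x)) (lincomb d c w))) <= 1 / 2).

Let eA : bounded_op A := ex_intro _ KA HA.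

Lemma bounded_op_inv_scal t : 0 < t -> bounded_op (fun i j => / t * A i j).
Proof.
  intros Ht; exists (/ t * KA); apply op_bound_scal; [|assumption].
  apply Rlt_le, Rinv_0_lt_compat; assumption.
Qed.

Lemma gamma_mpow_small t k : s < t ->
  exists p, (k <= p)%nat /\ gamma (mpow (fun i j => / t * A i j) p) <= 1.
Proof.
  intros Ht; assert (H := Hlim); apply is_lim_seq_spec in H; assert (He : 0 < t - s) by lra.
  destruct (H (mkposreal _ He)) as [N HN]; simpl pos in HN.
  exists (k + N)%nat; split; [lia|]; set (p := (k + N)%nat).
  specialize (HN p ltac:(unfold p; lia)); apply Rabs_lt_between' in HN.
  destruct (bounded_op_mpow A p eA) as [Kp HKp].
  assert (G0 := gamma_ge0 _ Kp HKp).
  assert (Hti : 0 < / t) by (apply Rinv_0_lt_compat; lra).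
  rewrite mpow_scal; eapply Rle_trans.
  - apply (gamma_scal_le _ _ Kp); [apply pow_le; lra|assumption].
  - assert (Hp : gamma (mpow A p) <= t ^ S p).
    { rewrite <- (pow_pw_inv (gamma (mpow A p)) (S p)) by (assumption || lia).
      apply pow_incr; split; [apply pw_ge0|lra]. }
    rewrite pow_inv.
    assert (T0 : 0 < t ^ S p) by (apply pow_lt; lra).
    rewrite <- (Rinv_l (t ^ S p)) by lra.
    apply Rmult_le_compat_l; [apply Rlt_le, Rinv_0_lt_compat|]; assumption.
Qed.

(* Writing [y = (s - A) x + w c + e] with [|e| <= 1/2], the telescoped sum [S] satisfies
   [S y = A x - t B^(p+1) x - (t - s) S x + S (w c) + S e]; taking tails bounds [gamma S]
   by a constant plus [3/4 gamma S]. *)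
Lemma gamma_power_sum_le t k : s < t -> t <= 2 * s -> (t - s) * K <= 1 / 4 ->
  gamma (power_sum (fun i j => / t * A i j) k) <= 4 * (KA * K + 4 * s * K + 1).
Proof.
  intros Ht1 Ht2 Ht3; set (B := fun i j => / t * A i j).
  assert (T0 : 0 < t) by lra.
  assert (eB : bounded_op B) by (apply bounded_op_inv_scal; assumption).
  (* The sum is extended from [k] to some [p >= k] for which [B^(p+1)] has small [gamma]; by
     positivity the longer sum dominates the shorter one. *)
  destruct (gamma_mpow_small t k Ht1) as [p [Hkp Hp]]; fold B in Hp.
  set (X := power_sum B p); assert (eX : bounded_op X) by (apply bounded_op_power_sum; assumption).
  assert (Hmono : gamma (power_sum B k) <= gamma X).
  { destruct eX as [KX HX]; apply (gamma_mono _ _ KX); [|assumption|].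
    - apply bounded_op_nonneg, bounded_op_power_sum; assumption.
    - apply power_sum_mono; assumption. }
  eapply Rle_trans; [apply Hmono|].
  assert (PX := bounded_op_posop X eX); assert (HX := eX); destruct HX as [KX HX].
  assert (eP : bounded_op (mpow B p)) by (apply bounded_op_mpow; assumption).
  assert (HP := eP); destruct HP as [KP HP].
  assert (G0 := gamma_ge0 X KX HX).
  (* [KA * K] bounds [A x], [4 * s * K] bounds [t B^(p+1) x] through [t <= 2 s] and tail bound 2,
     and 1 bounds the tail of [S (w c)]. *)
  set (D := KA * K + 4 * s * K + 1).
  assert (KA0 : 0 <= KA) by apply HA.
  assert (D0 : 0 <= D) by (unfold D; assert (0 <= KA * K) by (apply Rmult_le_pos; lra);
    assert (0 <= s * K) by (apply Rmult_le_pos; lra); lra).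
  assert (Hself : forall eta, 0 < eta -> gamma X <= D + 3 / 4 * (gamma X + eta)).
  { intros eta Heta; set (g := gamma X + eta).
    destruct (tail_bound_of_gamma_lt X KX g HX ltac:(unfold g; lra)) as [n1 N1].
    destruct (tail_bound_of_gamma_lt (mpow B p) KP 2 HP ltac:(lra)) as [n2 N2].
    destruct (tail_matapp_lincomb_small X d w K 1 eX HK0 ltac:(lra) Hw) as [n3 N3].
    set (n := (n1 + n2 + n3)%nat).
    apply (gamma_le_tail_bound n X KX); [assumption|unfold g; lra|].
    apply tail_bound_of_unit_ball; [assumption|]; intros y Hy Hy1.
    destruct (Hopen y Hy Hy1) as [x [c [Hx [Hxk [Hc He]]]]].
    set (v := lincomb d c w) in *.
    assert (Hv : Lm v) by (apply Lm_lincomb; assumption).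
    set (e := ssub y _) in He.
    assert (PA : posop A) by apply HA.
    assert (HAx : Lm (matapp Rs A x)) by (apply Lm_matapp; assumption).
    assert (HTx : Lm (ssub (sscal (RtoC s) x) (matapp Rs A x)))
      by (apply Lm_sub; [apply Lm_scal|]; assumption).
    assert (Le : Lm e) by (apply Lm_sub; [|apply Lm_add]; assumption).
    assert (Lx : Lm (matapp Rs X x)) by (apply Lm_matapp; assumption).
    assert (Lp : Lm (matapp Rs (mpow B p) x)) by (apply Lm_matapp; [apply bounded_op_posop|]; assumption).
    assert (LXv : Lm (matapp Rs X v)) by (apply Lm_matapp; assumption).
    assert (LXe : Lm (matapp Rs X e)) by (apply Lm_matapp; assumption).
    assert (LBx : Lm (matapp Rs B x)) by (apply Lm_matapp; [apply bounded_op_posop|]; assumption).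
    destruct (linear_matapp X PX) as [L1 L2].
    assert (HB : matapp Rs A x = sscal (RtoC t) (matapp Rs B x)).
    { unfold B; rewrite (proj2 (posop_scal (/ t) A ltac:(apply Rlt_le, Rinv_0_lt_compat; assumption) PA))
        by assumption.
      seq_ext; rewrite Cmult_assoc, <- RtoC_mult, Rinv_r by lra; ring. }
    assert (HXA : matapp Rs X (matapp Rs A x) =
      sadd (ssub (sscal (RtoC t) (matapp Rs X x)) (matapp Rs A x))
           (sscal (RtoC t) (matapp Rs (mpow B p) x))).
    { rewrite HB, L2 by assumption; unfold X; rewrite power_sum_telescope by assumption.
      seq_ext; ring. }
    assert (Hdec : y = sadd (sadd (ssub (sscal (RtoC s) x) (matapp Rs A x)) v) e)
      by (unfold e; seq_ext; ring).
    assert (HXy : matapp Rs X y = sadd (sadd (sadd (sadd (matapp Rs A x)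
        (sscal (RtoC (- t)) (matapp Rs (mpow B p) x)))
        (sscal (RtoC (s - t)) (matapp Rs X x))) (matapp Rs X v)) (matapp Rs X e)).
    { assert (Lsx : Lm (sscal (RtoC s) x)) by (apply Lm_scal; assumption).
      assert (LX : linear (matapp Rs X)) by (split; assumption).
      rewrite Hdec at 1; rewrite L1 by (first [assumption | apply Lm_add; assumption]).
      rewrite L1 by assumption.
      rewrite (linear_sub (matapp Rs X)), L2, HXA by assumption.
      rewrite RtoC_minus, RtoC_opp; seq_ext; ring. }
    rewrite HXy, !tail_add, !tail_scal.
    assert (T1 : nrm (tail n (matapp Rs A x)) <= KA * K).
    { eapply Rle_trans; [apply nrm_tail_le; assumption|].
      eapply Rle_trans; [apply (op_bound_nrm A KA); assumption|].
      apply Rmult_le_compat_l; assumption. }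
    assert (T2 : nrm (tail n (matapp Rs (mpow B p) x)) <= 2 * K).
    { eapply Rle_trans; [apply (tail_bound_anti n2 n); [apply bounded_op_posop| | |]; try eassumption; unfold n; lia|].
      apply Rmult_le_compat_l; lra. }
    assert (g0 : 0 <= g) by (unfold g; lra).
    assert (T3 : nrm (tail n (matapp Rs X x)) <= g * K).
    { eapply Rle_trans; [apply (tail_bound_anti n1 n X g); try assumption; unfold n; lia|].
      apply Rmult_le_compat_l; lra. }
    assert (T4 : nrm (tail n (matapp Rs X v)) <= 1) by (apply N3; [unfold n; lia|assumption]).
    assert (T5 : nrm (tail n (matapp Rs X e)) <= g * (1 / 2)).
    { eapply Rle_trans; [apply (tail_bound_anti n1 n X g); try assumption; unfold n; lia|].
      apply Rmult_le_compat_l; lra. }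
    assert (Lt := Lm_tail n).
    assert (H5 := nrm_add _ _ (Lm_add _ _ (Lm_add _ _ (Lm_add _ _ (Lt _ HAx)
      (Lm_scal (RtoC (- t)) _ (Lt _ Lp))) (Lm_scal (RtoC (s - t)) _ (Lt _ Lx))) (Lt _ LXv)) (Lt _ LXe)).
    assert (H4 := nrm_add _ _ (Lm_add _ _ (Lm_add _ _ (Lt _ HAx)
      (Lm_scal (RtoC (- t)) _ (Lt _ Lp))) (Lm_scal (RtoC (s - t)) _ (Lt _ Lx))) (Lt _ LXv)).
    assert (H3 := nrm_add _ _ (Lm_add _ _ (Lt _ HAx)
      (Lm_scal (RtoC (- t)) _ (Lt _ Lp))) (Lm_scal (RtoC (s - t)) _ (Lt _ Lx))).
    assert (H2 := nrm_add _ _ (Lt _ HAx) (Lm_scal (RtoC (- t)) _ (Lt _ Lp))).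
    rewrite (nrm_scal (RtoC (- t))), Cmod_R, Rabs_Ropp, Rabs_pos_eq in H2 by (try apply Lt; lra || assumption).
    rewrite (nrm_scal (RtoC (s - t))), Cmod_R, Rabs_minus_sym, Rabs_pos_eq in H3
      by (try apply Lt; lra || assumption).
    assert (U2 : t * nrm (tail n (matapp Rs (mpow B p) x)) <= 2 * s * (2 * K)).
    { apply Rmult_le_compat; try lra; apply nrm_ge0, Lt; assumption. }
    assert (U3 : (t - s) * nrm (tail n (matapp Rs X x)) <= g * (1 / 4)).
    { apply Rle_trans with ((t - s) * (g * K)); [apply Rmult_le_compat_l; lra|].
      replace ((t - s) * (g * K)) with (g * ((t - s) * K)) by ring.
      apply Rmult_le_compat_l; lra. }
    unfold D; lra. }
  (* The fraction 3/4 is 1/4 from [(t - s) K] plus 1/2 from the error [e]; solving for [gamma X]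
     gives [4 D + eta]. *)
  apply le_epsilon; intros eta Heta; specialize (Hself (eta / 3) ltac:(lra)); lra.
Qed.

Lemma lower_bound_contradiction : False.
Proof.
  set (M := 4 * (KA * K + 4 * s * K + 1)).
  assert (KA0 : 0 <= KA) by apply HA.
  assert (Hk : forall k, (1 <= k)%nat -> INR k <= M * M).
  { intros k Hk.
    (* With [t = s + h / (p + 1)] this ensures [t <= 2 s] and [(t - s) K <= 1/4] for every [p]. *)
    set (h := Rmin s (/ (4 * (K + 1)))).
    assert (Hi : 0 < / (4 * (K + 1))) by (apply Rinv_0_lt_compat; lra).
    assert (h0 : 0 < h) by (apply Rmin_glb_lt; lra).
    assert (h1 : h <= s) by apply Rmin_l.
    assert (h2 : h <= / (4 * (K + 1))) by apply Rmin_r.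
    assert (Hp : forall p, s ^ S k * INR k <= (s + h * / INR (S p)) ^ S k * (M * M)).
    { intros p; set (q := / INR (S p)).
      assert (q0 : 0 < q) by (apply inv_INR_gt0; lia).
      assert (q1 : q <= 1).
      { unfold q; rewrite <- Rinv_1; apply Rinv_le_contravar; [lra|].
        rewrite S_INR; assert (X := pos_INR p); lra. }
      set (t := s + h * q).
      assert (hq : 0 < h * q <= h) by (split; nra).
      assert (T0 : 0 < t) by (unfold t; lra).
      set (B := fun i j => / t * A i j).
      assert (eB : bounded_op B) by (apply bounded_op_inv_scal; assumption).
      assert (HS : gamma (power_sum B k) <= M).
      { apply gamma_power_sum_le; unfold t; try lra.
        apply Rle_trans with (/ (4 * (K + 1)) * (K + 1)); [|right; field; lra].
        apply Rmult_le_compat; lra. }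
      destruct (bounded_op_power_sum B k eB) as [KS HKS].
      destruct (bounded_op_mpow B k eB) as [KB HKB].
      assert (GS := gamma_ge0 _ _ HKS).
      assert (Ik : 0 < INR k) by (apply INR_gt0; assumption).
      assert (H1 : INR k * gamma (mpow B k) <= M * M).
      { apply Rle_trans with (gamma (fun r q => INR k * mpow B k r q)).
        - assert (Hsc : op_bound (fun r q => INR k * mpow B k r q) (INR k * KB))
            by (apply op_bound_scal; [lra|assumption]).
          (* [gamma_scal_le] is one-sided; applied with the inverse factor it gives the opposite
             inequality. *)
          assert (Y := gamma_scal_le (/ INR k) _ _ ltac:(apply Rlt_le, Rinv_0_lt_compat; assumption) Hsc).
          cbv beta in Y.
          replace (fun i j => / INR k * (INR k * mpow B k i j)) with (mpow B k) in Y.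
          + apply Rmult_le_reg_l with (/ INR k); [apply Rinv_0_lt_compat; assumption|].
            rewrite <- Rmult_assoc, Rinv_l, Rmult_1_l by lra; assumption.
          + apply functional_extensionality; intros i; apply functional_extensionality; intros j.
            field; lra.
        - apply Rle_trans with (gamma (mmul Rs (power_sum B k) (power_sum B k))).
          + apply (gamma_mono _ _ (KS * KS)).
            * apply (op_bound_scal (INR k) (mpow B k) KB); [lra|assumption].
            * apply op_bound_mul; assumption.
            * apply power_sum_sqr_ge; [assumption|lia].
          + eapply Rle_trans; [apply (gamma_mul_le _ _ KS KS); assumption|].
            apply Rmult_le_compat; try exact GS; exact HS. }
      assert (H2 : s ^ S k <= t ^ S k * gamma (mpow B k)).
      { eapply Rle_trans; [apply Hlow|].
        replace (mpow A k) with (fun i j => t ^ S k * mpow B k i j).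
        - apply (gamma_scal_le _ _ KB); [apply pow_le; lra|assumption].
        - unfold B; rewrite mpow_scal.
          apply functional_extensionality; intros i; apply functional_extensionality; intros j.
          rewrite pow_inv; field; apply pow_nonzero; lra. }
      assert (tk : 0 <= t ^ S k) by (apply pow_le; lra).
      apply Rle_trans with (t ^ S k * gamma (mpow B k) * INR k);
        [apply Rmult_le_compat_r; lra|].
      rewrite Rmult_assoc; apply Rmult_le_compat_l; [assumption|lra]. }
    (* Letting [t] decrease to [s] at fixed [k] is possible because [M] depends on neither. *)
    assert (Hl : is_lim_seq (fun p => (s + h * / INR (S p)) ^ S k * (M * M)) (s ^ S k * (M * M))).
    { apply is_lim_seq_mult'; [|apply is_lim_seq_const].
      apply (is_lim_seq_continuous (fun x => x ^ S k) (fun p => s + h * / INR (S p)) s).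
      - apply derivable_continuous_pt, derivable_pt_pow.
      - replace (Finite s) with (Finite (s + h * 0)) by (f_equal; ring).
        apply is_lim_seq_plus'; [apply is_lim_seq_const|].
        apply is_lim_seq_mult'; [apply is_lim_seq_const|apply is_lim_seq_eps]. }
    assert (Z := is_lim_seq_le _ _ _ _ Hp (is_lim_seq_const _) Hl); simpl in Z.
    apply Rmult_le_reg_l with (s ^ S k); [apply pow_lt; assumption|exact Z]. }
  destruct (nfloor_ex (M * M)) as [q Hq]; [apply Rle_0_sqr|].
  assert (Y := Hk (S q) ltac:(lia)); rewrite S_INR in Y; lra.
Qed.

End LowerBound.

(** The Gelfand-type formula. The upper bound is [not_fredholm_le]; for the lower one [s] itself is
    shown to be non-Fredholm, the finite codimension of the range of [s - A] being contradictory. *)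
Lemma rho_ess_op_lim A : bounded_op A ->
  0 <= rho_ess_op Rs Lm A /\
  is_lim_seq (fun p => pw (gamma (mpow A p)) (/ INR (S p))) (rho_ess_op Rs Lm A) /\
  forall p, rho_ess_op Rs Lm A ^ S p <= gamma (mpow A p).
Proof.
  intros HA; destruct (gamma_mpow_fekete A HA) as [s [S0 [S1 S2]]].
  set (E := fun r => exists lam : C,
     ~ fredholm Lm (fun x => ssub (sscal lam x) (matapp Rs A x)) /\ r = Cmod lam).
  assert (Hub : forall r, E r -> r <= s)
    by (intros r [lam [Hlam ->]]; apply (not_fredholm_le A); assumption).
  assert (Heq : rho_ess_op Rs Lm A = s); [|rewrite Heq; split; [|split]; assumption].
  change (supR E = s); apply Rle_antisym; [apply supR_le; assumption|].
  destruct S0 as [S0|<-].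
  - apply (supR_ub E s); [assumption|]; exists (RtoC s); split;
      [|rewrite Cmod_R, Rabs_pos_eq; lra].
    intros [_ [d [w [Hw Hsurj]]]].
    assert (PA := bounded_op_posop A HA); assert (LA := linear_matapp A PA).
    destruct (approx_open (fun x => ssub (sscal (RtoC s) x) (matapp Rs A x)) d w)
      as [K [HK0 HK]]; try assumption.
    + split.
      * intros x y Hx Hy; rewrite (proj1 LA) by assumption; seq_ext; ring.
      * intros c x Hx; rewrite (proj2 LA) by assumption; seq_ext; ring.
    + intros x Hx; apply Lm_sub; [apply Lm_scal|apply Lm_matapp]; assumption.
    + destruct HA as [KA HA].
      apply (lower_bound_contradiction A KA s HA S0 S1 S2 K HK0 d w Hw HK).
  (* For [s = 0] the supremum is nonnegative whether or not any spectral point exists. *)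
  - apply (supR_ge0 E 0); intros r Hr; split; [|apply Hub; assumption].
    destruct Hr as [lam [_ ->]]; apply Cmod_ge_0.
Qed.

(** * Radii of sets of operators *)

Lemma mpow_mono A B p : bounded_op A -> bounded_op B -> mle A B -> mle (mpow A p) (mpow B p).
Proof. intros HA HB H; apply mprodn_mono; intros; split; [|split]; assumption. Qed.

Lemma gamma_op_mono A B : bounded_op A -> bounded_op B -> mle A B -> gamma A <= gamma B.
Proof. intros HA [K HB] H; apply (gamma_mono A B K); [apply bounded_op_nonneg|..]; assumption. Qed.

(** Entrywise order passes to powers and to [gamma_op], hence to the limit. *)
Lemma rho_mono A B : bounded_op A -> bounded_op B -> mle A B -> rho_ess_op Rs Lm A <= rho_ess_op Rs Lm B.
Proof.
  intros HA HB H.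
  apply (is_lim_seq_le (fun p => pw (gamma (mpow A p)) (/ INR (S p)))
    (fun p => pw (gamma (mpow B p)) (/ INR (S p))) (rho_ess_op Rs Lm A) (rho_ess_op Rs Lm B));
    [|apply rho_ess_op_lim; assumption|apply rho_ess_op_lim; assumption].
  intros p; apply pw_le; [apply inv_INR_gt0; lia|].
  apply gamma_op_mono; try apply bounded_op_mpow; try apply mpow_mono; assumption.
Qed.

(** The lower bound [rho^(n (p+1)) <= gamma (A^(n (p+1)))] is read as a statement on [(A^n)^(p+1)];
    roots and the limit in [p] follow. *)
Lemma rho_pow_le A n : bounded_op A -> (1 <= n)%nat ->
  rho_ess_op Rs Lm A ^ n <= rho_ess_op Rs Lm (mpow A (n - 1)).
Proof.
  intros HA Hn; destruct (rho_ess_op_lim A HA) as [R0 [_ R2]].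
  assert (HAn := bounded_op_mpow A (n - 1) HA).
  apply (is_lim_seq_le (fun _ => rho_ess_op Rs Lm A ^ n)
    (fun p => pw (gamma (mpow (mpow A (n - 1)) p)) (/ INR (S p)))
    (rho_ess_op Rs Lm A ^ n) (rho_ess_op Rs Lm (mpow A (n - 1))));
    [|apply is_lim_seq_const|apply rho_ess_op_lim; assumption].
  intros p; rewrite <- (pw_inv_pow (rho_ess_op Rs Lm A ^ n) (S p)) by (try apply pow_le; lia || assumption).
  apply pw_le; [apply inv_INR_gt0; lia|].
  rewrite <- pow_mult; replace (n * S p)%nat with (S (n * S p - 1)) by nia.
  eapply Rle_trans; [apply R2|].
  right; apply gamma_meq; [apply bounded_op_mpow; assumption|].
  apply (mprodn_blocks (fun _ => A) n p); [assumption|intros; assumption].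
Qed.

(** The operator quantity whose suprema over words define the radius selected by [b]: [true] is the
    generalized one, [false] the joint one. *)
Definition rad_op (b : bool) (A : mat) : R := if b then rho_ess_op Rs Lm A else gamma A.

Definition rad_set (b : bool) (Sig : mset) : R :=
  if b then rho_ess_set Rs Lm Sig else hat_rho_ess Rs Lm nrm Sig.

Lemma rad_op_ge0 b A : bounded_op A -> 0 <= rad_op b A.
Proof.
  intros HA; destruct b; simpl; [apply rho_ess_op_lim; assumption|].
  destruct HA as [K HA]; apply (gamma_ge0 A K HA).
Qed.

Lemma rad_op_le_K b A K : op_bound A K -> rad_op b A <= K.
Proof.
  intros HA; assert (G := gamma_le_K A K HA); destruct b; simpl; [|assumption].
  destruct (rho_ess_op_lim A (ex_intro _ K HA)) as [_ [_ H]]; specialize (H O).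
  change (mpow A 0) with A in H; simpl in H; lra.
Qed.

Lemma rad_op_mono b A B : bounded_op A -> bounded_op B -> mle A B -> rad_op b A <= rad_op b B.
Proof. intros; destruct b; simpl; [apply rho_mono|apply gamma_op_mono]; assumption. Qed.

Lemma bounded_op_meq A B : bounded_op A -> meq A B -> bounded_op B.
Proof.
  intros [K HA] [H1 H2]; exists K; apply (op_bound_dom B A K); try assumption.
  apply (nonneg_mle A); [apply HA|assumption].
Qed.

Lemma rad_op_meq b A B : bounded_op A -> meq A B -> rad_op b A = rad_op b B.
Proof.
  intros HA H; assert (HB := bounded_op_meq A B HA H); destruct H.
  apply Rle_antisym; apply rad_op_mono; assumption.
Qed.

(** Powers of the Hadamard product are dominated by the Hadamard product of the powers;
    [gamma_had_le] applies to these, then roots and limits are taken. *)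
Lemma rho_had_le m alpha F : (forall j, (j < m)%nat -> 0 < alpha j) -> 1 <= fsum m alpha ->
  (forall j, (j < m)%nat -> bounded_op (F j)) ->
  rho_ess_op Rs Lm (had m alpha F) <= fprod m (fun j => pw (rho_ess_op Rs Lm (F j)) (alpha j)).
Proof.
  intros Ha Hs HF; assert (HH : bounded_op (had m alpha F)) by (apply ex_op_bound_had; assumption).
  assert (HFp : forall p j, (j < m)%nat -> bounded_op (mpow (F j) p))
    by (intros; apply bounded_op_mpow, HF; assumption).
  apply (is_lim_seq_le (fun p => pw (gamma (mpow (had m alpha F) p)) (/ INR (S p)))
    (fun p => fprod m (fun j => pw (pw (gamma (mpow (F j) p)) (/ INR (S p))) (alpha j)))
    (rho_ess_op Rs Lm (had m alpha F))
    (fprod m (fun j => pw (rho_ess_op Rs Lm (F j)) (alpha j)))).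
  - intros p.
    rewrite (fprod_ext m _ (fun j => pw (pw (gamma (mpow (F j) p)) (alpha j)) (/ INR (S p))))
      by (intros; rewrite !pw_pw, Rmult_comm; reflexivity).
    rewrite <- (pw_fprod m (fun j => pw (gamma (mpow (F j) p)) (alpha j)))
      by (intros; apply pw_ge0).
    apply pw_le; [apply inv_INR_gt0; lia|].
    eapply Rle_trans; [|apply gamma_had_le; [assumption|assumption|exact (HFp p)]].
    apply gamma_op_mono; [apply bounded_op_mpow; assumption|apply ex_op_bound_had; [assumption|assumption|exact (HFp p)]|].
    exact (mprodn_had_le m alpha (fun _ => F) p Ha Hs (fun _ j _ Hj => HF j Hj)).
  - apply rho_ess_op_lim; assumption.
  - apply (is_lim_seq_fprod m (fun j p => pw (pw (gamma (mpow (F j) p)) (/ INR (S p))) (alpha j))).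
    intros j Hj; apply is_lim_seq_pw; [apply Ha; assumption|].
    apply rho_ess_op_lim, HF; assumption.
Qed.

Lemma rad_op_had_le b m alpha F :
  (forall j, (j < m)%nat -> 0 < alpha j) -> 1 <= fsum m alpha ->
  (forall j, (j < m)%nat -> bounded_op (F j)) ->
  rad_op b (had m alpha F) <= fprod m (fun j => pw (rad_op b (F j)) (alpha j)).
Proof. intros; destruct b; simpl; [apply rho_had_le|apply gamma_had_le]; assumption. Qed.

(** * Bounded sets of operators and their radii *)

Definition opset (Sig : mset) : Prop := exists K, 0 <= K /\ forall A, Sig A -> op_bound A K.

Lemma opset_bounded_op Sig A : opset Sig -> Sig A -> bounded_op A.
Proof. intros [K [_ H]] HA; exists K; apply H; assumption. Qed.

Lemma opset_setpow_bounded_op Sig p A : opset Sig -> (1 <= p)%nat -> setpow Rs Sig p A -> bounded_op A.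
Proof. intros [K [_ H]] Hp HA; exists (K ^ p); apply (setpow_op_bound Sig); assumption. Qed.

Lemma opset_setpow Sig p : opset Sig -> (1 <= p)%nat -> opset (setpow Rs Sig p).
Proof.
  intros [K [K0 H]] Hp; exists (K ^ p); split; [apply pow_le; assumption|].
  intros A HA; apply (setpow_op_bound Sig); assumption.
Qed.

Lemma opset_setsum k F : (forall i, (i < k)%nat -> opset (F i)) -> opset (setsum k F).
Proof.
  intros H; destruct (choice_lt 0 k (fun i K => 0 <= K /\ forall A, F i A -> op_bound A K) H) as [K HK].
  exists (fsum k K); split; [apply fsum_ge0; intros; apply HK; assumption|].
  intros M [A [HA ->]]; apply op_bound_fsum; intros j Hj; apply HK; [|apply HA]; assumption.
Qed.

Lemma op_bound_le A K K' : K <= K' -> op_bound A K -> op_bound A K'.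
Proof.
  intros HK [H0 [H1 H2]]; split; [lra|split; [assumption|apply (tail_bound_le 0 A K); assumption]].
Qed.

Lemma opset_hgeo m alpha Phi : (forall j, (j < m)%nat -> 0 < alpha j) -> 1 <= fsum m alpha ->
  (forall j, (j < m)%nat -> opset (Phi j)) -> opset (hgeo m Phi alpha).
Proof.
  intros Ha Hs H.
  destruct (choice_lt 0 m (fun j K => 0 <= K /\ forall A, Phi j A -> op_bound A K) H) as [K HK].
  (* [op_bound_had] requires strictly positive bounds, hence the shift by 1. *)
  exists (fprod m (fun j => pw (K j + 1) (alpha j))); split;
    [apply fprod_ge0; intros; apply pw_ge0|].
  intros M [A [HA ->]].
  apply (op_bound_had m alpha Ha Hs A (fun j => K j + 1)); intros j Hj; destruct (HK j Hj) as [K0 HKj].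
  split; [lra|apply (op_bound_le _ (K j)); [lra|apply HKj, HA; assumption]].
Qed.

Definition rad_sup (b : bool) (Sig : mset) (p : nat) : R :=
  supR (fun x => exists A, setpow Rs Sig p A /\ x = rad_op b A).

Definition rad_seq (b : bool) (Sig : mset) (p : nat) : R := pw (rad_sup b Sig p) (/ INR p).

Lemma rad_sup_bounds b Sig K p : 0 <= K -> (forall A, Sig A -> op_bound A K) -> (1 <= p)%nat ->
  (forall A, setpow Rs Sig p A -> rad_op b A <= rad_sup b Sig p) /\ 0 <= rad_sup b Sig p <= K ^ p.
Proof.
  intros K0 HK Hp.
  assert (Hb : forall y, (exists A, setpow Rs Sig p A /\ y = rad_op b A) -> 0 <= y <= K ^ p).
  { intros y [A [HA ->]]; assert (HA' := setpow_op_bound Sig K p A HK Hp HA).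
    split; [apply rad_op_ge0; exists (K ^ p)|apply rad_op_le_K]; assumption. }
  split; [|split].
  - intros A HA; apply (supR_ub _ (K ^ p)); [intros; apply Hb; assumption|].
    exists A; split; [assumption|reflexivity].
  - apply (supR_ge0 _ (K ^ p)); assumption.
  - apply supR_le; [apply pow_le; assumption|intros; apply Hb; assumption].
Qed.

Lemma rad_sup_ub b Sig p A : opset Sig -> (1 <= p)%nat -> setpow Rs Sig p A ->
  rad_op b A <= rad_sup b Sig p.
Proof. intros [K [K0 HK]] Hp; apply (rad_sup_bounds b Sig K p); assumption. Qed.

Lemma rad_sup_ge0 b Sig p : opset Sig -> (1 <= p)%nat -> 0 <= rad_sup b Sig p.
Proof. intros [K [K0 HK]] Hp; apply (rad_sup_bounds b Sig K p); assumption. Qed.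

Lemma rad_sup_le b Sig p c : 0 <= c ->
  (forall A, setpow Rs Sig p A -> rad_op b A <= c) -> rad_sup b Sig p <= c.
Proof. intros Hc H; apply supR_le; [assumption|intros y [A [HA ->]]; apply H; assumption]. Qed.

Lemma inv_INR_mult n l : (1 <= n)%nat -> (1 <= l)%nat -> / INR (n * l) = / INR n * / INR l.
Proof. intros; rewrite mult_INR; apply Rinv_mult. Qed.

(** If [A] is a word of length [l], then [A^n] is a word of length [n * l], and
    [rho(A)^n <= rho(A^n)]. *)
Lemma rad_seq_multiple Sig n l : opset Sig -> (1 <= n)%nat -> (1 <= l)%nat ->
  rad_seq true Sig l <= rad_seq true Sig (n * l).
Proof.
  intros HS Hn Hl; unfold rad_seq; rewrite inv_INR_mult, <- pw_pw by assumption.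
  apply pw_le; [apply inv_INR_gt0; assumption|].
  apply rad_sup_le; [apply pw_ge0|]; intros A HA.
  assert (eA : bounded_op A) by (apply (opset_setpow_bounded_op Sig l); assumption).
  destruct (setpow_unblocks Sig l n (fun _ => A)) as [M [HM HeqM]];
    [intros; apply (opset_bounded_op Sig); assumption|assumption|assumption|intros; assumption|].
  rewrite Nat.mul_comm in HM.
  rewrite <- (pw_inv_pow (rad_op true A) n) by (try apply rad_op_ge0; assumption).
  apply pw_le; [apply inv_INR_gt0; assumption|].
  eapply Rle_trans; [apply rho_pow_le; assumption|].
  change (rad_op true (mpow A (n - 1)) <= rad_sup true Sig (n * l)).
  rewrite (rad_op_meq true _ M) by (try apply bounded_op_mpow; assumption).
  apply rad_sup_ub; [assumption|nia|assumption].
Qed.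

Lemma rad_sup_submult Sig p l : opset Sig -> (1 <= p)%nat -> (1 <= l)%nat ->
  rad_sup false Sig (p + l) <= rad_sup false Sig p * rad_sup false Sig l.
Proof.
  intros HS Hp Hl.
  apply rad_sup_le; [apply Rmult_le_pos; apply rad_sup_ge0; assumption|].
  intros A HA.
  destruct (setpow_split Sig p l A) as [P [Q [HP [HQ Heq]]]]; try assumption;
    [intros; apply (opset_bounded_op Sig); assumption|].
  rewrite (rad_op_meq false A (mmul Rs P Q))
    by (try apply (opset_setpow_bounded_op Sig (p + l)); assumption || lia).
  assert (eP := opset_setpow_bounded_op Sig p P HS Hp HP).
  assert (eQ := opset_setpow_bounded_op Sig l Q HS Hl HQ).
  apply Rle_trans with (rad_op false P * rad_op false Q).
  - destruct eP as [KP eP], eQ as [KQ eQ]; apply (gamma_mul_le P Q KP KQ); assumption.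
  - apply Rmult_le_compat; try apply rad_op_ge0; try apply rad_sup_ub; assumption.
Qed.

Lemma radius_of_rad_set b Sig : opset Sig -> radius_of b (rad_seq b Sig) (rad_set b Sig).
Proof.
  intros HS; destruct b; simpl.
  - destruct HS as [K [K0 HK]]; assert (HS : opset Sig) by (exists K; split; assumption).
    set (E := fun r => exists p, (1 <= p)%nat /\ r = rad_seq true Sig p).
    assert (Hlub : is_lub E (supR E)).
    { apply (supR_is_lub E K (rad_seq true Sig 1)).
      - intros y [p [Hp ->]]; rewrite <- (pw_inv_pow K p) by assumption.
        apply pw_le; [apply inv_INR_gt0; assumption|].
        apply (rad_sup_bounds true Sig K p); assumption.
      - exists 1%nat; split; [lia|reflexivity]. }
    change (rho_ess_set Rs Lm Sig) with (supR E); split; [|split].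
    + intros l Hl; apply Hlub; exists l; split; [assumption|reflexivity].
    + intros c Hc; apply Hlub; intros y [p [Hp ->]]; apply Hc; assumption.
    + intros n l Hn Hl; apply rad_seq_multiple; assumption.
  - destruct (fekete (rad_sup false Sig)) as [r [_ [Hr _]]].
    + intros p Hp; apply rad_sup_ge0; assumption.
    + intros p l Hp Hl; apply rad_sup_submult; assumption.
    + change (is_lim_seq (fun p => rad_seq false Sig (S p))
        (real (Lim_seq (fun p => rad_seq false Sig (S p))))).
      rewrite (is_lim_seq_unique (fun p => rad_seq false Sig (S p)) r Hr); exact Hr.
Qed.

Lemma rad_set_ge0 b Sig : opset Sig -> 0 <= rad_set b Sig.
Proof.
  intros HS; assert (H := radius_of_rad_set b Sig HS); destruct b; simpl in H.
  - eapply Rle_trans; [|apply (proj1 H 1%nat); lia]; apply pw_ge0.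
  - apply (is_lim_seq_le (fun _ => 0) (fun p => rad_seq false Sig (S p)) 0 (rad_set false Sig));
      [intros; apply pw_ge0|apply is_lim_seq_const|assumption].
Qed.

(** The common comparison principle. Words of length [p * l] on the left meet words of length
    [n * l] on the right, so normalising both sides turns the exponent [alpha j] into
    [n * alpha j / p]. *)
Lemma rad_set_le_prod b J alpha (Sig : mset) (Sigs : nat -> mset) n p :
  (forall j, (j < J)%nat -> 0 < alpha j) -> opset Sig -> (forall j, (j < J)%nat -> opset (Sigs j)) ->
  (1 <= n)%nat -> (1 <= p)%nat ->
  (forall l M, (1 <= l)%nat -> setpow Rs Sig (p * l) M -> exists F,
     (forall j, (j < J)%nat -> setpow Rs (Sigs j) (n * l) (F j)) /\
     rad_op b M <= fprod J (fun j => pw (rad_op b (F j)) (alpha j))) ->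
  rad_set b Sig <= fprod J (fun j => pw (rad_set b (Sigs j)) (INR n * alpha j * / INR p)).
Proof.
  intros Ha HS HSs Hn Hp H; assert (Hpi := inv_INR_gt0 p Hp); assert (Hni := INR_gt0 n Hn).
  apply (radius_of_le_prod b J (fun j => INR n * alpha j * / INR p)
           (fun j l => rad_seq b (Sigs j) (n * l)) (fun j => rad_set b (Sigs j))
           (fun l => rad_seq b Sig (p * l))).
  - intros j Hj; apply Rmult_lt_0_compat; [apply Rmult_lt_0_compat; [|apply Ha]|]; assumption.
  - intros j Hj; apply (radius_of_multiples b (rad_seq b (Sigs j))); [assumption|].
    apply radius_of_rad_set, HSs; assumption.
  - apply (radius_of_multiples b (rad_seq b Sig)); [assumption|].
    apply radius_of_rad_set; assumption.
  - intros l Hl; assert (Hpl : (1 <= p * l)%nat) by nia; assert (Hnl : (1 <= n * l)%nat) by nia.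
    apply Rle_trans with
      (pw (fprod J (fun j => pw (rad_sup b (Sigs j) (n * l)) (alpha j))) (/ INR (p * l))).
    + apply pw_le; [apply inv_INR_gt0; assumption|].
      apply rad_sup_le; [apply fprod_ge0; intros; apply pw_ge0|]; intros M HM.
      destruct (H l M Hl HM) as [F [HF Hle]]; eapply Rle_trans; [apply Hle|].
      apply fprod_le; intros j Hj; split; [apply pw_ge0|].
      apply pw_le; [apply Ha; assumption|].
      apply rad_sup_ub; [apply HSs|assumption|apply HF]; assumption.
    + rewrite pw_fprod by (intros; apply pw_ge0); right; apply fprod_ext; intros j Hj.
      unfold rad_seq; rewrite !pw_pw; f_equal; rewrite !inv_INR_mult by assumption.
      assert (Hli := INR_gt0 l Hl); assert (Hp0 := INR_gt0 p Hp); field; lra.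
Qed.

Lemma rad_set_le_pw b (Sig Sig' : mset) p : opset Sig -> opset Sig' -> (1 <= p)%nat ->
  (forall l M, (1 <= l)%nat -> setpow Rs Sig (p * l) M -> exists M',
     setpow Rs Sig' l M' /\ mle M M') ->
  rad_set b Sig <= pw (rad_set b Sig') (/ INR p).
Proof.
  intros HS HS' Hp H.
  replace (pw (rad_set b Sig') (/ INR p))
    with (fprod 1 (fun j => pw (rad_set b Sig') (INR 1 * (fun _ => 1) j * / INR p)))
    by (simpl; rewrite !Rmult_1_l; reflexivity).
  apply (rad_set_le_prod b 1 (fun _ => 1) Sig (fun _ => Sig') 1 p); try assumption; try lia;
    try (intros; lra); [intros; assumption|].
  intros l M Hl HM; destruct (H l M Hl HM) as [M' [HM' Hle]].
  exists (fun _ => M'); rewrite Nat.mul_1_l; split; [intros; assumption|].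
  assert (eM' := opset_setpow_bounded_op Sig' l M' HS' Hl HM').
  simpl; rewrite Rmult_1_l, pw_1 by (apply rad_op_ge0; assumption).
  apply rad_op_mono; [|assumption|assumption].
  apply (opset_setpow_bounded_op Sig (p * l)); [assumption|nia|assumption].
Qed.

(** [mprodn_had_le] moves the outer product into each Hadamard factor, where the [l] inner words of
    length [n] are concatenated. Inner length 1 serves the second inequality of the chain, inner
    length [n] the third. *)
Lemma hgeo_pow_dominated m alpha (Sigs : nat -> mset) n l M :
  (forall j, (j < m)%nat -> 0 < alpha j) -> 1 <= fsum m alpha ->
  (forall j, (j < m)%nat -> opset (Sigs j)) -> (1 <= n)%nat -> (1 <= l)%nat ->
  setpow Rs (hgeo m (fun j => setpow Rs (Sigs j) n) alpha) l M ->
  exists G, (forall j, (j < m)%nat -> setpow Rs (Sigs j) (n * l) (G j)) /\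
    (forall j, (j < m)%nat -> bounded_op (G j)) /\ bounded_op M /\ mle M (had m alpha G).
Proof.
  intros Ha Hs HS Hn Hl HM.
  assert (eM : bounded_op M).
  { refine (opset_setpow_bounded_op _ l M _ Hl HM).
    apply opset_hgeo; try assumption; intros; apply opset_setpow; [apply HS|]; assumption. }
  destruct HM as [D [HD ->]].
  destruct (choice_lt (fun _ _ _ => 0) l (fun i F =>
    (forall j, (j < m)%nat -> setpow Rs (Sigs j) n (F j)) /\ D i = had m alpha F) HD) as [F HF].
  assert (eF : forall i j, (i < l)%nat -> (j < m)%nat -> bounded_op (F i j)).
  { intros i j Hi Hj; apply (opset_setpow_bounded_op (Sigs j) n); [apply HS|assumption|apply HF]; assumption. }
  destruct (choice_lt (fun _ _ => 0) m (fun j G => setpow Rs (Sigs j) (n * l) G /\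
              meq (mprodn Rs (fun i => F i j) (l - 1)) G)) as [G HG].
  { intros j Hj; apply setpow_unblocks; try assumption.
    - intros A; apply opset_bounded_op, HS; assumption.
    - intros i Hi; apply HF; assumption. }
  assert (eP : forall j, (j < m)%nat -> bounded_op (mprodn Rs (fun i => F i j) (l - 1)))
    by (intros; apply bounded_op_mprodn; intros; apply eF; [lia|assumption]).
  exists G; split; [intros; apply HG; assumption|split; [|split; [assumption|]]].
  - intros j Hj; apply (opset_setpow_bounded_op (Sigs j) (n * l)); [apply HS|nia|apply HG]; assumption.
  - rewrite (mprodn_ext D (fun i => had m alpha (F i))) by (intros; apply HF; lia).
    eapply mle_trans; [apply mprodn_had_le; try assumption; intros; apply eF; [lia|assumption]|].
    apply had_mono; [assumption|]; intros j Hj.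
    split; [apply bounded_op_nonneg, eP|apply HG]; assumption.
Qed.

Lemma mprodn_dominated (Sig Sig' : mset) l M : opset Sig -> opset Sig' -> (1 <= l)%nat ->
  (forall A, Sig A -> exists A', Sig' A' /\ mle A A') ->
  setpow Rs Sig l M -> exists M', setpow Rs Sig' l M' /\ mle M M'.
Proof.
  intros HS HS' Hl H [D [HD ->]].
  destruct (choice_lt (fun _ _ => 0) l (fun i A' => Sig' A' /\ mle (D i) A')) as [D' HD'].
  { intros i Hi; apply H, HD; assumption. }
  exists (mprodn Rs D' (l - 1)); split.
  - exists D'; split; [intros; apply HD'; assumption|reflexivity].
  - apply mprodn_mono; intros i Hi; split; [|split].
    + apply (opset_bounded_op Sig); [|apply HD; lia]; assumption.
    + apply (opset_bounded_op Sig'); [|apply HD'; lia]; assumption.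
    + apply HD'; lia.
Qed.

(** * The chain of inequalities *)

Lemma rad_set_chain m alpha n k (Psi : nat -> nat -> mset) b :
  (forall j, (j < m)%nat -> 0 < alpha j) -> 1 <= fsum m alpha -> (1 <= n)%nat ->
  (forall i j, (i < k)%nat -> (j < m)%nat -> opset (Psi i j)) ->
  let Sj := fun j => setsum k (fun i => Psi i j) in
  rad_set b (setsum k (fun i => hgeo m (fun j => Psi i j) alpha)) <= rad_set b (hgeo m Sj alpha) /\
  rad_set b (hgeo m Sj alpha) <=
    pw (rad_set b (hgeo m (fun j => setpow Rs (Sj j) n) alpha)) (/ INR n) /\
  pw (rad_set b (hgeo m (fun j => setpow Rs (Sj j) n) alpha)) (/ INR n) <=
    fprod m (fun j => pw (rad_set b (Sj j)) (alpha j)).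
Proof.
  intros Ha Hs Hn HPsi Sj.
  assert (OS : forall j, (j < m)%nat -> opset (Sj j))
    by (intros; apply opset_setsum; intros; apply HPsi; assumption).
  assert (OH : opset (hgeo m Sj alpha)) by (apply opset_hgeo; assumption).
  assert (OHn : opset (hgeo m (fun j => setpow Rs (Sj j) n) alpha)).
  { apply opset_hgeo; try assumption; intros; apply opset_setpow; [apply OS|]; assumption. }
  assert (O1 : opset (setsum k (fun i => hgeo m (fun j => Psi i j) alpha))).
  { apply opset_setsum; intros; apply opset_hgeo; try assumption; intros; apply HPsi; assumption. }
  split; [|split].
  - rewrite <- (pw_1 (rad_set b (hgeo m Sj alpha))) by (apply rad_set_ge0; assumption).
    rewrite <- Rinv_1; apply (rad_set_le_pw b _ _ 1); try assumption; [lia|].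
    intros l M Hl HM; rewrite Nat.mul_1_l in HM.
    eapply mprodn_dominated; try eassumption; intros A [D [HD ->]].
    destruct (choice_lt (fun _ _ _ => 0) k (fun i F =>
      (forall j, (j < m)%nat -> Psi i j (F j)) /\ D i = had m alpha F) HD) as [F HF].
    exists (had m alpha (fun j r s => fsum k (fun i => F i j r s))); split.
    + eexists; split; [|reflexivity]; intros j Hj; exists (fun i => F i j).
      split; [intros; apply HF; assumption|reflexivity].
    + intros r s Hr Hs'.
      rewrite (fsum_ext k _ (fun i => had m alpha (F i) r s))
        by (intros i Hi; rewrite (proj2 (HF i Hi)); reflexivity).
      (* Hoelder at a fixed entry: a sum of Hadamard products is at most the Hadamard product of the
         sums. *)
      apply (hoelder_fsum k m alpha _ (fun j i => F i j r s)); try assumption.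
      * intros j i Hj Hi; apply bounded_op_nonneg; try assumption.
        apply (opset_bounded_op (Psi i j)); [apply HPsi|apply HF]; assumption.
      * intros j Hj; apply Rle_refl.
  - apply rad_set_le_pw; try assumption; intros l M Hl HM.
    destruct (setpow_blocks (hgeo m Sj alpha) n l M) as [B [HB Heq]]; try assumption;
      [intros A; apply opset_bounded_op; assumption|].
    destruct (choice_lt (fun _ _ => 0) l (fun i A' =>
      hgeo m (fun j => setpow Rs (Sj j) n) alpha A' /\ mle (B i) A')) as [D HD].
    { intros i Hi.
      (* A word of length [n * l] was cut into [l] blocks; each block of [n] Hadamard products is
         dominated by one Hadamard product of words of length [n]. *)
      destruct (hgeo_pow_dominated m alpha Sj 1 n (B i)) as [G [HG [_ [_ HG']]]]; try assumption; [lia| |].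
      - destruct (HB i Hi) as [C [HC ->]]; exists C; split; [|reflexivity]; intros q Hq.
        destruct (HC q Hq) as [F [HF ->]]; exists F; split; [|reflexivity].
        intros j Hj; exists (fun _ => F j); split; [intros; apply HF; assumption|reflexivity].
      - exists (had m alpha G); split; [|assumption].
        exists G; split; [|reflexivity].
        intros j Hj; rewrite <- (Nat.mul_1_l n); apply HG; assumption. }
    exists (mprodn Rs D (l - 1)); split.
    + exists D; split; [intros; apply HD; assumption|reflexivity].
    + eapply mle_trans; [apply Heq|]; apply mprodn_mono; intros i Hi; split; [|split].
      * apply (opset_setpow_bounded_op (hgeo m Sj alpha) n); [assumption|assumption|apply HB; lia].
      * apply (opset_bounded_op _ _ OHn), HD; lia.
      * apply HD; lia.
  (* Words of length [l] on the left correspond to words of length [n * l] in the factors, so the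
     exponents are [n * alpha j] until the outer root is taken. *)
  - assert (H3 : rad_set b (hgeo m (fun j => setpow Rs (Sj j) n) alpha) <=
              fprod m (fun j => pw (rad_set b (Sj j)) (INR n * alpha j * / INR 1))).
    { apply rad_set_le_prod; try assumption; [lia|]; intros l M Hl HM.
      rewrite Nat.mul_1_l in HM.
      destruct (hgeo_pow_dominated m alpha Sj n l M) as [G [HG [eG [eM Hle]]]]; try assumption.
      exists G; split; [assumption|].
      eapply Rle_trans; [|apply rad_op_had_le; assumption].
      apply rad_op_mono; [assumption|apply ex_op_bound_had; assumption|assumption]. }
    eapply Rle_trans; [apply (pw_le _ _ _ (inv_INR_gt0 n Hn) H3)|].
    rewrite pw_fprod by (intros; apply pw_ge0); right; apply fprod_ext; intros j Hj.
    rewrite pw_pw; f_equal; simpl; assert (Hn' := INR_gt0 n Hn); field; lra.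
Qed.

End Space.

(** * Order continuity and the conclusion *)

(** The tails of [|x|] form a net indexed by [nat] that decreases to 0. *)
Lemma tail_vanishes Rs Lm nrm : in_class_L Rs Lm nrm -> order_cont_L Lm nrm ->
  forall x, Lm x -> forall eps, 0 < eps ->
  exists N, forall n, (N <= n)%nat -> nrm (tail n x) < eps.
Proof.
  intros HL HoL x Hx eps Heps.
  assert (Hax := Lm_absv Rs Lm nrm HL x Hx).
  destruct (HoL nat le (fun n => tail n (absv x))) with (eps := eps) as [N HN].
  - split; [exact (inhabits O)|split; [apply Nat.le_refl|split; [apply Nat.le_trans|]]].
    intros p q; exists (p + q)%nat; lia.
  - intros n; split; [apply (Lm_tail Rs Lm nrm HL); assumption|].
    intros i; unfold tail, absv; destruct (Nat.ltb i n); simpl; split; try lra; apply Cmod_ge_0.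
  - intros p q Hpq i; unfold tail, absv.
    assert (H := Cmod_ge_0 (x i)).
    destruct (Nat.ltb_spec i p), (Nat.ltb_spec i q); simpl; try lia; lra.
  (* Coordinate [i] of the tail from [i + 1] on is 0, so every lower bound is nonpositive there. *)
  - intros h _ _ Hh i; specialize (Hh (S i) i); unfold tail in Hh.
    destruct (Nat.ltb_spec i (S i)); [exact Hh|lia].
  - assumption.
  - exists N; intros n Hn; specialize (HN n Hn).
    replace (tail n (absv x)) with (absv (tail n x)) in HN.
    + rewrite (nrm_absv Rs Lm nrm HL) in HN by (apply (Lm_tail Rs Lm nrm HL); assumption).
      assumption.
    + apply functional_extensionality; intros i; unfold absv, tail.
      destruct (Nat.ltb i n); [rewrite Cmod_0|]; reflexivity.
Qed.

Lemma opset_of_bounded Rs Lm nrm Psi : in_class_L Rs Lm nrm -> bounded_set Rs Lm nrm Psi ->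
  (forall A, Psi A -> nonneg_mat Rs A /\ defines_op Rs Lm A) -> opset Rs Lm nrm Psi.
Proof.
  (* The constant in [bounded_set] may be negative, while [opset] asks for a nonnegative one. *)
  intros HL [K HK] H; exists (Rmax K 0); split; [apply Rmax_r|].
  intros A HA; split; [apply Rmax_r|split; [apply H; assumption|]].
  intros x Hx; rewrite tail_0; eapply Rle_trans; [apply HK; assumption|].
  apply Rmult_le_compat_r; [apply (nrm_ge0 Rs Lm nrm HL); assumption|apply Rmax_l].
Qed.

Theorem theorem4p1
  (Rs : option nat) (Lm : seqC -> Prop) (nrm : seqC -> R)
  (HL : in_class_L Rs Lm nrm)
  (HoL : order_cont_L Lm nrm)
  (HoD : order_cont_dual Lm nrm)
  (m : nat) (alpha : nat -> R)
  (Hpos : forall j, (j < m)%nat -> 0 < alpha j)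
  (Hsum : 1 <= fsum m alpha)
  (n : nat) (Hn : (1 <= n)%nat)
  (k : nat) (Hk : (1 <= k)%nat)
  (Psi : nat -> nat -> mset)
  (HPsi : forall i j, (i < k)%nat -> (j < m)%nat ->
     bounded_set Rs Lm nrm (Psi i j) /\
     (forall A, Psi i j A -> nonneg_mat Rs A /\ defines_op Rs Lm A))
  (b : bool) :
  let r := fun S : mset => if b then rho_ess_set Rs Lm S else hat_rho_ess Rs Lm nrm S in
  let Sj := fun j => setsum k (fun i => Psi i j) in
  r (setsum k (fun i => hgeo m (fun j => Psi i j) alpha)) <= r (hgeo m Sj alpha) /\
  r (hgeo m Sj alpha) <=
    pw (r (hgeo m (fun j => setpow Rs (Sj j) n) alpha)) (/ INR n) /\
  pw (r (hgeo m (fun j => setpow Rs (Sj j) n) alpha)) (/ INR n) <=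
    fprod m (fun j => pw (r (Sj j)) (alpha j)).
Proof.
  apply (rad_set_chain Rs Lm nrm HL (tail_vanishes Rs Lm nrm HL HoL)); try assumption.
  intros i j Hi Hj; destruct (HPsi i j Hi Hj); apply opset_of_bounded; assumption.
Qed.
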